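(* Let $T>0$ and let $(u,\zeta_1,\zeta_2)$ be the weak solution on $[0,T]$ (as defined in the context), and assume $u\in H^2(0,T;\tilde H^4_0(0,L))\cap H^4(0,T;\tilde H^2_0(0,L))$ and $\zeta_1,\zeta_2\in H^3(0,T;\mathbb{R}^r)$. Let $z(t_n)=[u(t_n)\ u_t(t_n)\ \zeta_1(t_n)\ \zeta_2(t_n)]^\top$, and let $z^n=[u^n\ v^n\ \zeta^n_1\ \zeta^n_2]^\top$ be the solution of the Crank–Nicolson scheme at $t_n=n\Delta t$ with cubic Hermite elements of mesh size $h$ (as defined in the context). Then there is a constant $C$, independent of $h$, $\Delta t$, $n$ and of the solution, such that for every $n\in\{0,1,\dots,S\}$, $T=S\Delta t$, $$\|z^n-z(t_n)\|\le C\Big[\|z^0_e\|+h^2\|u\|_{H^2(0,T;H^4(0,L))}+(\Delta t)^2\Big(\|u_{tt}\|_{L^2(0,T;H^4(0,L))}+\|u_{tt}\|_{H^2(0,T;H^2(0,L))}+\|(\zeta_1)_{tt}\|_{H^1(0,T;\mathbb{R}^r)}+\|(\zeta_2)_{tt}\|_{H^1(0,T;\mathbb{R}^r)}\Big)\Big],$$ where $z^0_e=[u^0-\breve u(0)\ \ v^0-\breve u_t(0)\ \ \zeta_1^0-\zeta_1(0)\ \ \zeta_2^0-\zeta_2(0)]^\top$ and $\breve u(t)\in W_h$ is the projection of $u(t)$ defined in the context.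
   Context: Coefficients. Fix $L>0$, an integer $r\ge1$, constants $M,J,k_1,k_2>0$, and strictly positive functions $\mu,\Lambda\in C^4[0,L]$. For $j=1,2$ let $A_j\in\mathbb{R}^{r\times r}$ be Hurwitz (all eigenvalues have negative real part), $b_j,c_j\in\mathbb{R}^r$, and $d_j,\delta_j\in\mathbb{R}$ such that the transfer function $\mathcal{G}_j(s)=\big((s\,\mathrm{Id}-A_j)^{-1}b_j\big)\cdot c_j+d_j$ satisfies $\operatorname{Re}\mathcal{G}_j(i\omega)\ge d_j\ge\delta_j>0$ for all $\omega\ge0$. Fix symmetric positive definite matrices $P_j\in\mathbb{R}^{r\times r}$, scalars $\epsilon_j>0$ and vectors $q_j\in\mathbb{R}^r$ (existing by the Kalman–Yakubovich–Popov lemma) with $P_jA_j+A_j^\top P_j=-q_jq_j^\top-\epsilon_jP_j$ and $P_jb_j=c_j-q_j\sqrt{2(d_j-\delta_j)}$, $j=1,2$. Spaces. $\tilde H^k_0(0,L):=\{u\in H^k(0,L):u(0)=u_x(0)=0\}$. $H:=\mathbb{R}\times\mathbb{R}\times L^2(0,L)$, with elements $\hat\varphi=({}^1\hat\varphi,{}^2\hat\varphi,{}^3\hat\varphi)$ and inner product $J\,({}^1\hat\varphi)({}^1\hat\nu)+M\,({}^2\hat\varphi)({}^2\hat\nu)+(\mu\,{}^3\hat\varphi,{}^3\hat\nu)_{L^2}$. $V:=\{\hat w=(w_x(L),w(L),w): w\in\tilde H^2_0(0,L)\}$ with inner product $(\hat w_1,\hat w_2)_V=(\Lambda(w_1)_{xx},(w_2)_{xx})_{L^2}$;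 $V\subset H\subset V'$ is a Gelfand triple with duality pairing ${}_{V'}\langle\cdot,\cdot\rangle_V$ extending the inner product of $H$. For $w_1,w_2\in\tilde H^2_0(0,L)$ let $$a(w_1,w_2)=\int_0^L\Lambda(w_1)_{xx}(w_2)_{xx}\,dx+k_1(w_1)_x(L)(w_2)_x(L)+k_2w_1(L)w_2(L).$$ Weak solution. $(u,\zeta_1,\zeta_2)$ is the weak solution on $(0,T)$ if $\hat u=(u_x(L),u(L),u)\in L^2(0,T;V)\cap H^1(0,T;H)\cap H^2(0,T;V')$, $\zeta_1,\zeta_2\in H^1(0,T;\mathbb{R}^r)$, and for a.e. $t\in(0,T)$ and all $\hat w\in V$ $${}_{V'}\langle\hat u_{tt},\hat w\rangle_V+a(u,w)+d_1({}^1\hat u_t)w_x(L)+d_2({}^2\hat u_t)w(L)+c_1\cdot\zeta_1\,w_x(L)+c_2\cdot\zeta_2\,w(L)=0,$$ $(\zeta_1)_t=A_1\zeta_1+b_1({}^1\hat u_t)$, $(\zeta_2)_t=A_2\zeta_2+b_2({}^2\hat u_t)$, with initial data $\hat u(0)=\hat u_0\in V$, $\hat u_t(0)=\hat v_0\in H$, $\zeta_i(0)=\zeta_{i,0}\in\mathbb{R}^r$. It exists and is unique. Discrete space. Let $P\in\mathbb{N}$, $h=L/P$, $x_m=mh$ for $m=0,\dots,P$. $W_h\subset\tilde H^2_0(0,L)$ is the space of $C^1[0,L]$ functions that are cubic polynomials on each $[x_{m-1},x_m]$ and vanish together with their first derivative at $x=0$; let $w_1,\dots,w_N$, $N=2P$,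 be a basis (the Hermite cubic basis). For $t\in[0,T]$, $\breve u(t)\in W_h$ is defined by $a(\breve u(t),w_h)=a(u(t),w_h)$ for all $w_h\in W_h$. Crank–Nicolson scheme. Let $S\in\mathbb{N}$, $\Delta t=T/S$, $t_n=n\Delta t$. Define for $i,j=1,\dots,N$ $\mathbb{A}_{i,j}=\int_0^L\mu w_iw_j\,dx+Mw_i(L)w_j(L)+J(w_i)_x(L)(w_j)_x(L)$, $\mathbb{B}_{i,j}=d_1(w_i)_x(L)(w_j)_x(L)+d_2w_i(L)w_j(L)$, $\mathbb{K}_{i,j}=a(w_i,w_j)$. The discrete solution is $z^n=[u^n\ v^n\ \zeta_1^n\ \zeta_2^n]^\top$ with $u^n,v^n\in W_h$, $\zeta_1^n,\zeta_2^n\in\mathbb{R}^r$; $\mathbb{U}^n,\mathbb{V}^n\in\mathbb{R}^N$ are the coefficient vectors of $u^n,v^n$, and $(\mathbb{C}^n)_j:=c_1\cdot\zeta_1^n\,(w_j)_x(L)+c_2\cdot\zeta_2^n\,w_j(L)$. Starting from given $z^0$, $$\frac{\mathbb{U}^{n+1}-\mathbb{U}^n}{\Delta t}=\frac12(\mathbb{V}^{n+1}+\mathbb{V}^n),$$ $$\frac{\mathbb{A}\mathbb{V}^{n+1}-\mathbb{A}\mathbb{V}^n}{\Delta t}=-\frac12(\mathbb{K}\mathbb{U}^{n+1}+\mathbb{K}\mathbb{U}^n)-\frac12(\mathbb{B}\mathbb{V}^{n+1}+\mathbb{B}\mathbb{V}^n)-\frac12(\mathbb{C}^{n+1}+\mathbb{C}^n),$$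 $$\frac{\zeta_1^{n+1}-\zeta_1^n}{\Delta t}=A_1\frac{\zeta_1^{n+1}+\zeta_1^n}{2}+b_1\frac{v^{n+1}_x(L)+v^n_x(L)}{2},$$ $$\frac{\zeta_2^{n+1}-\zeta_2^n}{\Delta t}=A_2\frac{\zeta_2^{n+1}+\zeta_2^n}{2}+b_2\frac{v^{n+1}(L)+v^n(L)}{2}.$$ Norm. For $z=[u\ v\ \zeta_1\ \zeta_2]^\top$ with $u,v\in\tilde H^2_0(0,L)$, $\zeta_1,\zeta_2\in\mathbb{R}^r$, $$\|z\|^2:=\frac12\int_0^L\Lambda u_{xx}^2\,dx+\frac12\int_0^L\mu v^2\,dx+\frac M2v(L)^2+\frac J2v_x(L)^2+\frac{k_1}2u_x(L)^2+\frac{k_2}2u(L)^2+\frac12\zeta_1^\top P_1\zeta_1+\frac12\zeta_2^\top P_2\zeta_2.$$ *)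

(* Defs.v *)
From HB Require Import structures.
From mathcomp Require Import all_boot all_order all_algebra.
From mathcomp Require Import all_classical all_reals all_analysis.
From mathcomp Require Import complex.
Set Implicit Arguments.
Unset Strict Implicit.
Unset Printing Implicit Defensive.
Import Order.TTheory GRing.Theory Num.Theory.
Import numFieldNormedType.Exports.
Local Open Scope classical_set_scope.
Local Open Scope ring_scope.

(* A normed function space is presented by representatives: a linear subspace
   [dom] of an ambient vector space with a seminorm [nrm] on it. Two elements
   of [dom] denote the same vector when [nrm] of their difference vanishes. *)
Record nspace (R : realType) := NSpace {
  car :> lmodType R ;
  dom : set car ;
  nrm : car -> R }.

Section Sobolev.
Context {R : realType}.
Local Notation leb := (@lebesgue_measure R).

Definition test_fun (a b : R) (phi : R -> R) : Prop :=
  (forall n x, derivable (derive1n n phi) x 1) /\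
  exists c d, [/\ a < c, d < b & forall x, ~ `[c, d]%classic x -> phi x = 0].

Variable X : nspace R.

(* Bounded linear functionals; only the values on [dom X] matter. *)
Definition dual (l : X -> R) : Prop :=
  (forall (k : R) x y, dom x -> dom y -> l (k *: x + y) = k * l x + l y) /\
  exists K, forall x, dom x -> `|l x| <= K * nrm x.

Definition simple_fun (s : R -> X) : Prop :=
  exists (m : nat) (E : 'I_m -> set R) (x : 'I_m -> X),
    [/\ forall i, measurable (E i), forall i, dom (x i) &
        forall t, s t = \sum_(i < m) (\1_(E i) t : R) *: x i].

Variables a b : R.

Definition strongly_measurable (f : R -> X) : Prop :=
  exists s : nat -> R -> X,
    (forall n, simple_fun (s n)) /\
    {ae leb, forall t, `]a, b[%classic t ->
      nrm (f t - s n t) @[n --> \oo] --> (0 : R)}.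

(* L^2(a,b;X) *)
Definition bochner_L2 (f : R -> X) : Prop :=
  [/\ {ae leb, forall t, `]a, b[%classic t -> dom (f t)},
      strongly_measurable f &
      (\int[leb]_(t in `]a, b[%classic) ((nrm (f t) ^+ 2)%:E) < +oo)%E].

(* C([a,b];X) *)
Definition cont (f : R -> X) : Prop :=
  forall t, `[a, b]%classic t ->
    dom (f t) /\
    nrm (f s - f t) @[s --> within `[a, b]%classic (nbhs t)] --> (0 : R).

(* g is the weak derivative of f. The identity between the Bochner integrals
   of phi' f and - phi g is expressed by applying all bounded functionals. *)
Definition weak_deriv (f g : R -> X) : Prop :=
  [/\ bochner_L2 f, bochner_L2 g &
    forall (phi : R -> R) (l : X -> R), test_fun a b phi -> dual l ->
      \int[leb]_(t in `]a, b[%classic) (l (f t) * derive1n 1 phi t) =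
      - \int[leb]_(t in `]a, b[%classic) (l (g t) * phi t)].

(* The weak derivative as a function: the continuous representative on [a,b]
   is chosen whenever there is one, so that its values at points of [a,b] are
   the traces. *)
Definition wdiff (f : R -> X) : R -> X :=
  xget (fun=> 0) [set g | weak_deriv f g /\
    ((exists g', weak_deriv f g' /\ cont g') -> cont g)].

Definition wdiffn (j : nat) (f : R -> X) : R -> X := iter j wdiff f.

(* H^m(a,b;X); for m >= 1 its elements are given by their continuous
   representatives. *)
Definition sobolev (m : nat) (f : R -> X) : Prop :=
  (forall j, (j <= m)%N -> bochner_L2 (wdiffn j f)) /\
  (forall j, (j < m)%N ->
     cont (wdiffn j f) /\ weak_deriv (wdiffn j f) (wdiffn j.+1 f)).

Definition sobolev_norm (m : nat) (f : R -> X) : R :=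
  Num.sqrt (\sum_(j < m.+1)
    \int[leb]_(t in `]a, b[%classic) (nrm (wdiffn j f t) ^+ 2)).

End Sobolev.

Arguments dom {R} _ _.
Arguments dual {R} X l.
Arguments bochner_L2 {R} X a b f.
Arguments wdiffn {R} X a b j f _.
Arguments sobolev {R} X a b m f.
Arguments sobolev_norm {R} X a b m f.

Section Spaces.
Context {R : realType}.
Local Notation leb := (@lebesgue_measure R).

Definition scalars : nspace R := @NSpace R R^o setT (fun x => `|x|).

Definition dotp (r : nat) (x y : 'cV[R]_r) : R := \sum_i x i 0 * y i 0.

Definition euclid (r : nat) : nspace R :=
  @NSpace R 'cV[R]_r setT (fun x => Num.sqrt (dotp x x)).

Variable L : R.

(* Spatial (weak) derivatives on (0,L): [Dx 1 w x] is w_x(x), also at the end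
   points when w lies in H^2(0,L). *)
Definition Dx (j : nat) (w : R -> R) : R -> R := wdiffn scalars 0 L j w.

(* H^k(0,L) *)
Definition Hk (k : nat) : nspace R :=
  @NSpace R (R -> R^o) [set w | sobolev scalars 0 L k w]
    (sobolev_norm scalars 0 L k).

(* The subspace of H^k(0,L) given by u(0) = u_x(0) = 0, for k >= 2 *)
Definition Ht (k : nat) : nspace R :=
  @NSpace R (R -> R^o)
    [set w | [/\ dom (Hk k) w, w 0 = 0 & Dx 1 w 0 = 0]]
    (@nrm R (Hk k)).

(* C^k[0,L]: k times continuously differentiable on ]0,L[, with all these
   derivatives extending continuously to [0,L] *)
Definition Ck (k : nat) (f : R -> R) : Prop :=
  exists g : nat -> R -> R,
    [/\ g 0%N = f,
        forall j, (j <= k)%N -> {within `[0, L]%classic, continuous (g j)} &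
        forall j, (j < k)%N -> forall x : R, `]0, L[%classic x ->
          is_derive x (1 : R) (g j) (g j.+1 x)].

End Spaces.

Record beam (R : realType) := Beam {
  bL : R ; bM : R ; bJ : R ; bk1 : R ; bk2 : R ;
  bmu : R -> R ; bLam : R -> R }.

Record controller (R : realType) (r : nat) := Controller {
  cA : 'M[R]_r ; cb : 'cV[R]_r ; cc : 'cV[R]_r ; cd : R ; cdelta : R ;
  cP : 'M[R]_r ; cq : 'cV[R]_r ; ceps : R }.

Section Coefficients.
Context {R : realType}.

Definition beam_ok (B : beam R) : Prop :=
  [/\ [/\ 0 < bL B, 0 < bM B, 0 < bJ B, 0 < bk1 B & 0 < bk2 B],
      Ck (bL B) 4 (bmu B), Ck (bL B) 4 (bLam B),
      forall x, `[0, bL B]%classic x -> 0 < bmu B x &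
      forall x, `[0, bL B]%classic x -> 0 < bLam B x].

Definition hurwitz (r : nat) (A : 'M[R]_r) : Prop :=
  forall lam : R[i],
    eigenvalue (map_mx (real_complex R) A) lam -> complex.Re lam < 0.

Definition transfer (r : nat) (S : controller R r) (s : R[i]) : R[i] :=
  let toC n p (E : 'M[R]_(n, p)) := map_mx (real_complex R) E in
  ((invmx (s%:M - toC _ _ (cA S)) *m toC _ _ (cb S))^T *m toC _ _ (cc S)) 0 0
  + real_complex R (cd S).

Definition controller_ok (r : nat) (S : controller R r) : Prop :=
  [/\ hurwitz (cA S),
      0 < cdelta S /\ cdelta S <= cd S,
      forall omega : R, 0 <= omega ->
        cd S <= complex.Re (transfer S (Complex 0 omega)),
      (cP S)^T = cP S /\
        (forall x : 'cV[R]_r, x != 0 -> 0 < dotp x (cP S *m x)) &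
      [/\ 0 < ceps S,
          cP S *m cA S + (cA S)^T *m cP S =
            - (cq S *m (cq S)^T) - ceps S *: cP S &
          cP S *m cb S = cc S - Num.sqrt (2 * (cd S - cdelta S)) *: cq S]].

End Coefficients.

Section Weak.
Context {R : realType}.
Local Notation leb := (@lebesgue_measure R).
Variable B : beam R.
Local Notation L := (bL B).
Local Notation Dx := (Dx L).

Definition form_a (w1 w2 : R -> R) : R :=
  \int[leb]_(x in `[0, L]%classic) (bLam B x * Dx 2 w1 x * Dx 2 w2 x)
  + bk1 B * Dx 1 w1 L * Dx 1 w2 L + bk2 B * w1 L * w2 L.

(* Elements of V are represented by w instead of (w_x(L), w(L), w). *)
Definition Vsp : nspace R :=
  @NSpace R (R -> R^o) (dom (Ht L 2))
    (fun w => Num.sqrt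
       (\int[leb]_(x in `[0, L]%classic) (bLam B x * Dx 2 w x * Dx 2 w x))).

Definition hat (w : R -> R) : R^o * R^o * (R -> R^o) := (Dx 1 w L, w L, w).

Definition ipH (p q : R^o * R^o * (R -> R^o)) : R :=
  bJ B * p.1.1 * q.1.1 + bM B * p.1.2 * q.1.2
  + \int[leb]_(x in `[0, L]%classic) (bmu B x * p.2 x * q.2 x).

Definition Hsp : nspace R :=
  @NSpace R (R^o * R^o * (R -> R^o))%type
    [set p | dom (Hk L 0) p.2]
    (fun p => Num.sqrt (ipH p p)).

(* V': bounded functionals on V with the dual norm *)
Definition Vdual : nspace R :=
  @NSpace R ((R -> R^o) -> R^o)
    [set l | dual Vsp l]
    (fun l => sup [set y | exists w : Vsp, [/\ dom Vsp w, nrm w <= 1 & y = `|l w|]]).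

(* The embedding of H into V' of the Gelfand triple *)
Definition embH (p : Hsp) : Vdual := fun w => ipH p (hat w).

Variables (r : nat) (S1 S2 : controller R r) (T : R).

Definition weak_solution (u : R -> R -> R) (z1 z2 : R -> 'cV[R]_r)
    (u0 : R -> R) (v0 : Hsp) (z10 z20 : 'cV[R]_r) : Prop :=
  let uhat : R -> Hsp := fun t => hat (u t) in
  let uhat_t := wdiffn Hsp 0 T 1 uhat in
  let uhat' : R -> Vdual := fun t => embH (uhat t) in
  let uhat_tt := wdiffn Vdual 0 T 2 uhat' in
  [/\ [/\ bochner_L2 Vsp 0 T u, sobolev Hsp 0 T 1 uhat,
          sobolev Vdual 0 T 2 uhat',
          sobolev (euclid r) 0 T 1 z1 & sobolev (euclid r) 0 T 1 z2],
      {ae leb, forall t, `]0, T[%classic t -> forall w, dom Vsp w ->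
        uhat_tt t w + form_a (u t) w
        + cd S1 * (uhat_t t).1.1 * Dx 1 w L + cd S2 * (uhat_t t).1.2 * w L
        + dotp (cc S1) (z1 t) * Dx 1 w L + dotp (cc S2) (z2 t) * w L = 0},
      {ae leb, forall t, `]0, T[%classic t ->
        wdiffn (euclid r) 0 T 1 z1 t
          = cA S1 *m z1 t + (uhat_t t).1.1 *: cb S1},
      {ae leb, forall t, `]0, T[%classic t ->
        wdiffn (euclid r) 0 T 1 z2 t
          = cA S2 *m z2 t + (uhat_t t).1.2 *: cb S2} &
      [/\ dom Vsp u0 /\ nrm (uhat 0 - (hat u0 : Hsp)) = 0,
          (* uhat_t(0) = v0, read on the representative in C([0,T];V') *)
          dom Hsp v0 /\ (forall w, dom Vsp w ->
            wdiffn Vdual 0 T 1 uhat' 0 w = embH v0 w),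
          z1 0 = z10 & z2 0 = z20]].

End Weak.

Section Discrete.
Context {R : realType}.
Local Notation leb := (@lebesgue_measure R).
Variable B : beam R.
Local Notation L := (bL B).
Local Notation Dx := (Dx L).

Definition Wh (P : nat) (w : R -> R) : Prop :=
  [/\ Ck L 1 w,
      forall m : nat, (m < P)%N ->
        exists p : {poly R}, (size p <= 4)%N /\
          forall x, `[m%:R * (L / P%:R), m.+1%:R * (L / P%:R)]%classic x ->
            w x = p.[x],
      w 0 = 0 & Dx 1 w 0 = 0].

Definition comb (N : nat) (w : 'I_N -> R -> R) (c : 'cV[R]_N) : R -> R :=
  fun x => \sum_i c i 0 * w i x.

(* Functions are identified when they agree on [0,L]. *)
Definition is_basis (P N : nat) (w : 'I_N -> R -> R) : Prop :=
  [/\ forall i, Wh P (w i),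
      forall c, (forall x, `[0, L]%classic x -> comb w c x = 0) -> c = 0 &
      forall v, Wh P v ->
        exists c, forall x, `[0, L]%classic x -> v x = comb w c x].

Definition is_projection (P : nat) (T : R) (u pu : R -> R -> R) : Prop :=
  forall t, `[0, T]%classic t -> Wh P (pu t) /\
    forall wh, Wh P wh -> form_a B (pu t) wh = form_a B (u t) wh.

Variables (r : nat) (S1 S2 : controller R r).
Variables (N : nat) (w : 'I_N -> R -> R).

Definition mxA : 'M[R]_N := \matrix_(i, j)
  (\int[leb]_(x in `[0, L]%classic) (bmu B x * w i x * w j x)
   + bM B * w i L * w j L + bJ B * Dx 1 (w i) L * Dx 1 (w j) L).

Definition mxB : 'M[R]_N := \matrix_(i, j)
  (cd S1 * Dx 1 (w i) L * Dx 1 (w j) L + cd S2 * w i L * w j L).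

Definition mxK : 'M[R]_N := \matrix_(i, j) form_a B (w i) (w j).

Definition vecC (z1 z2 : 'cV[R]_r) : 'cV[R]_N := \col_j
  (dotp (cc S1) z1 * Dx 1 (w j) L + dotp (cc S2) z2 * w j L).

Definition crank_nicolson (dt : R) (S : nat) (U V : nat -> 'cV[R]_N)
    (z1 z2 : nat -> 'cV[R]_r) : Prop :=
  forall n, (n < S)%N ->
  [/\ dt^-1 *: (U n.+1 - U n) = 2^-1 *: (V n.+1 + V n),
      dt^-1 *: (mxA *m V n.+1 - mxA *m V n) =
        - (2^-1 *: (mxK *m U n.+1 + mxK *m U n))
        - 2^-1 *: (mxB *m V n.+1 + mxB *m V n)
        - 2^-1 *: (vecC (z1 n.+1) (z2 n.+1) + vecC (z1 n) (z2 n)),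
      dt^-1 *: (z1 n.+1 - z1 n) =
        cA S1 *m (2^-1 *: (z1 n.+1 + z1 n))
        + ((Dx 1 (comb w (V n.+1)) L + Dx 1 (comb w (V n)) L) / 2) *: cb S1 &
      dt^-1 *: (z2 n.+1 - z2 n) =
        cA S2 *m (2^-1 *: (z2 n.+1 + z2 n))
        + ((comb w (V n.+1) L + comb w (V n) L) / 2) *: cb S2].

Definition znorm (u v : R -> R) (z1 z2 : 'cV[R]_r) : R :=
  Num.sqrt
   (2^-1 * \int[leb]_(x in `[0, L]%classic) (bLam B x * Dx 2 u x ^+ 2)
    + 2^-1 * \int[leb]_(x in `[0, L]%classic) (bmu B x * v x ^+ 2)
    + bM B / 2 * v L ^+ 2 + bJ B / 2 * Dx 1 v L ^+ 2
    + bk1 B / 2 * Dx 1 u L ^+ 2 + bk2 B / 2 * u L ^+ 2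
    + 2^-1 * dotp z1 (cP S1 *m z1) + 2^-1 * dotp z2 (cP S2 *m z2)).

End Discrete.

(* Main.v *)
Require Import Defs.
From HB Require Import structures.
From mathcomp Require Import all_boot all_order all_algebra.
From mathcomp Require Import all_classical all_reals all_analysis.
From mathcomp Require Import measurable_realfun.
From mathcomp Require Import ring lra.
Set Implicit Arguments.
Unset Strict Implicit.
Unset Printing Implicit Defensive.
Import Order.TTheory GRing.Theory Num.Theory.
Import numFieldNormedType.Exports.
Local Open Scope classical_set_scope.
Local Open Scope ring_scope.

(** The discrete solution is compared with the projection [proj] of the exact solution
    on [Wh] with respect to [form_a]. The energy norm [znorm] of the difference obeys
    [energy_step]: tested with the sums over two consecutive times, the elastic terms of
    the scheme cancel, and the boundary damping dominates the controllers because of the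
    Kalman-Yakubovich-Popov identities ([KYP_dissipative]). The norm therefore grows in
    each step by no more than a multiple of the residual, and the residuals only have to
    be added up, without any factor growing with the number of steps.

    The residuals are of two kinds ([step_error]). Where the scheme replaces a time
    integral by an average of two values, the defect is bounded by the square of the
    time step times the integral of a third derivative in time ([trapezoid]); this gives
    the third and fourth time derivatives of the displacement and the third ones of the
    controllers. Where the projected velocity stands for the velocity, the defect is a
    projection error. By orthogonality the projection is the best approximation in [Wh]
    ([proj_cea]), and [Wh] contains a function whose second derivative is, on each mesh
    interval, the affine Taylor polynomial of that of the given function ([Wh_approx]);
    the error is thus of second order in the mesh size times the norm in H^4
    ([proj_err]). Since the projection is defined by [form_a], no residual arises from
    the stiffness. Summed over the steps, the integrals combine to integrals over the
    whole time interval, and the Cauchy-Schwarz inequality in time yields the Sobolev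
    norms of the statement ([error_sum]). Finally the projection error itself is added,
    uniformly in time by the embedding of H^1 in the continuous functions ([hilb_sup]).

    Statements on functions with values in a Hilbert space are obtained from scalar
    ones. A bounded functional turns a weak derivative into a scalar weak derivative
    [sweak], for which the fundamental theorem of calculus is proved with smoothed
    indicator functions as test functions ([sweak_ftc]). Applied to a countable
    separating family of functionals, this shows that weak derivatives are unique up to
    vectors of norm zero, and that bounded operators commute with them whichever
    representatives are selected ([sobolev_push]). It also identifies the derivatives
    in the dual space that occur in the weak formulation with those in H^2, and extends
    the weak formulation from almost every time to all times ([weak_eq_all]), so that
    it can be evaluated at the points of the time grid. *)

(** * Integration of functions known almost everywhere *)

Import HBNNSimple.
Section integral_ae.
Context {R : realType}.
Local Notation leb := (@lebesgue_measure R).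
Local Notation rT := (measurableTypeR R).
Implicit Types (D : set rT).

(** The integral of a nonnegative function is a supremum over simple functions,
    and a simple function may be set to zero on a null set; this covers integrands that
    are not measurable. *)
Lemma le_integral_ae D (f g : rT -> \bar R) :
  (forall x, D x -> (0 <= f x)%E) -> (forall x, D x -> (0 <= g x)%E) ->
  {ae leb, forall x, D x -> (f x <= g x)%E} ->
  (\int[leb]_(x in D) f x <= \int[leb]_(x in D) g x)%E.
Proof.
move=> f0 g0 [N [mN N0 sN]].
rewrite !ge0_integralE//.
apply: ge_ereal_sup => _ [h /= hf <-].
have mNC : measurable (~` N) by exact: measurableC.
have E x : proj_nnsfun h mNC x = if x \in ~` N then h x else 0.
  by rewrite -[LHS]/((proj_nnsfun h mNC : R -> R) x) -mrestrict patchE.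
apply: le_ereal_sup_tmp; exists (sintegral leb (proj_nnsfun h mNC)).
  exists (proj_nnsfun h mNC) => // x.
  rewrite E; case: (boolP (x \in ~` N)) => [|_].
    rewrite inE /= => nNx; rewrite (le_trans (hf x))//.
    rewrite !patchE; case: ifPn => // xD.
    apply: contrapT => fg; apply/nNx/sN => /=.
    by apply/not_implyP; split; [exact/set_mem|exact/fg].
  by rewrite patchE; case: ifPn => // /set_mem/g0.
rewrite -!integralT_nnsfun le_eqVlt; apply/orP; left; apply/eqP.
apply: ge0_ae_eq_integral => //.
- exact/measurable_EFinP.
- exact/measurable_EFinP.
- by move=> x _; rewrite lee_fin.
- by move=> x _; rewrite lee_fin.
exists N; split => // x /=; apply: contra_notP => nNx _.
by congr (_%:E); have := E x; rewrite mem_set // => ->.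
Qed.

Lemma aeS (P Q : rT -> Prop) : (forall x, P x -> Q x) ->
  {ae leb, forall x, P x} -> {ae leb, forall x, Q x}.
Proof. by move=> PQ; apply: filterS PQ; exact: (ae_filter_ringOfSetsType leb). Qed.

Lemma aeS2 (P Q S : rT -> Prop) : (forall x, P x -> Q x -> S x) ->
  {ae leb, forall x, P x} -> {ae leb, forall x, Q x} -> {ae leb, forall x, S x}.
Proof. by move=> PQ; apply: filterS2 PQ; exact: (ae_filter_ringOfSetsType leb). Qed.

Implicit Types (f g m : rT -> R).

Definition aeq D f g := {ae leb, forall x, D x -> f x = g x}.

(** Integrands are not assumed measurable, because the representatives chosen by
    [wdiff] need not be; only their classes modulo null sets matter. *)
Definition I1 D f :=
  exists2 g : rT -> R, leb.-integrable D (EFin \o g) & aeq D f g.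

Definition L2 D f :=
  exists g : rT -> R, [/\ measurable_fun D g,
    leb.-integrable D (fun x => (g x ^+ 2)%:E) & aeq D f g].

Lemma aeq_refl D f : aeq D f f. Proof. exact: aeW. Qed.

Lemma aeq_eq D f g : (forall x, D x -> f x = g x) -> aeq D f g.
Proof. by move=> fg; apply: aeW => x; exact: fg. Qed.

Lemma aeq_sym D f g : aeq D f g -> aeq D g f.
Proof. by apply: aeS => x fg /fg. Qed.

Lemma aeq_trans D g f h : aeq D f g -> aeq D g h -> aeq D f h.
Proof. by apply: aeS2 => x fg gh Dx; rewrite fg// gh. Qed.

Lemma aeq_sub D E f g : E `<=` D -> aeq D f g -> aeq E f g.
Proof. by move=> ED; apply: aeS => x fg /ED /fg. Qed.

Lemma aeq_comp D f g (h : rT -> R -> R) : aeq D f g ->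
  aeq D (fun x => h x (f x)) (fun x => h x (g x)).
Proof. by apply: aeS => x fg /fg ->. Qed.

Lemma aeq_comp2 D f g f' g' (h : rT -> R -> R -> R) : aeq D f g -> aeq D f' g' ->
  aeq D (fun x => h x (f x) (f' x)) (fun x => h x (g x) (g' x)).
Proof. by apply: aeS2 => x fg fg' Dx; rewrite fg// fg'. Qed.

Lemma int_aeq D f g : aeq D f g ->
  (\int[leb]_(x in D) (f x)%:E = \int[leb]_(x in D) (g x)%:E)%E.
Proof.
move=> fg; rewrite [LHS]integralE [RHS]integralE; congr (_ - _)%E; apply/eqP;
  rewrite eq_le; apply/andP; split; apply: le_integral_ae => //.
all: by move: fg; apply: aeS => x + Dx; rewrite ?funeposE ?funenegE => ->.
Qed.

Lemma RI_aeq D f g : aeq D f g ->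
  \int[leb]_(x in D) f x = \int[leb]_(x in D) g x.
Proof. by move=> fg; rewrite /Rintegral (int_aeq fg). Qed.

Lemma I1_aeq D f g : aeq D f g -> I1 D g -> I1 D f.
Proof. by move=> fg [h ih gh]; exists h => //; exact: aeq_trans gh. Qed.

Lemma I1D D f g : measurable D -> I1 D f -> I1 D g -> I1 D (fun x => f x + g x).
Proof.
move=> mD [f' if' ff'] [g' ig' gg']; exists (fun x => f' x + g' x).
  by have := integrableD mD if' ig'; apply: eq_integrable => //= x _; rewrite EFinD.
exact: (aeq_comp2 (fun _ a b => a + b)).
Qed.

Lemma I1Z D k f : measurable D -> I1 D f -> I1 D (fun x => k * f x).
Proof.
move=> mD [f' if' ff']; exists (fun x => k * f' x).
  have := integrableZl mD k if'; apply: eq_integrable => //= x _.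
exact: (aeq_comp (fun _ a => k * a)).
Qed.

Lemma I1_abs D f : measurable D -> I1 D f -> I1 D (fun x => `|f x|).
Proof.
move=> mD [f' if' ff']; exists (fun x => `|f' x|).
  by have := integrable_abse if'; apply: eq_integrable.
exact: (aeq_comp (fun _ a => `|a|)).
Qed.

Lemma I1S D E f : measurable D -> measurable E -> E `<=` D -> I1 D f -> I1 E f.
Proof.
move=> mD mE ED [g ig fg]; exists g; first exact: integrableS ig.
exact: aeq_sub fg.
Qed.

Lemma RID D f g : measurable D -> I1 D f -> I1 D g ->
  \int[leb]_(x in D) (f x + g x) = \int[leb]_(x in D) f x + \int[leb]_(x in D) g x.
Proof.
move=> mD [f' if' ff'] [g' ig' gg'].
rewrite (RI_aeq ff') (RI_aeq gg') -RintegralD//; apply: RI_aeq.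
exact: (aeq_comp2 (fun _ a b => a + b)).
Qed.

Lemma RIZ D k f : measurable D -> I1 D f ->
  \int[leb]_(x in D) (k * f x) = k * \int[leb]_(x in D) f x.
Proof.
move=> mD [f' if' ff'].
rewrite (RI_aeq ff') -RintegralZl//; apply: RI_aeq.
exact: (aeq_comp (fun _ a => k * a)).
Qed.

Lemma RIN D f : measurable D -> I1 D f ->
  \int[leb]_(x in D) (- f x) = - \int[leb]_(x in D) f x.
Proof.
move=> mD If; rewrite -mulN1r -RIZ//; apply: eq_Rintegral => x _.
by rewrite mulN1r.
Qed.

Lemma I1N D f : measurable D -> I1 D f -> I1 D (fun x => - f x).
Proof.
move=> mD /(I1Z (-1) mD); apply: I1_aeq; apply: aeq_eq => x _; by rewrite mulN1r.
Qed.

Lemma I1B D f g : measurable D -> I1 D f -> I1 D g -> I1 D (fun x => f x - g x).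
Proof. by move=> mD If Ig; apply: I1D => //; exact: I1N. Qed.

Lemma RIB D f g : measurable D -> I1 D f -> I1 D g ->
  \int[leb]_(x in D) (f x - g x) = \int[leb]_(x in D) f x - \int[leb]_(x in D) g x.
Proof. by move=> mD If Ig; rewrite RID// ?RIN//; exact: I1N. Qed.

Lemma RI_ge0 D f : {ae leb, forall x, D x -> 0 <= f x} ->
  0 <= \int[leb]_(x in D) f x.
Proof.
move=> f0; rewrite (@RI_aeq _ f (fun x => `|f x|)).
  exact: Rintegral_ge0.
by move: f0; apply: aeS => x f0 /f0 /ger0_norm ->.
Qed.

Lemma RI_le D f g : measurable D -> I1 D f -> I1 D g ->
  {ae leb, forall x, D x -> f x <= g x} ->
  \int[leb]_(x in D) f x <= \int[leb]_(x in D) g x.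
Proof.
move=> mD If Ig fg; rewrite -subr_ge0 -RIB//; apply: RI_ge0.
by move: fg; apply: aeS => x fg /fg; rewrite subr_ge0.
Qed.

Lemma RI_abs D f : measurable D -> I1 D f ->
  `|\int[leb]_(x in D) f x| <= \int[leb]_(x in D) `|f x|.
Proof.
move=> mD [f' if' ff']; rewrite (RI_aeq ff').
rewrite (RI_aeq (aeq_comp (fun _ a => `|a|) ff')).
exact: le_normr_Rintegral.
Qed.

Lemma L2_aeq D f g : aeq D f g -> L2 D g -> L2 D f.
Proof. by move=> fg [h [mh ih gh]]; exists h; split => //; exact: aeq_trans gh. Qed.

Lemma L2_I1M D f g : measurable D -> L2 D f -> L2 D g -> I1 D (fun x => f x * g x).
Proof.
move=> mD [f' [mf if' ff']] [g' [mg ig' gg']]; exists (fun x => f' x * g' x).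
  apply: (@le_integrable _ _ _ _ _ mD _ (fun x => (f' x ^+ 2)%:E + (g' x ^+ 2)%:E)%E).
  - by apply/measurable_EFinP; exact: measurable_funM.
  - move=> x Dx /=; rewrite lee_fin normrM.
    rewrite [leRHS]ger0_norm; last by rewrite addr_ge0// sqr_ge0.
    rewrite -(real_normK (num_real (f' x))) -(real_normK (num_real (g' x))).
    have := sqr_ge0 (`|f' x| - `|g' x|); have := sqr_ge0 (`|f' x| + `|g' x|).
    by rewrite sqrrB sqrrD; lra.
  - exact: integrableD.
exact: (aeq_comp2 (fun _ a b => a * b)).
Qed.

Lemma L2Z D k f : measurable D -> L2 D f -> L2 D (fun x => k * f x).
Proof.
move=> mD [f' [mf if' ff']]; exists (fun x => k * f' x); split.
- exact: measurable_funM.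
- have := integrableZl mD (k ^+ 2) if'; apply: eq_integrable => //= x _.
  by rewrite -EFinM exprMn.
- exact: (aeq_comp (fun _ a => k * a)).
Qed.

Lemma L2D D f g : measurable D -> L2 D f -> L2 D g -> L2 D (fun x => f x + g x).
Proof.
move=> mD [f' [mf if' ff']] [g' [mg ig' gg']]; exists (fun x => f' x + g' x); split.
- exact: measurable_funD.
- have := integrableZl mD 2 (integrableD mD if' ig'); apply: le_integrable => //.
    by apply/measurable_EFinP; apply: measurable_funX; exact: measurable_funD.
  move=> x Dx /=; rewrite lee_fin ger0_norm ?sqr_ge0// ger0_norm; last first.
    by rewrite mulr_ge0// addr_ge0// sqr_ge0.
  by have := sqr_ge0 (f' x - g' x); rewrite sqrrB sqrrD; lra.
- exact: (aeq_comp2 (fun _ a b => a + b)).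
Qed.

Lemma L2N D f : measurable D -> L2 D f -> L2 D (fun x => - f x).
Proof.
move=> mD /(L2Z (-1) mD); apply: L2_aeq; apply: aeq_eq => x _; by rewrite mulN1r.
Qed.

Lemma L2B D f g : measurable D -> L2 D f -> L2 D g -> L2 D (fun x => f x - g x).
Proof. by move=> mD Lf Lg; apply: L2D => //; exact: L2N. Qed.

Lemma L2S D E f : measurable D -> measurable E -> E `<=` D -> L2 D f -> L2 E f.
Proof.
move=> mD mE ED [g [mg ig fg]]; exists g; split.
- exact: measurable_funS mg.
- exact: integrableS ig.
- exact: aeq_sub fg.
Qed.

Lemma L2_abs D f : measurable D -> L2 D f -> L2 D (fun x => `|f x|).
Proof.
move=> mD [f' [mf if' ff']]; exists (fun x => `|f' x|); split.
- exact: measurableT_comp.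
- by apply: eq_integrable if' => //= x _; rewrite real_normK ?num_real.
- exact: (aeq_comp (fun _ a => `|a|)).
Qed.

Lemma L2_I1sq D f : measurable D -> L2 D f -> I1 D (fun x => f x ^+ 2).
Proof.
move=> mD Lf; have := L2_I1M mD Lf Lf; apply: I1_aeq.
by apply: aeq_eq => x _; rewrite expr2.
Qed.

Definition bmeas D m :=
  measurable_fun D m /\ exists K, forall x, D x -> `|m x| <= K.

Lemma L2M D m f : measurable D -> bmeas D m -> L2 D f -> L2 D (fun x => m x * f x).
Proof.
move=> mD [mm [K mK]] [f' [mf if' ff']]; exists (fun x => m x * f' x); split.
- exact: measurable_funM.
- have := integrableZl mD (K ^+ 2) if'; apply: le_integrable => //.
    by apply/measurable_EFinP; apply: measurable_funX; exact: measurable_funM.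
  move=> x Dx /=; rewrite lee_fin exprMn normrM [leRHS]normrM ler_wpM2r// !(ger0_norm (sqr_ge0 _)).
  rewrite -(real_normK (num_real (m x))) ler_sqr ?nnegrE//.
    exact: mK.
  by rewrite (le_trans _ (mK _ Dx)).
- exact: (aeq_comp (fun x a => m x * a)).
Qed.

Lemma L2_bmeas D m : measurable D -> (leb D < +oo)%E -> bmeas D m -> L2 D m.
Proof.
move=> mD Doo [mm [K mK]]; exists m; split => //; last exact: aeq_refl.
apply: measurable_bounded_integrable => //; first exact: measurable_funX.
exists (K ^+ 2); split; first exact: num_real.
move=> M KM x Dx /=; rewrite ger0_norm ?sqr_ge0// (le_trans _ (ltW KM))//.
rewrite -(real_normK (num_real (m x))) ler_sqr ?nnegrE//; first exact: mK.
by rewrite (le_trans _ (mK _ Dx)).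
Qed.

Lemma bmeas_cst D k : bmeas D (fun=> k).
Proof. by split => //; exists `|k|. Qed.

Lemma L2_I1 D f : measurable D -> (leb D < +oo)%E -> L2 D f -> I1 D f.
Proof.
move=> mD Doo Lf; have := L2_I1M mD (L2_bmeas mD Doo (@bmeas_cst D 1)) Lf.
by apply: I1_aeq; apply: aeq_eq => x _; rewrite mul1r.
Qed.

(** Evaluation at the minimum or, when [c = 0], at a point where a nonconstant affine
    function is negative. The Cauchy-Schwarz inequalities below rest on this. *)
Lemma quad_discr (a b c : R) : 0 <= c ->
  (forall t, 0 <= a + 2 * t * b + t ^+ 2 * c) -> b ^+ 2 <= a * c.
Proof.
rewrite le_eqVlt => /predU1P[<-|c0] H.
  rewrite mulr0; have [->|b0] := eqVneq b 0; first by rewrite expr0n.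
  have := H (- (a + 1) / (2 * b)).
  have -> : a + 2 * (- (a + 1) / (2 * b)) * b + (- (a + 1) / (2 * b)) ^+ 2 * 0 = -1.
    by field.
  by rewrite ler0N1.
have := H (- b / c).
have -> : a + 2 * (- b / c) * b + (- b / c) ^+ 2 * c = (a * c - b ^+ 2) / c.
  by field; rewrite gt_eqF.
by rewrite pmulr_lge0 ?invr_gt0// subr_ge0.
Qed.

Lemma L2_CS D f g : measurable D -> L2 D f -> L2 D g ->
  (\int[leb]_(x in D) (f x * g x)) ^+ 2 <=
  (\int[leb]_(x in D) (f x ^+ 2)) * \int[leb]_(x in D) (g x ^+ 2).
Proof.
move=> mD Lf Lg; apply: quad_discr.
  by apply: RI_ge0; apply: aeW => x _; rewrite sqr_ge0.
move=> t; have -> : \int[leb]_(x in D) f x ^+ 2 +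
    2 * t * \int[leb]_(x in D) (f x * g x) + t ^+ 2 * \int[leb]_(x in D) g x ^+ 2
  = \int[leb]_(x in D) (f x + t * g x) ^+ 2.
  rewrite -!RIZ -?RID//; try by [exact: L2_I1M|exact: L2_I1sq|
    apply: I1Z => //; exact: L2_I1M|apply: I1Z => //; exact: L2_I1sq].
    by apply: eq_Rintegral => x _; ring.
  by apply: I1D => //; [exact: L2_I1sq|apply: I1Z => //; exact: L2_I1M].
by apply: RI_ge0; apply: aeW => x _; rewrite sqr_ge0.
Qed.

End integral_ae.

(** * A smooth step function *)

Section smooth_step.
Context {R : realType}.
Implicit Types (q : {poly R}) (f g : R -> R).

(** For every [q] these functions are flat at the origin, hence smooth. *)
Definition flat q (x : R) : R := if 0 < x then q.[x^-1] * expR (- x^-1) else 0.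

(** The exponential dominates each monomial by its own Taylor coefficient. *)
Lemma horner_expN_bounded q :
  exists2 C, 0 <= C & forall y, 0 <= y -> `|q.[y] * expR (- y)| <= C.
Proof.
have mono n : exists2 C, 0 <= C & forall y, 0 <= y -> `|y ^+ n * expR (- y)| <= C :> R.
  exists n`!%:R => // y y0; rewrite ger0_norm ?mulr_ge0 ?exprn_ge0 ?expR_ge0//.
  rewrite expRN ler_pdivrMr ?expR_gt0//; case: n => [|n].
    by rewrite expr0 fact0 mul1r -expR0 ler_expR.
  rewrite -ler_pdivrMl ?ltr0n ?fact_gt0// mulrC.
  by rewrite (le_trans _ (expR_ge1Dxn n y0))// lerDr.
rewrite -[q]coefK poly_def; elim/big_ind: _ => [|p r [C C0 Cp] [D D0 Dr]|i _].
- by exists 0 => // y _; rewrite horner0 mul0r normr0.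
- exists (C + D); first exact: addr_ge0.
  move=> y y0; rewrite hornerD mulrDl (le_trans (ler_normD _ _))// lerD//.
    exact: Cp.
  exact: Dr.
- have [C C0 HC] := mono i; exists (`|q`_i| * C); first exact: mulr_ge0.
  by move=> y y0; rewrite hornerZ hornerXn -mulrA normrM ler_wpM2l// HC.
Qed.

Lemma flat_quadratic q : exists2 C, 0 <= C & forall x, `|flat q x| <= C * x ^+ 2.
Proof.
have [C C0 HC] := horner_expN_bounded (q * 'X^2); exists C => // x.
rewrite /flat; case: ifPn => [x0|_]; last by rewrite normr0 mulr_ge0 ?sqr_ge0.
have := HC x^-1; rewrite invr_ge0 => /(_ (ltW x0)).
rewrite hornerM hornerXn mulrAC normrM exprVn (ger0_norm (x := _^-1)).
  by rewrite ler_pdivrMr// exprn_gt0.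
by rewrite invr_ge0 sqr_ge0.
Qed.

Lemma is_derive_quadratic f (C : R) : (forall x, `|f x| <= C * x ^+ 2) ->
  is_derive (0 : R) (1 : R) f 0.
Proof.
move=> fC; have f0 : f 0 = 0.
  by apply/eqP; rewrite -normr_le0 (le_trans (fC 0))// expr0n mulr0.
apply/is_derive1_caratheodory; exists (fun x => f x / x); split.
- by move=> z; rewrite f0 !subr0; have [->|z0] := eqVneq z 0;
    [rewrite f0 mulr0|rewrite divfK].
- rewrite /prop_for /continuous_at /= f0 mul0r; apply/cvgrPdist_le => e e0.
  have C1 : 0 < `|C| + 1 by rewrite ltr_wpDl.
  near=> t; rewrite sub0r normrN normrM normfV.
  have [->|t0] := eqVneq t 0; first by rewrite f0 normr0 mul0r ltW.
  rewrite ler_pdivrMr ?normr_gt0// (le_trans (fC t))//.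
  rewrite -real_normK ?num_real// expr2 mulrA ler_wpM2r//.
  have tl : `|t| <= e / (`|C| + 1).
    near: t; have HH := @nbhs0_le R R^o (e / (`|C| + 1)); apply: HH; exact: divr_gt0.
  rewrite (le_trans (ler_norm _))// normrM normr_id.
  rewrite (le_trans (ler_wpM2l _ tl))// mulrCA -[leRHS]mulr1.
  by rewrite ler_wpM2l ?(ltW e0)// ler_pdivrMr// mul1r lerDl.
- by rewrite f0 mul0r.
Unshelve. all: by end_near. Qed.

(** Away from the origin this is the chain rule, at the origin the quadratic bound. The
    derivative is in the same family, so all orders follow by induction. *)
Lemma is_derive_flat q x : is_derive x (1 : R) (flat q) (flat ((q - q^`()) * 'X^2) x).
Proof.
have [x0|x0|<-] := ltgtP 0 x; last first.
- rewrite {2}/flat ltxx; have [C _ HC] := flat_quadratic q.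
  exact: is_derive_quadratic HC.
- apply: (@near_eq_is_derive _ _ _ (cst 0)).
    near=> t; rewrite /flat ifF//; apply/negbTE; rewrite -leNgt.
    by apply: ltW; near: t; exact: lt_nbhsl.
  by rewrite {1}/flat ifF ?ltNge ?(ltW x0)//; exact: is_derive_cst.
- apply: (@near_eq_is_derive R R R (fun t : R => q.[t^-1] * expR (- t^-1))).
    near=> t; rewrite /flat ifT//; near: t; exact: lt_nbhsr.
  rewrite {1}/flat x0.
  have dV : is_derive x 1 (fun t : R => t^-1) (- x ^- 2).
    have := @is_deriveV _ id x 1 1; rewrite gt_eqF// => /(_ isT) H.
    by apply: is_derive_eq; rewrite /GRing.scale/= mulr1.
  have d1 : is_derive x 1 (horner q \o (fun t => t^-1)) (q^`().[x^-1] * - x ^- 2).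
    exact: is_derive1_comp.
  have d2 : is_derive x 1 (expR \o (fun t => - t^-1)) (expR (- x^-1) * x ^- 2).
    apply: is_derive1_comp => //.
    by have := is_deriveN dV; rewrite opprK.
  apply: (is_derive_eq (is_deriveM d1 d2)).
  rewrite /GRing.scale/= hornerM hornerXn hornerD hornerN exprVn; ring.
Unshelve. all: by end_near. Qed.

(** Generated by the operations that occur, so that a derivative in the class is found
    by recursion on the way a function was built. *)
Inductive smooth : (R -> R) -> Prop :=
| smooth_flat q (a b : R) : smooth (fun x => flat q (a * x + b))
| smooth_cst c : smooth (fun=> c)
| smoothD f g : smooth f -> smooth g -> smooth (fun x => f x + g x)
| smoothM f g : smooth f -> smooth g -> smooth (fun x => f x * g x)
| smoothV f : smooth f -> (forall x, f x != 0) -> smooth (fun x => (f x)^-1).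

Lemma smooth_derive f : smooth f ->
  exists2 f', smooth f' & forall x, is_derive x (1 : R) f (f' x).
Proof.
elim=> {f} [q a b|c|f g _ [f' sf df] _ [g' sg dg]|f g sf [f' sf' df] sg [g' sg' dg]
  |f sf [f' sf' df] f0].
- exists (fun x => flat ((q - q^`()) * 'X^2) (a * x + b) * a).
    by apply: smoothM; [exact: smooth_flat|exact: smooth_cst].
  move=> x; have d : is_derive x 1 (fun t : R => a * t + b) a.
    have d1 : is_derive x 1 (fun t : R => a * t) a.
      have := @is_deriveZ R R R id a x 1 1 (is_derive_id x 1).
      by rewrite /GRing.scale/= mulr1.
    have := is_deriveD d1 (is_derive_cst b x (1:R)); by rewrite addr0.
  have := @is_derive1_comp R (flat q) (fun t => a * t + b) x _ _ (is_derive_flat q (a * x + b)) d.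
  exact.
- exists (fun=> 0); [exact: smooth_cst|move=> x; exact: is_derive_cst].
- exists (fun x => f' x + g' x); first exact: smoothD.
  by move=> x; exact: is_deriveD.
- exists (fun x => f x * g' x + g x * f' x).
    by apply: smoothD; exact: smoothM.
  by move=> x; exact: is_deriveM.
- exists (fun x => -1 * ((f x)^-1 * (f x)^-1) * f' x).
    by do !apply: smoothM => //; try exact: smoothV; exact: smooth_cst.
  move=> x; apply: (is_derive_eq (is_deriveV (f0 x) (df x))).
  by rewrite /GRing.scale/= mulN1r expr2 invfM.
Qed.

Lemma smooth_derive1n f n : smooth f -> smooth (derive1n n f).
Proof.
move=> sf; elim: n => [//|n IH]; rewrite derive1nS.
have [f' sf' df] := smooth_derive IH.
have -> // : derive1 (derive1n n f) = f'.
by apply/funext => x; rewrite derive1E; case: (df x).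
Qed.

Lemma smooth_derivable f : smooth f -> forall n x, derivable (derive1n n f) x 1.
Proof.
by move=> sf n x; have [f' _ /(_ x)[]] := smooth_derive (smooth_derive1n n sf).
Qed.

(** Differences of two rescaled copies are the test functions close to the indicator
    function of an interval. *)
Definition step (t : R) : R := flat 1 t / (flat 1 t + flat 1 (1 - t)).

Lemma flat1_ge0 t : 0 <= flat 1 t.
Proof. by rewrite /flat; case: ifP => // _; rewrite hornerC mul1r expR_ge0. Qed.

Lemma flat1_gt0 t : 0 < t -> 0 < flat 1 t.
Proof. by rewrite /flat => ->; rewrite hornerC mul1r expR_gt0. Qed.

Lemma flat_le0 q t : t <= 0 -> flat q t = 0.
Proof. by rewrite /flat ltNge => ->. Qed.

Lemma step_den t : 0 < flat 1 t + flat 1 (1 - t).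
Proof.
have [t0|t0] := ltP 0 t; first by rewrite ltr_pwDl ?flat1_ge0 ?flat1_gt0.
by rewrite ltr_wpDl ?flat1_ge0 ?flat1_gt0//; lra.
Qed.

Lemma step0 t : t <= 0 -> step t = 0.
Proof. by move=> t0; rewrite /step flat_le0// mul0r. Qed.

Lemma step1 t : 1 <= t -> step t = 1.
Proof.
move=> t1; rewrite /step (@flat_le0 _ (1 - t)) ?addr0 ?divff//; last lra.
by rewrite gt_eqF// flat1_gt0//; lra.
Qed.

Lemma step_01 t : 0 <= step t <= 1.
Proof.
rewrite /step divr_ge0 ?flat1_ge0 ?(ltW (step_den t))//=.
by rewrite ler_pdivrMr ?step_den// mul1r lerDl flat1_ge0.
Qed.

Lemma smooth_step a b : smooth (fun t => step (a * t + b)).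
Proof.
apply: smoothM; first exact: smooth_flat.
apply: smoothV => [|x]; last by rewrite gt_eqF ?step_den.
apply: smoothD; first exact: smooth_flat.
have -> : (fun x => flat 1 (1 - (a * x + b))) = (fun x => flat 1 (- a * x + (1 - b))).
  by apply/funext => x; congr flat; ring.
exact: smooth_flat.
Qed.

Lemma step_derive : exists s' : R -> R, [/\ continuous s',
  (forall t, is_derive t (1 : R) step (s' t)) &
  exists2 M, 0 <= M & forall t, 0 <= t <= 1 -> `|s' t| <= M].
Proof.
have := smooth_step 1 0.
have -> : (fun t => step (1 * t + 0)) = step.
  by apply/funext => t; rewrite mul1r addr0.
move=> /smooth_derive[s' /smooth_derive[s'' _ ds'] ds]; exists s'.
have cs : continuous s'.
  by move=> x; case: (ds' x) => /derivable1_diffP/differentiable_continuous.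
split => //.
have cn : {within `[0, 1], continuous (fun t : R => `|s' t|)}.
  apply: continuous_subspaceT => x; apply: continuous_comp; first exact: cs.
  exact: norm_continuous.
have [c _ Hc] := EVT_max ler01 cn; exists `|s' c| => // t t01; exact: Hc.
Qed.

End smooth_step.

(** * Integrals and continuity on intervals *)

Section intervals.
Context {R : realType}.
Local Notation leb := (@lebesgue_measure R).
Local Notation rT := (measurableTypeR R).
Implicit Types (a b c s t x : R) (f g : rT -> R).

Lemma mitv (i : interval R) : @measurable _ rT [set` i].
Proof. exact: measurable_itv. Qed.
Hint Resolve mitv : core.

Lemma leb_itv_lty a b : (leb `]a, b[%classic < +oo)%E.
Proof. by rewrite lebesgue_measure_itv /=; case: ifP; rewrite ?ltey// -EFinB ltry. Qed.
Hint Resolve leb_itv_lty : core.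

Lemma leb_itvoo a b : a <= b -> fine (leb `]a, b[%classic) = b - a.
Proof.
move=> ab; rewrite lebesgue_measure_itv /= lte_fin; case: ifPn => //=.
by rewrite -leNgt => ba; apply/eqP; rewrite eq_sym subr_eq0 eq_le ab ba.
Qed.

Lemma RI_supp (D E : set rT) f : E `<=` D ->
  {ae leb, forall x, D x -> ~ E x -> f x = 0} ->
  \int[leb]_(x in D) f x = \int[leb]_(x in E) f x.
Proof.
move=> ED f0; rewrite Rintegral_mkcond [RHS]Rintegral_mkcond.
apply: RI_aeq; apply: aeS f0 => x f0 _; rewrite !patchE.
have [xE|/negP xE] := boolP (x \in E).
  by rewrite mem_set//; apply/ED/set_mem.
case: ifPn => // /set_mem Dx; apply: f0 => // Ex.
by apply: xE; rewrite mem_set.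
Qed.

Lemma ae_neq (p : R) : {ae leb, forall x : rT, x <> p}.
Proof.
exists [set p : rT]; split; first exact: (@measurable_set1 R).
  exact: lebesgue_measure_set1.
by move=> x /= /contrapT.
Qed.

Lemma RI_cc_oo a b f : \int[leb]_(x in `[a, b]%classic) f x =
  \int[leb]_(x in `]a, b[%classic) f x.
Proof.
apply: RI_supp; first by move=> x /=; rewrite !in_itv/= => /andP[/ltW-> /ltW->].
apply: aeS2 (ae_neq a) (ae_neq b) => x xa xb /=.
rewrite !in_itv/= => /andP[ax bx] []; rewrite !lt_neqAle ax bx !andbT.
by apply/andP; split; apply/eqP => // /esym.
Qed.

Lemma RI_split a c b f : a <= c <= b -> I1 `]a, b[%classic f ->
  \int[leb]_(x in `]a, b[%classic) f x =
  \int[leb]_(x in `]a, c[%classic) f x + \int[leb]_(x in `]c, b[%classic) f x.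
Proof.
move=> /andP[ac cb] If.
have s1 : `]a, c[%classic `<=` `]a, b[%classic.
  by move=> x /=; rewrite !in_itv/= => /andP[-> /lt_le_trans->].
have s2 : `]c, b[%classic `<=` `]a, b[%classic.
  by move=> x /=; rewrite !in_itv/= => /andP[+ ->]; rewrite andbT; exact: le_lt_trans.
pose f1 := f \_ `]a, c[%classic; pose f2 := f \_ `]c, b[%classic.
have H (E : set R) : @measurable _ rT E -> E `<=` `]a, b[%classic ->
    I1 `]a, b[%classic (f \_ E) /\
    \int[leb]_(x in `]a, b[%classic) (f \_ E) x = \int[leb]_(x in E) f x.
  move=> mE sE; split.
    case: If => g ig fg; exists (g \_ E).
      rewrite -restrict_EFin; apply/integrable_restrict => //.
      by apply: integrableS ig => //; exact: measurableI.
    by apply: aeS fg => x fg Dx; rewrite !patchE; case: ifP => // _; exact: fg.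
  rewrite (RI_supp sE).
    by apply: eq_Rintegral => x xE; rewrite patchE xE.
  by apply: aeW => x _ nE; rewrite patchE memNset.
have [I1' <-] := H _ (mitv _) s1; have [I2' <-] := H _ (mitv _) s2.
rewrite -RID//; apply: RI_aeq; apply: aeS (ae_neq c) => x xc /=.
rewrite in_itv/= => /andP[ax xb]; rewrite !patchE !mem_setE !in_itv/= ax xb andbT /=.
by move/eqP : xc; rewrite neq_lt => /orP[xc|cx]; rewrite ?xc ?cx ltNge ltW//= (addr0,add0r).
Qed.

Lemma RI_oo_ge s t f : t <= s -> \int[leb]_(x in `]s, t[%classic) f x = 0.
Proof. by move=> ts; rewrite set_itv_ge ?Rintegral_set0// bnd_simp -leNgt. Qed.

Lemma subset_oo a b s t : a <= s -> t <= b -> `]s, t[%classic `<=` `]a, b[%classic.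
Proof.
move=> sa tb x /=; rewrite !in_itv/= => /andP[sx xt].
by rewrite (le_lt_trans sa)// (lt_le_trans xt).
Qed.

Lemma L2_sub a b s t f : a <= s -> t <= b -> L2 `]a, b[%classic f -> L2 `]s, t[%classic f.
Proof. by move=> sa tb; apply: L2S => //; exact: subset_oo. Qed.

Lemma I1_sub a b s t f : a <= s -> t <= b -> I1 `]a, b[%classic f -> I1 `]s, t[%classic f.
Proof. by move=> sa tb; apply: I1S => //; exact: subset_oo. Qed.

Lemma L2_I1oo a b f : L2 `]a, b[%classic f -> I1 `]a, b[%classic f.
Proof. exact: L2_I1. Qed.

(** The quantitative absolute continuity of square integrable functions. *)
Lemma RI_CS1 s t f : s <= t -> L2 `]s, t[%classic f ->
  (\int[leb]_(x in `]s, t[%classic) `|f x|) ^+ 2 <=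
  (t - s) * \int[leb]_(x in `]s, t[%classic) (f x ^+ 2).
Proof.
move=> st Lf.
have := L2_CS (mitv `]s, t[) (L2_bmeas (mitv _) (leb_itv_lty s t) (@bmeas_cst R _ 1))
  (L2_abs (mitv _) Lf).
under eq_Rintegral do rewrite mul1r.
under [X in _ <= X * _ -> _]eq_Rintegral do rewrite expr1n.
rewrite Rintegral_cst// mul1r leb_itvoo//.
by under [X in _ <= _ * X -> _]eq_Rintegral do rewrite real_normK ?num_real//.
Qed.

Lemma RI_sq_mono a b s t f : a <= s -> t <= b -> L2 `]a, b[%classic f ->
  \int[leb]_(x in `]s, t[%classic) (f x ^+ 2) <= \int[leb]_(x in `]a, b[%classic) (f x ^+ 2).
Proof.
move=> sa tb Lf; rewrite /Rintegral fine_le//.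
- case: (L2_sub sa tb Lf) => g [_ ig fg].
  rewrite (@int_aeq _ _ _ (fun x => g x ^+ 2)); first exact: integrable_fin_num.
  exact: (aeq_comp (fun _ u => u ^+ 2)).
- case: Lf => g [_ ig fg].
  rewrite (@int_aeq _ _ _ (fun x => g x ^+ 2)); first exact: integrable_fin_num.
  exact: (aeq_comp (fun _ u => u ^+ 2)).
rewrite integral_mkcond [leRHS]integral_mkcond; apply: le_integral_ae => //.
- by move=> x _; apply: erestrict_ge0 => y _; rewrite lee_fin sqr_ge0.
- by move=> x _; apply: erestrict_ge0 => y _; rewrite lee_fin sqr_ge0.
apply: aeW => x _; rewrite !patchE; case: ifPn => [xst|_].
  by rewrite mem_set//; apply: (subset_oo sa tb); exact: set_mem.
by case: ifP => // _; rewrite lee_fin sqr_ge0.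
Qed.

(** Continuity within the closed interval, see [ccontP], in the form in which estimates
    at a given point use it. *)
Definition ccont a b f := forall x, a <= x <= b -> forall e, 0 < e ->
  exists2 d, 0 < d & forall y, a <= y <= b -> `|y - x| < d -> `|f y - f x| <= e.

Lemma ccontP a b f : ccont a b f <-> {within `[a, b]%classic, continuous (f : R -> R)}.
Proof.
split=> [cf|/subspace_continuousP cf].
  apply/subspace_continuousP => x /=; rewrite in_itv/= => xab.
  move=> P /nbhs_ballP[e /= e0 HP].
  have [d d0 H] := cf _ xab _ (divr_gt0 e0 (@ltr0Sn R 1)).
  apply/nbhs_ballP; exists d => //= y; rewrite /ball /= => xy yab; apply: HP.
  rewrite /ball /= distrC; apply: (@le_lt_trans _ _ (e / 2)).
    by apply: H; [rewrite /= in_itv in yab|rewrite distrC].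
  by rewrite ltr_pdivrMr// mulr_natr mulr2n ltrDl.
move=> x xab e e0; have := cf x; rewrite /= in_itv/= => /(_ xab).
move=> /cvgrPdist_le/(_ _ e0) /nbhs_ballP[d /= d0 H]; exists d => // y yab yx.
by rewrite distrC; apply: H => //=; rewrite ?in_itv//= /ball /= distrC.
Unshelve. all: by end_near. Qed.

Lemma ccontS a b s t f : a <= s -> t <= b -> ccont a b f -> ccont s t f.
Proof.
move=> sa tb cf x /andP[sx xt] e /cf H.
have [|d d0 Hd] := H x; first by rewrite (le_trans sa) ?(le_trans xt).
by exists d => // y /andP[sy yt]; apply: Hd; rewrite (le_trans sa) ?(le_trans yt).
Qed.

Lemma ccont_eq a b f g : (forall x, a <= x <= b -> f x = g x) -> ccont a b f -> ccont a b g.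
Proof.
by move=> fg cf x xab e /(cf x xab)[d d0 H]; exists d => // y yab; rewrite -!fg//; exact: H.
Qed.

Lemma ccontD a b f g : ccont a b f -> ccont a b g -> ccont a b (fun x => f x + g x).
Proof.
move=> cf cg x xab e e0; have e2 : 0 < e / 2 by rewrite divr_gt0.
have [d d0 H] := cf x xab _ e2; have [d' d'0 H'] := cg x xab _ e2.
exists (Num.min d d'); first by rewrite lt_min d0.
move=> y yab; rewrite lt_min => /andP[yd yd'].
rewrite opprD addrACA (le_trans (ler_normD _ _))// [leRHS]splitr lerD//; [exact: H|exact: H'].
Qed.

Lemma ccontZ a b k f : ccont a b f -> ccont a b (fun x => k * f x).
Proof.
move=> cf x xab e e0; have k1 : 0 < `|k| + 1 by rewrite ltr_wpDl.
have [d d0 H] := cf x xab _ (divr_gt0 e0 k1); exists d => // y yab yx.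
rewrite -mulrBr normrM (le_trans (ler_wpM2l _ (H _ yab yx)))//.
by rewrite mulrCA -[leRHS]mulr1 ler_wpM2l ?(ltW e0)// ler_pdivrMr// mul1r lerDl.
Qed.

Lemma ccont_bmeas a b f : ccont a b f -> bmeas `]a, b[%classic f.
Proof.
move=> cf; have [ab|ba] := leP a b; last first.
  rewrite set_itv_ge ?bnd_simp -?leNgt ?(ltW ba)//.
  by split; [exact: measurable_fun_set0|exists 0].
have /ccontP wf := cf; split.
  apply: (@measurable_funS _ _ _ _ `[a, b]%classic); first exact: measurable_itv.
    by move=> x /=; rewrite !in_itv/= => /andP[/ltW-> /ltW->].
  by apply: subspace_continuous_measurable_fun => //; exact: measurable_itv.
have wn : {within `[a, b]%classic, continuous (fun t : R => `|f t|)}.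
  by move=> x; apply: continuous_comp; [exact: wf|exact: norm_continuous].
have [c _ Hc] := EVT_max ab wn; exists `|f c| => x /=; rewrite in_itv/= => /andP[ax xb].
by apply: Hc; rewrite in_itv/= !ltW.
Qed.

Lemma ccont_L2 a b f : ccont a b f -> L2 `]a, b[%classic f.
Proof. by move=> cf; apply: L2_bmeas => //; exact: ccont_bmeas. Qed.

Lemma ae_ex (P : rT -> Prop) s t : s < t -> {ae leb, forall x, P x} ->
  exists2 x, s < x < t & P x.
Proof.
move=> st [N [mN N0 sN]]; apply: contrapT => nP.
have sub : `]s, t[%classic `<=` N.
  move=> x /=; rewrite in_itv/= => sxt; apply: sN => Px; apply: nP.
  by exists x.
have : (leb `]s, t[%classic <= leb N)%E by apply: le_measure; rewrite ?inE//.
rewrite N0 lebesgue_measure_itv /= lte_fin st -EFinB lee_fin subr_le0 leNgt st //.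
Qed.

(** A null set contains no interval, so every neighbourhood has points of agreement. *)
Lemma ccont_aeq a b f g : a < b -> ccont a b f -> ccont a b g ->
  aeq `]a, b[%classic f g -> forall x, a <= x <= b -> f x = g x.
Proof.
move=> ab cf cg fg x xab; apply/eqP; rewrite -subr_eq0 -normr_le0; apply/ler_addgt0Pr => e e0.
rewrite add0r; have e2 : 0 < e / 2 by rewrite divr_gt0.
have [d d0 H] := cf x xab _ e2; have [d' d'0 H'] := cg x xab _ e2.
pose m := Num.min d d'; have m0 : 0 < m by rewrite lt_min d0.
have [y /andP[y1 y2] /= fgy] : exists2 y, Num.max a (x - m) < y < Num.min b (x + m) &
    `]a, b[%classic y -> f y = g y.
  apply: ae_ex => //; have [ax xb] := andP xab; rewrite lt_min !gt_max ab /=.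
  by apply/and3P; split; lra.
move: y1 y2; rewrite gt_max lt_min => /andP[ay y1] /andP[yb y2].
have yab : a <= y <= b by rewrite !ltW.
have ym : `|y - x| < m by rewrite ltr_norml; apply/andP; split; lra.
move: ym; rewrite lt_min => /andP[/(H _ yab) h /(H' _ yab) h'].
rewrite (_ : f x - g x = (g y - g x) - (f y - f x)); last first.
  by rewrite fgy ?in_itv/= ?ay//; ring.
by rewrite (le_trans (ler_normB _ _))// [leRHS]splitr lerD.
Qed.

End intervals.
#[export] Hint Resolve mitv leb_itv_lty : core.

(** * Weak derivatives of scalar functions *)

Section weak_derivative.
Context {R : realType}.
Local Notation leb := (@lebesgue_measure R).
Local Notation rT := (measurableTypeR R).
Implicit Types (a b c s t x : R) (f g : rT -> R).

Lemma RI_FTC2 s t (F f : R -> R) : s <= t -> ccont s t f -> ccont s t F ->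
  (forall x, s < x < t -> is_derive x (1 : R) F (f x)) ->
  \int[leb]_(x in `]s, t[%classic) f x = F t - F s.
Proof.
rewrite le_eqVlt => /predU1P[<- _ _ _|st /ccontP cf /ccontP cF dF].
  by rewrite RI_oo_ge// subrr.
rewrite -RI_cc_oo /Rintegral (@continuous_FTC2 _ f F)//.
- have [_ cs ct] := (continuous_within_itvP _ st).1 cF; split => // x.
  by rewrite in_itv => /dF[].
- by move=> x; rewrite in_itv derive1E => /dF[].
Qed.

Lemma continuous_ccont a b (f : R -> R) : continuous f -> ccont a b f.
Proof. by move=> cf; apply/ccontP; exact: continuous_subspaceT. Qed.

Lemma derive_locally_cst (f : R -> R) (x l k d : R) : 0 < d ->
  (forall y, `|y - x| < d -> f y = k) -> is_derive x (1 : R) f l -> l = 0.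
Proof.
move=> d0 fk [_ <-].
suff [_ ->] : is_derive x (1 : R) f 0 by [].
apply: (@near_eq_is_derive R R R (cst k)).
apply/nbhs_ballP; exists d => //= y; rewrite /ball /= => xy.
by rewrite fk// distrC.
Qed.

(** Vector-valued weak derivatives are reduced to this one by applying functionals. *)
Definition sweak a b f g := [/\ L2 `]a, b[%classic f, L2 `]a, b[%classic g &
  forall phi : R -> R, test_fun a b phi ->
   \int[leb]_(t in `]a, b[%classic) (f t * derive1n 1 phi t) =
   - \int[leb]_(t in `]a, b[%classic) (g t * phi t)].

Section mollify.
Variables (s' : R -> R) (M : R).
Hypotheses (cs : continuous s') (ds : forall t, is_derive t (1 : R) step (s' t))
  (M0 : 0 <= M) (sM : forall t, 0 <= t <= 1 -> `|s' t| <= M).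

Lemma s'_out u : u < 0 \/ 1 < u -> s' u = 0.
Proof.
case=> u0.
  apply: (@derive_locally_cst step u _ 0 (- u)) => //; first by rewrite oppr_gt0.
  by move=> y; rewrite ltr_norml => /andP[_ yu]; apply: step0; lra.
apply: (@derive_locally_cst step u _ 1 (u - 1)) => //; first by rewrite subr_gt0.
by move=> y; rewrite ltr_norml => /andP[yu _]; apply: step1; lra.
Qed.

Lemma aff_derive (p e x : R) : e != 0 ->
  is_derive x (1 : R) (fun t => step ((t - p) / e)) (s' ((x - p) / e) / e).
Proof.
move=> e0.
have d : is_derive x (1 : R) (fun t : R => (t - p) / e) e^-1.
  have d1 := is_deriveB (is_derive_id x (1 : R)) (is_derive_cst p x (1:R)).
  have := @is_deriveZ R R R _ e^-1 x 1 _ d1.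
  rewrite subr0 /GRing.scale/= mulr1.
  suff -> : (fun t : R => (t - p) / e) = (fun t => e^-1 * (id - cst p) t) by [].
  by apply/funext => t; rewrite mulrC.
exact: (@is_derive1_comp R step (fun t => (t - p) / e) x _ _ (ds _) d).
Qed.

Lemma mollify_bmeas (D : set rT) p e : 0 < e -> @measurable _ rT D ->
  bmeas D (fun x => s' ((x - p) / e) / e).
Proof.
move=> e0 mD.
have cc : continuous (fun x : R => s' ((x - p) / e) / e).
  move=> x; apply: cvgM; last exact: cvg_cst.
  apply: (continuous_comp (f := fun x => (x - p) / e)); last exact: cs.
  by apply: cvgM; [apply: cvgB => //; exact: cvg_cst|exact: cvg_cst].
split.
  apply: (@measurable_funS _ _ _ _ setT) => //.
  exact: continuous_measurable_fun.
exists (M / e) => x _; rewrite normrM (gtr0_norm (x := e^-1)) ?invr_gt0//.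
rewrite ler_wpM2r ?invr_ge0 ?(ltW e0)//.
have [u0|u0] := ltP ((x - p) / e) 0; first by rewrite s'_out ?normr0//; left.
have [u1|u1] := ltP 1 ((x - p) / e); first by rewrite s'_out ?normr0//; right.
by apply: sM; rewrite u0.
Qed.

(** The derivative of a rescaled step has integral 1 and is at most [M / e], so the
    integral is an average of [f] over an interval of length [e]. *)
Lemma mollify a b f p e c dl : 0 < e -> a <= p -> p + e <= b ->
  L2 `]a, b[%classic f -> (forall x, p < x < p + e -> `|f x - c| <= dl) ->
  `|\int[leb]_(x in `]a, b[%classic) (f x * (s' ((x - p) / e) / e)) - c| <= dl * M.
Proof.
move=> e0 ap pb Lf fc; set psi := fun x => s' ((x - p) / e) / e.
have e_neq0 : e != 0 by rewrite gt_eqF.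
have bpsi : bmeas `]p, p + e[%classic psi by exact: mollify_bmeas.
have Lf' : L2 `]p, p + e[%classic f by exact: L2_sub Lf.
have Lpsi : L2 `]p, p + e[%classic psi by exact: L2_bmeas.
have psiM x : `|psi x| <= M / e.
  rewrite normrM (gtr0_norm (x := e^-1)) ?invr_gt0//.
  rewrite ler_wpM2r ?invr_ge0 ?(ltW e0)//.
  have [u0|u0] := ltP ((x - p) / e) 0; first by rewrite s'_out ?normr0//; left.
  have [u1|u1] := ltP 1 ((x - p) / e); first by rewrite s'_out ?normr0//; right.
  by apply: sM; rewrite u0.
have Ipsi : \int[leb]_(x in `]p, p + e[%classic) psi x = 1.
  transitivity (step ((p + e - p) / e) - step ((p - p) / e)); last first.
    by rewrite addrAC !subrr add0r divff// mul0r (@step1 _ 1)// step0// subr0.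
  apply: (@RI_FTC2 _ _ (fun t => step ((t - p) / e))).
  - by rewrite lerDl ltW.
  - apply: continuous_ccont => x; apply: cvgM; last exact: cvg_cst.
    apply: (continuous_comp (f := fun x => (x - p) / e)); last exact: cs.
    by apply: cvgM; [apply: cvgB => //; exact: cvg_cst|exact: cvg_cst].
  - apply: continuous_ccont => x.
    by case: (aff_derive p x e_neq0) => /derivable1_diffP/differentiable_continuous.
  - by move=> x _; exact: aff_derive.
rewrite (@RI_supp _ _ `]p, p + e[%classic); last 2 first.
- exact: subset_oo.
- apply: aeS2 (ae_neq p) (ae_neq (p + e)) => x xp xe _ /=.
  rewrite in_itv/= => /negP; rewrite negb_and -!leNgt => xpe.
  have H : (x - p) / e < 0 \/ 1 < (x - p) / e.
    case/orP: xpe => h; [left|right].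
      rewrite pmulr_llt0 ?invr_gt0// subr_lt0 lt_neqAle h andbT; exact/eqP.
    rewrite ltr_pdivlMr// mul1r ltrBrDl lt_neqAle h andbT; apply/eqP => //.
    by move/esym.
  by rewrite s'_out// mul0r mulr0.
have -> : c = \int[leb]_(x in `]p, p + e[%classic) (c * psi x).
  by rewrite RIZ ?Ipsi ?mulr1//; exact: L2_I1oo.
rewrite -RIB//; [|exact: L2_I1M|by apply: I1Z => //; exact: L2_I1oo].
have I3 : I1 `]p, p + e[%classic (fun x => f x * psi x - c * psi x).
  by apply: I1B => //; [exact: L2_I1M|apply: I1Z => //; exact: L2_I1oo].
rewrite (le_trans (RI_abs _ I3))//.
have -> : dl * M = \int[leb]_(x in `]p, p + e[%classic) (dl * (M / e)).
  rewrite Rintegral_cst// leb_itvoo ?lerDl ?(ltW e0)//.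
  by field.
apply: RI_le => //; first exact: I1_abs.
  exact: L2_I1oo (L2_bmeas _ _ (bmeas_cst _ _)).
apply: aeW => x /=; rewrite in_itv/= => pxe.
by rewrite -mulrBl normrM ler_pM// fc.
Qed.

End mollify.

(** The test functions are smoothed indicator functions of the interval: against their
    derivative, [f] is averaged near both end points, where it is continuous. *)
Lemma sweak_ftc a b f g : sweak a b f g -> ccont a b f ->
  forall s t, a <= s -> s <= t -> t <= b ->
    f t - f s = \int[leb]_(x in `]s, t[%classic) g x.
Proof.
move=> [Lf Lg fg] cf s t as_; rewrite le_eqVlt => /predU1P[<- _|st tb].
  by rewrite RI_oo_ge// subrr.
have [s' [cs ds [M M0 sM]]] := @step_derive R.
set G := \int[leb]_(x in `]a, b[%classic) (g x ^+ 2).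
have G0 : 0 <= G by apply: RI_ge0; apply: aeW => x _; rewrite sqr_ge0.
apply/eqP; rewrite -subr_eq0 -normr_le0; apply/ler_addgt0Pr => e' e'0; rewrite add0r.
pose dl := e' / (2 * M + 1).
have dl0 : 0 < dl by rewrite divr_gt0// ltr_wpDl// mulr_ge0.
have sab : a <= s <= b by rewrite as_ (le_trans (ltW st)).
have tab : a <= t <= b by rewrite tb (le_trans as_)// ltW.
have [d1 d10 H1] := cf s sab _ dl0; have [d2 d20 H2] := cf t tab _ dl0.
(* The three bounds make [e] small enough for the continuity of [f] at both end
   points, for both transitions to fit into the interval, and for the integral of
   [`|g|] over a subinterval of length [2 * e] to be at most [dl / 2]. *)
pose e := Num.min (Num.min (d1 / 3) (d2 / 3)) (Num.min ((t - s) / 5) (dl ^+ 2 / (8 * (G + 1)))).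
have e0 : 0 < e.
  by rewrite !lt_min !divr_gt0 ?subr_gt0 ?exprn_gt0// mulr_gt0// ltr_wpDl.
have e_d1 : e <= d1 / 3 by rewrite !ge_min lexx.
have e_d2 : e <= d2 / 3 by rewrite !ge_min lexx !orbT.
have e_st : e <= (t - s) / 5 by rewrite !ge_min lexx !orbT.
have e_dl : e * (8 * (G + 1)) <= dl ^+ 2.
  by rewrite -ler_pdivlMr ?mulr_gt0 ?ltr_wpDl// !ge_min lexx !orbT.
have e_neq0 : e != 0 by rewrite gt_eqF.
pose p := s + e; pose q := t - e - e.
pose phi := fun x : R => step ((x - p) / e) - step ((x - q) / e).
pose D := `]a, b[%classic : set rT.
have mD : @measurable _ rT D by exact: mitv.
have dphi x : is_derive x (1 : R) phi (s' ((x - p) / e) / e - s' ((x - q) / e) / e).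
  by apply: is_deriveB; exact: aff_derive.
have tphi : test_fun a b phi.
  split.
    apply: smooth_derivable.
    have -> : phi = fun x => step (e^-1 * x + (- p / e)) + (-1) * step (e^-1 * x + (- q / e)).
      by apply/funext => x; rewrite mulN1r; congr (step _ - step _); ring.
    by apply: smoothD; [|apply: smoothM; [exact: smooth_cst|]]; exact: smooth_step.
  exists p, (t - e); split.
  - by rewrite /p; lra.
  - lra.
  - move=> x /=; rewrite in_itv/= => /negP; rewrite negb_and -!ltNge => /orP[xp|xt].
      rewrite /phi !step0 ?subrr// pmulr_lle0 ?invr_gt0// subr_le0 ?(ltW xp)//.
      by rewrite /q; move: xp; rewrite /p; lra.
    rewrite /phi !step1 ?subrr// ler_pdivlMr// mul1r; rewrite /q /p; clear -xt e0 e_st; lra.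
have /esym := fg _ tphi.
have -> : \int[leb]_(t in D) (f t * derive1n 1 phi t) =
    \int[leb]_(x in D) (f x * (s' ((x - p) / e) / e)) -
    \int[leb]_(x in D) (f x * (s' ((x - q) / e) / e)).
  have I r : I1 D (fun x => f x * (s' ((x - r) / e) / e)).
    apply: L2_I1M => //; apply: L2_bmeas => //; first exact: leb_itv_lty.
    exact: (mollify_bmeas cs ds M0 sM).
  rewrite -RIB//.
  apply: eq_Rintegral => x _; rewrite derive1n1 derive1E -mulrBr; congr (_ * _).
  by case: (dphi x).
have m1 : `|\int[leb]_(x in D) (f x * (s' ((x - p) / e) / e)) - f s| <= dl * M.
  apply: (mollify cs ds M0 sM) => //; try by rewrite /p; clear -e0 e_st as_ st tb; lra.
  move=> x /andP[px xp]; apply: H1; first by rewrite /p in px xp; clear -e0 e_st as_ st tb px xp d10 e_d1; apply/andP; split; lra.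
  by rewrite /p in px xp; rewrite ltr_norml; clear -e0 e_st as_ st tb px xp d10 e_d1; apply/andP; split; lra.
have m2 : `|\int[leb]_(x in D) (f x * (s' ((x - q) / e) / e)) - f t| <= dl * M.
  apply: (mollify cs ds M0 sM) => //; try by rewrite /q; clear -e0 e_st as_ st tb; lra.
  move=> x /andP[px xp]; apply: H2; first by rewrite /q in px xp; clear -e0 e_st as_ st tb px xp d20 e_d2; apply/andP; split; lra.
  by rewrite /q in px xp; rewrite ltr_norml; clear -e0 e_st as_ st tb px xp d20 e_d2; apply/andP; split; lra.
pose E1 := `]s, s + 2 * e[%classic : set rT.
pose E2 := `]t - 2 * e, t[%classic : set rT.
have phi01 x : `|phi x| <= 1.
  have /andP[a0 a1] := step_01 ((x - p) / e); have /andP[b0 b1] := step_01 ((x - q) / e).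
  by rewrite ler_norml /phi; clear -a0 a1 b0 b1; apply/andP; split; lra.
have bphi (E : set rT) : @measurable _ rT E -> bmeas E phi.
  move=> mE; split; last by exists 1.
  apply: (@measurable_funS _ _ _ _ setT) => //; apply: continuous_measurable_fun => x.
  by case: (dphi x) => /derivable1_diffP/differentiable_continuous.
have subst : `]s, t[%classic `<=` D by exact: subset_oo.
have phist x : ~~ (s < x < t) -> phi x = 0.
  rewrite negb_and -!leNgt => /orP[xp|xt].
    by rewrite /phi !step0 ?subrr// pmulr_lle0 ?invr_gt0// subr_le0 /q /p; clear -xp e0 e_st; lra.
  by rewrite /phi !step1 ?subrr// ler_pdivlMr// mul1r; rewrite /q /p; clear -xt e0 e_st; lra.
have gphi : \int[leb]_(x in D) (g x * phi x) = \int[leb]_(x in `]s, t[%classic) (g x * phi x).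
  apply: RI_supp => //; apply: aeW => x _ /=; rewrite in_itv/= => /negP nx.
  by rewrite phist// mulr0.
have Lgst : L2 `]s, t[%classic g by exact: L2_sub Lg.
have small s1 t1 : s <= s1 -> t1 <= t -> s1 <= t1 -> t1 - s1 <= 2 * e ->
    \int[leb]_(x in `]s1, t1[%classic) `|g x| <= dl / 2.
  move=> ss1 tt1 st1 st1e.
  have Lg1 : L2 `]s1, t1[%classic g by exact: L2_sub Lgst.
  have h1 := RI_CS1 st1 Lg1.
  have h2 : \int[leb]_(x in `]s1, t1[%classic) (g x ^+ 2) <= G.
    by apply: RI_sq_mono => //; clear -as_ tb ss1 tt1; lra.
  have h0 : 0 <= \int[leb]_(x in `]s1, t1[%classic) `|g x|.
    by apply: RI_ge0; apply: aeW.
  have dl2 : 0 <= dl / 2 by rewrite divr_ge0// ltW.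
  rewrite -(@ler_sqr _ _ (dl / 2))// (le_trans h1)//.
  apply: (@le_trans _ _ (2 * e * G)).
    apply: ler_pM => //; first by rewrite subr_ge0.
    by apply: RI_ge0; apply: aeW => x _; rewrite sqr_ge0.
  have : 0 <= e by exact: ltW.
  rewrite exprMn exprVn; move: e_dl G0; clear; nra.
have gdiff : `|\int[leb]_(x in `]s, t[%classic) (g x * phi x) -
    \int[leb]_(x in `]s, t[%classic) g x| <= dl.
  have Ig := L2_I1oo Lgst.
  have Igp : I1 `]s, t[%classic (fun x => g x * phi x).
    by apply: L2_I1M => //; apply: L2_bmeas => //; exact: bphi.
  have I3 : I1 `]s, t[%classic (fun x => g x * phi x - g x) by exact: I1B.
  rewrite -RIB// (le_trans (RI_abs _ I3))//.
  have I4 := I1_abs (mitv _) I3.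
  have bound s1 t1 : s <= s1 -> t1 <= t -> s1 <= t1 -> t1 - s1 <= 2 * e ->
      \int[leb]_(x in `]s1, t1[%classic) `|g x * phi x - g x| <= dl / 2.
    move=> h1 h2 h3 h4; apply: (le_trans _ (small s1 t1 h1 h2 h3 h4)).
    apply: RI_le => //; first exact: I1_sub I4.
      by apply: I1_abs => //; exact: I1_sub Ig.
    apply: aeW => x _; rewrite -[X in _ - X]mulr1 -mulrBr normrM ler_piMr//.
    have /andP[a0 a1] := step_01 ((x - p) / e); have /andP[b0 b1] := step_01 ((x - q) / e).
    have phi0 : 0 <= phi x.
      rewrite /phi; have [xq|xq] := leP (x - p) e.
        rewrite (@step0 _ ((x - q) / e)) ?subr0// pmulr_lle0 ?invr_gt0//.
        by move: xq; rewrite /q /p; clear -e0 e_st; lra.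
      by rewrite (@step1 _ ((x - p) / e)) ?subr_ge0// ler_pdivlMr// mul1r ltW.
    have phi1 := le_trans (ler_norm _) (phi01 x).
    by clear -phi0 phi1; rewrite ler_norml; apply/andP; split; lra.
  rewrite (@RI_split _ _ (p + e))//; last by rewrite /p; clear -e0 e_st as_ st tb; lra.
  rewrite [X in _ + X](@RI_split _ _ q)//; last 2 first.
  - by rewrite /p /q; clear -e0 e_st as_ st tb; lra.
  - by apply: I1_sub I4 => //; rewrite /p; clear -e0 e_st as_ st tb; lra.
  have -> : \int[leb]_(x in `]p + e, q[%classic) `|g x * phi x - g x| = 0.
    rewrite (@eq_Rintegral _ _ _ _ _ (fun=> 0)) ?Rintegral_cst ?mul0r//.
    move=> x; rewrite inE /= in_itv/= => /andP[xp xq].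
    have u1 : 1 <= (x - p) / e by rewrite ler_pdivlMr// mul1r; clear -xp; lra.
    have u0 : (x - q) / e <= 0 by rewrite pmulr_lle0 ?invr_gt0//; clear -xq; lra.
    rewrite /phi (step1 u1) (step0 u0).
    by rewrite subr0 mulr1 subrr normr0.
  rewrite add0r [leRHS]splitr lerD//; apply: bound => //; rewrite /p /q; clear -e0 e_st as_ st tb; lra.
rewrite gphi => HH.
have -> : f t - f s - \int[leb]_(x in `]s, t[%classic) g x =
   - (\int[leb]_(x in D) (f x * (s' ((x - q) / e) / e)) - f t)
   + (\int[leb]_(x in D) (f x * (s' ((x - p) / e) / e)) - f s)
   + (\int[leb]_(x in `]s, t[%classic) (g x * phi x) -
      \int[leb]_(x in `]s, t[%classic) g x) by move: HH; lra.
have -> : e' = dl * M + dl * M + dl.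
  by rewrite /dl; field; rewrite gt_eqF// ltr_wpDl// mulr_ge0.
rewrite (le_trans (ler_normD _ _))// lerD// (le_trans (ler_normD _ _))// lerD//.
by rewrite normrN.
Qed.

(** The primitive of [g] vanishes, and by Lebesgue's differentiation theorem its
    derivative is [g] almost everywhere. *)
Lemma ae0_of_int a b g : L2 `]a, b[%classic g ->
  (forall s t, a <= s -> s <= t -> t <= b -> \int[leb]_(x in `]s, t[%classic) g x = 0) ->
  aeq `]a, b[%classic g (fun=> 0).
Proof.
move=> Lg g0; have [g1 ig1 gg1] := L2_I1oo Lg.
pose h := g1 \_ `]a, b[%classic.
have ih : leb.-integrable setT (EFin \o h).
  rewrite -restrict_EFin; apply/integrable_restrict => //.
  by rewrite setTI.
have h0 x : a <= x -> x <= b -> \int[leb]_(t in `[a, x]%classic) h t = 0.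
  move=> ax xb; rewrite RI_cc_oo -(g0 a x)//; apply: RI_aeq.
  have sub : `]a, x[%classic `<=` `]a, b[%classic by exact: subset_oo.
  apply: aeq_trans (aeq_sub sub (aeq_sym gg1)).
  by apply: aeq_eq => t /sub tD; rewrite /h patchE mem_set.
have lh : locally_integrable [set: R] h.
  apply: open_integrable_locally => //; exact: openT.
have := @FTC1 R h (BLeft a) _ lh.
have ihy y : leb.-integrable [set` Interval (BLeft a) (BRight y)] (EFin \o h).
  exact: integrableS ih.
move=> /(_ ihy) F; apply: aeq_trans gg1 _.
apply: aeS F => x /= F; rewrite in_itv/= => /andP[ax xb].
have cond : (a%:E < x%:E)%E by rewrite lte_fin.
have [dF eF] := F cond.
have <- : h x = g1 x by rewrite /h patchE mem_set//= in_itv/= ax.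
apply: (@derive_locally_cst (fun y => \int[leb]_(t in `[a, y]%classic) h t) x _ 0
  (Num.min (x - a) (b - x))).
- by rewrite lt_min !subr_gt0 ax.
- move=> y; rewrite lt_min ltr_norml => /andP[/andP[y1 _] y2].
  by apply: h0; [lra|have := ler_norm (y - x); lra].
- by split; [exact: dF|rewrite -derive1E; exact: eF].
Qed.

(** The difference of the two derivatives is a weak derivative of 0, so its integrals
    over subintervals vanish. *)
Lemma sweak_uniq a b f f' g g' : sweak a b f g -> sweak a b f' g' ->
  aeq `]a, b[%classic f f' -> aeq `]a, b[%classic g g'.
Proof.
move=> [Lf Lg H] [Lf' Lg' H'] ff'.
have sw : sweak a b (fun=> 0) (fun x => g x - g' x).
  split; [exact: L2_bmeas (mitv _) (leb_itv_lty _ _) (bmeas_cst _ _)|exact: L2B|].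
  move=> phi tphi.
  have bphi : L2 `]a, b[%classic phi.
    apply: ccont_L2; apply: continuous_ccont => x.
    by case: tphi => /(_ 0%N x); rewrite derive1n0 => /derivable1_diffP/differentiable_continuous.
  under eq_Rintegral do rewrite mul0r.
  rewrite Rintegral_cst// mul0r.
  under eq_Rintegral do rewrite mulrBl.
  rewrite RIB//; [|exact: L2_I1M|exact: L2_I1M].
  apply/esym/eqP; rewrite oppr_eq0 subr_eq0 -eqr_opp -H// -H'//; apply/eqP.
  by apply: RI_aeq; exact: (aeq_comp (fun x u => u * derive1n 1 phi x)).
have c0 : ccont a b (fun=> 0).
  by move=> x _ e e0; exists 1 => // y _ _; rewrite subrr normr0 ltW.
have := @ae0_of_int a b (fun x => g x - g' x) (L2B (mitv _) Lg Lg').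
have i0 s t : a <= s -> s <= t -> t <= b ->
    \int[leb]_(x in `]s, t[%classic) (g x - g' x) = 0.
  by move=> as_ st tb; rewrite -(sweak_ftc sw c0)// subrr.
move=> /(_ i0); apply: aeS => x gg Dx; apply/eqP; rewrite -subr_eq0; apply/eqP; exact: gg.
Qed.

Lemma sweak_aeq a b f f' g g' : aeq `]a, b[%classic f f' -> aeq `]a, b[%classic g g' ->
  sweak a b f g -> sweak a b f' g'.
Proof.
move=> ff gg [Lf Lg H]; split.
- exact: L2_aeq (aeq_sym ff) Lf.
- exact: L2_aeq (aeq_sym gg) Lg.
- move=> phi tphi; have := H _ tphi.
  rewrite (RI_aeq (aeq_comp (fun x u => u * derive1n 1 phi x) ff)).
  by rewrite (RI_aeq (aeq_comp (fun x u => u * phi x) gg)).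
Qed.

Lemma test_fun_L2 a b (phi : R -> R) n : test_fun a b phi -> L2 `]a, b[%classic (derive1n n phi).
Proof.
case=> sm _; apply: ccont_L2; apply: continuous_ccont => x.
by have /derivable1_diffP/differentiable_continuous := sm n x.
Qed.

Lemma sweakD a b f f' g g' : sweak a b f g -> sweak a b f' g' ->
  sweak a b (fun x => f x + f' x) (fun x => g x + g' x).
Proof.
move=> [Lf Lg H] [Lf' Lg' H']; split; [exact: L2D|exact: L2D|] => phi tphi.
have T1 := test_fun_L2 1 tphi; have T0 := test_fun_L2 0 tphi.
under eq_Rintegral do rewrite mulrDl.
under [X in _ = - X]eq_Rintegral do rewrite mulrDl.
rewrite !RID//; try exact: L2_I1M.
by rewrite H// H'// opprD.
Qed.

Lemma sweakZ a b k f g : sweak a b f g -> sweak a b (fun x => k * f x) (fun x => k * g x).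
Proof.
move=> [Lf Lg H]; split; [exact: L2Z|exact: L2Z|] => phi tphi.
have T1 := test_fun_L2 1 tphi; have T0 := test_fun_L2 0 tphi.
under eq_Rintegral do rewrite -mulrA.
under [X in _ = - X]eq_Rintegral do rewrite -mulrA.
rewrite !RIZ//; try exact: L2_I1M.
by rewrite H// mulrN.
Qed.

(** Sobolev embedding, with the average of [f] as reference value. *)
Lemma sweak_sup a b f g : a < b -> sweak a b f g -> ccont a b f -> forall x, a <= x <= b ->
  `|f x| <= (b - a)^-1 * \int[leb]_(t in `]a, b[%classic) `|f t|
            + \int[leb]_(t in `]a, b[%classic) `|g t|.
Proof.
move=> ab sw cf x xab; have [Lf Lg _] := sw.
have ba : 0 < b - a by rewrite subr_gt0.
have Ig := I1_abs (mitv _) (L2_I1oo Lg); have If := I1_abs (mitv _) (L2_I1oo Lf).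
set G := \int[leb]_(t in _) `|g t|.
have sub s t : a <= s -> s <= t -> t <= b -> `|f t - f s| <= G.
  move=> as_ st tb; rewrite (sweak_ftc sw cf as_ st tb).
  rewrite (le_trans (RI_abs (mitv _) (L2_I1oo (L2_sub as_ tb Lg))))//.
  rewrite /G (@RI_split _ a s b)//; last by rewrite as_ (le_trans st).
  rewrite [X in _ + X](@RI_split _ s t b)//; last 2 first.
  - by rewrite st tb.
  - exact: I1_sub Ig.
  by rewrite addrCA lerDl addr_ge0//; apply: RI_ge0; apply: aeW.
have pt t : a <= t <= b -> `|f x| <= `|f t| + G.
  move=> /andP[at_ tb]; have /andP[ax xb] := xab; rewrite -lerBlDl.
  rewrite (le_trans (lerB_dist _ _))//; have [xt|tx] := leP x t.
    by rewrite distrC sub.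
  by rewrite sub// ltW.
rewrite -(@ler_pM2l _ (b - a))// mulrDr mulrA divff ?gt_eqF// mul1r.
have I c : I1 `]a, b[%classic (fun=> c).
  by apply: L2_I1oo; apply: L2_bmeas => //; exact: bmeas_cst.
have C c : \int[leb]_(t in `]a, b[%classic) c = (b - a) * c.
  by rewrite Rintegral_cst// leb_itvoo ?(ltW ab)// mulrC.
rewrite -!C -RID//; apply: RI_le => //; first exact: I1D.
by apply: aeW => t /=; rewrite in_itv/= => /andP[? ?]; apply: pt; rewrite !ltW.
Qed.

End weak_derivative.

(** * Semi-inner products *)

Section psd_forms.
Context {R : realType}.
Implicit Types (V : lmodType R).

(** Subspaces, linear maps and forms are relative to a subset [D] of an ambient space,
    in the way [nspace] presents its vectors. *)
Definition lsub V (D : set V) := D 0 /\ forall (k : R) x y, D x -> D y -> D (k *: x + y).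

Definition lin_on V (D : set V) (W : lmodType R) (l : V -> W) :=
  forall (k : R) x y, D x -> D y -> l (k *: x + y) = k *: l x + l y.

(** Semidefinite, because vectors are only determined up to norm zero. *)
Definition psd V (D : set V) (q : V -> V -> R) := [/\
  forall x y, D x -> D y -> q x y = q y x,
  forall (k : R) x y z, D x -> D y -> D z -> q (k *: x + y) z = k * q x z + q y z &
  forall x, D x -> 0 <= q x x].

Section one.
Variables (V : lmodType R) (D : set V).
Hypothesis sD : lsub D.

Lemma lsub0 : D 0. Proof. by case: sD. Qed.
Lemma lsubZ k x : D x -> D (k *: x).
Proof. by case: sD => D0 H Dx; rewrite -[_ *: _]addr0; exact: H. Qed.
Lemma lsubD x y : D x -> D y -> D (x + y).
Proof. by case: sD => D0 H Dx Dy; rewrite -[x]scale1r; exact: H. Qed.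
Lemma lsubB x y : D x -> D y -> D (x - y).
Proof. by move=> Dx Dy; rewrite addrC -scaleN1r; case: sD => _; exact. Qed.
Lemma lsub_sum (I : Type) (r : seq I) (F : I -> V) : (forall i, D (F i)) ->
  D (\sum_(i <- r) F i).
Proof.
by move=> DF; elim/big_ind: _ => [|x y Dx Dy|i _ //]; [exact: lsub0|exact: lsubD].
Qed.

Section lin.
Variables (W : lmodType R) (l : V -> W).
Hypothesis ll : lin_on D l.
Lemma lin_on0 : l 0 = 0.
Proof. by have := ll (-1) lsub0 lsub0; rewrite scaler0 addr0 scaleN1r addNr. Qed.
Lemma lin_onZ k x : D x -> l (k *: x) = k *: l x.
Proof. by move=> Dx; have := ll k Dx lsub0; rewrite !addr0 lin_on0 addr0. Qed.
Lemma lin_onD x y : D x -> D y -> l (x + y) = l x + l y.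
Proof. by move=> Dx Dy; have := ll 1 Dx Dy; rewrite !scale1r. Qed.
Lemma lin_onB x y : D x -> D y -> l (x - y) = l x - l y.
Proof. by move=> Dx Dy; rewrite addrC -scaleN1r ll// scaleN1r addrC. Qed.
Lemma lin_on_sum (I : Type) (r : seq I) (F : I -> V) : (forall i, D (F i)) ->
  l (\sum_(i <- r) F i) = \sum_(i <- r) l (F i).
Proof.
move=> DF; elim: r => [|i r IH]; first by rewrite !big_nil lin_on0.
by rewrite !big_cons lin_onD ?IH//; exact: lsub_sum.
Qed.
End lin.

Variable q : V -> V -> R.
Hypothesis pq : psd D q.

Lemma psdC x y : D x -> D y -> q x y = q y x. Proof. by case: pq => H _ _; exact: H. Qed.
Lemma psd_ge0 x : D x -> 0 <= q x x. Proof. by case: pq => _ _; exact. Qed.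
Lemma psd_linl z : D z -> lin_on D (fun x => q x z : R^o).
Proof. by case: pq => _ H _ Dz k x y Dx Dy; exact: H. Qed.
Lemma psd_linr z : D z -> lin_on D (fun x => q z x : R^o).
Proof.
move=> Dz k x y Dx Dy /=; rewrite psdC//; last by case: sD => _; exact.
by rewrite (psd_linl Dz)// (psdC Dx)// (psdC Dy).
Qed.

Lemma psd_expand x y t : D x -> D y ->
  q (x + t *: y) (x + t *: y) = q x x + 2 * t * q x y + t ^+ 2 * q y y.
Proof.
move=> Dx Dy; have Dty := lsubZ t Dy; have Ds := lsubD Dx Dty.
rewrite (lin_onD (psd_linl Ds))// (lin_onZ (psd_linl Ds))//.
rewrite (lin_onD (psd_linr Dx))// (lin_onZ (psd_linr Dx))//.
rewrite (lin_onD (psd_linr Dy))// (lin_onZ (psd_linr Dy))//.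
by rewrite (psdC Dy Dx) /GRing.scale/=; ring.
Qed.

Lemma psd_CS x y : D x -> D y -> q x y ^+ 2 <= q x x * q y y.
Proof.
move=> Dx Dy; apply: quad_discr; first exact: psd_ge0.
by move=> t; rewrite -psd_expand//; apply: psd_ge0; apply: lsubD => //; exact: lsubZ.
Qed.

Definition pnorm x := Num.sqrt (q x x).

Lemma psd_CSn x y : D x -> D y -> `|q x y| <= pnorm x * pnorm y.
Proof.
move=> Dx Dy; rewrite -sqrtrM ?psd_ge0// -sqrtr_sqr ler_sqrt ?psd_CS//.
by rewrite mulr_ge0// psd_ge0.
Qed.

Lemma pnorm_sqr x : D x -> pnorm x ^+ 2 = q x x.
Proof. by move=> Dx; rewrite sqr_sqrtr// psd_ge0. Qed.

Lemma pnorm_tri x y : D x -> D y -> pnorm (x + y) <= pnorm x + pnorm y.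
Proof.
move=> Dx Dy; rewrite -ler_sqr ?nnegrE ?sqrtr_ge0 ?addr_ge0 ?sqrtr_ge0//.
rewrite pnorm_sqr; last exact: lsubD.
have := @psd_expand x y 1 Dx Dy; rewrite scale1r => ->.
rewrite sqrrD !pnorm_sqr// expr1n mul1r mulr1.
by have := le_trans (ler_norm _) (psd_CSn Dx Dy); lra.
Qed.

Lemma pnormZ k x : D x -> pnorm (k *: x) = `|k| * pnorm x.
Proof.
move=> Dx; rewrite /pnorm (lin_onZ (psd_linl (lsubZ k Dx)))// (lin_onZ (psd_linr Dx))//.
by rewrite /GRing.scale/= mulrA -expr2 sqrtrM ?sqr_ge0// sqrtr_sqr.
Qed.

Lemma pnormB x y : D x -> D y -> pnorm (x - y) = pnorm (y - x).
Proof.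
move=> Dx Dy; rewrite -(opprB y x) -(scaleN1r (y - x)) pnormZ; last exact: lsubB.
by rewrite normrN1 mul1r.
Qed.

Lemma pnorm_lip x y : D x -> D y -> `|pnorm x - pnorm y| <= pnorm (x - y).
Proof.
move=> Dx Dy; have h1 := pnorm_tri (lsubB Dx Dy) Dy; have h2 := pnorm_tri (lsubB Dy Dx) Dx.
rewrite !subrK in h1 h2; rewrite (pnormB Dy Dx) in h2.
by rewrite ler_norml; apply/andP; split; lra.
Qed.

End one.

Lemma psdD V (D : set V) q1 q2 : psd D q1 -> psd D q2 -> psd D (fun x y => q1 x y + q2 x y).
Proof.
move=> [a1 a2 a3] [b1 b2 b3]; split.
- by move=> x y Dx Dy; rewrite a1// b1.
- by move=> k x y z Dx Dy Dz; rewrite a2// b2//; ring.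
- by move=> x Dx; rewrite addr_ge0 ?a3 ?b3.
Qed.

Lemma psdZ V (D : set V) q c : 0 <= c -> psd D q -> psd D (fun x y => c * q x y).
Proof.
move=> c0 [a1 a2 a3]; split.
- by move=> x y Dx Dy; rewrite a1.
- by move=> k x y z Dx Dy Dz; rewrite a2//; ring.
- by move=> x Dx; rewrite mulr_ge0 ?a3.
Qed.

Lemma psd_rank1 V (D : set V) (l : V -> R^o) : lin_on D l -> psd D (fun x y => l x * l y).
Proof.
move=> ll; split.
- by move=> x y _ _; exact: mulrC.
- by move=> k x y z Dx Dy Dz; rewrite ll// /GRing.scale/=; ring.
- by move=> x Dx; rewrite -expr2 sqr_ge0.
Qed.

Lemma psd_comp V (W : lmodType R) (D : set V) (E : set W) q (l : V -> W) : lin_on D l ->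
  (forall x, D x -> E (l x)) -> psd E q -> psd D (fun x y => q (l x) (l y)).
Proof.
move=> ll DE [a1 a2 a3]; split.
- by move=> x y Dx Dy; apply: a1; exact: DE.
- by move=> k x y z Dx Dy Dz; rewrite ll//; apply: a2; exact: DE.
- by move=> x Dx; apply: a3; exact: DE.
Qed.

Lemma psd_ext V (D : set V) q q' : (forall x y, D x -> D y -> q x y = q' x y) ->
  lsub D -> psd D q -> psd D q'.
Proof.
move=> e [_ sD] [a1 a2 a3]; split.
- by move=> x y Dx Dy; rewrite -!e// a1.
- by move=> k x y z Dx Dy Dz; rewrite -!e// ?a2//; exact: sD.
- by move=> x Dx; rewrite -e// a3.
Qed.

End psd_forms.

(** * Functions of time in spaces given by representatives *)

Section nspaces.
Context {R : realType}.
Local Notation leb := (@lebesgue_measure R).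
Local Notation rT := (measurableTypeR R).

Definition hilb (X : nspace R) (q : X -> X -> R) :=
  psd (dom X) q /\ forall x, dom X x -> nrm x = Num.sqrt (q x x).

Section bochner.
Variables (X : nspace R) (a b : R).
Hypothesis sX : lsub (dom X).
Local Notation D := (`]a, b[%classic : set rT).

Lemma simple_dom (s : R -> X) t : simple_fun s -> dom X (s t).
Proof.
case=> m [E [x [_ dx st]]]; rewrite st; apply: lsub_sum => // i.
exact: lsubZ.
Qed.

(** A simple function takes one value for each subset of its pieces, so that any
    function of it, linear or not, is simple as well. *)
Lemma simple_comp_meas (s : R -> X) (N : X -> R) : simple_fun s ->
  measurable_fun setT (fun t : rT => N (s t)).
Proof.
case=> m [E [x [mE _ st]]].
(* [A c] is where membership in the pieces is as prescribed by [c]. *)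
pose A (c : {ffun 'I_m -> bool}) : set rT := \bigcap_(i in [set: 'I_m]) (if c i then E i else ~` E i).
pose y (c : {ffun 'I_m -> bool}) := N (\sum_(i < m) (c i)%:R *: x i).
have -> : (fun t : rT => N (s t)) = (fun t => \sum_(c : {ffun 'I_m -> bool}) \1_(A c) t * y c).
  apply/funext => t; pose c0 := [ffun i : 'I_m => t \in E i].
  rewrite (bigD1 c0)//= big1 ?addr0 => [|c cc0].
    rewrite indicE mem_set ?mul1r.
      by rewrite /y st; congr N; apply: eq_bigr => i _; rewrite ffunE indicE.
    by move=> i _; rewrite ffunE; case: (boolP (t \in E i)) => [/set_mem//|/negP h /mem_set].
  rewrite indicE memNset ?mul0r// => At; move/eqP: cc0; apply; apply/ffunP => i.
  rewrite ffunE; have := At i I; case: (c i) => [/mem_set->//|h].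
  by apply/esym/negbTE; apply/negP => /set_mem.
apply: measurable_sum => c; apply: measurable_funM => //.
apply: measurable_indic; apply: fin_bigcap_measurable => // i _.
by case: (c i); [exact: mE|apply: measurableC; exact: mE].
Qed.

(** Simple functions approximate [f] in norm, hence [N] of them converges to [N] of [f]
    off a null set. *)
Lemma lip_aemeas (N : X -> R) K (f : R -> X) :
  (forall x y, dom X x -> dom X y -> `|N x - N y| <= K * nrm (x - y)) ->
  bochner_L2 X a b f ->
  exists2 g : rT -> R, measurable_fun D g & aeq D (fun t => N (f t)) g.
Proof.
move=> NK [df [s [ss sf]] _].
have cv : {ae leb, forall t : rT, D t -> (N (s n t) @[n --> \oo] --> N (f t))}.
  apply: aeS2 df sf => t df sf Dt; have {}df := df Dt; have {}sf := sf Dt.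
  apply/cvgrPdist_le => e e0.
  have K1 : 0 < `|K| + 1 by rewrite ltr_wpDl.
  move/cvgrPdist_le : sf => /(_ _ (divr_gt0 e0 K1)); apply: filterS => n.
  rewrite sub0r normrN => h.
  rewrite (le_trans (NK _ _ df (simple_dom t (ss n))))// (le_trans (ler_norm _))//.
  rewrite normrM; apply: (@le_trans _ _ ((`|K| + 1) * (e / (`|K| + 1)))).
    by apply: ler_pM => //; rewrite lerDl.
  by rewrite mulrCA divff ?gt_eqF// mulr1.
case: cv => Z [mZ Z0 sZ].
pose g := fun t : rT => if t \in Z then 0 else N (f t).
exists (g \_ D).
  have mD : @measurable _ rT D by exact: mitv.
  apply/(measurable_restrict _ mD mD) => //; rewrite setIid.
  apply: (@measurable_fun_cvg _ _ R D (fun n t => (\1_(~` Z) t : R) * N (s n t))) => //.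
    move=> n; apply: measurable_funM; apply: (@measurable_funS _ _ _ _ setT) => //.
      by apply: measurable_indic; exact: measurableC.
    exact: simple_comp_meas.
  move=> t Dt; rewrite /g indicE; case: ifPn => tZ.
    have -> : (t \in ~` Z) = false.
      by rewrite in_setC tZ.
    under eq_fun do rewrite mul0r; exact: cvg_cst.
  have -> : (t \in ~` Z) = true by rewrite in_setC.
  under eq_fun do rewrite mul1r.
  apply: contrapT => nc; move/negP : tZ; apply; rewrite inE; apply: sZ => /= h.
  exact/nc/h.
exists Z; split => // t /= h; apply: contrapT => tZ; apply: h => Dt.
by rewrite patchE mem_set// /g memNset.
Qed.

Lemma lip_L2 (N : X -> R) K (f : R -> X) :
  (forall x y, dom X x -> dom X y -> `|N x - N y| <= K * nrm (x - y)) ->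
  (forall x, dom X x -> `|N x| <= K * nrm x) ->
  bochner_L2 X a b f -> L2 D (fun t => N (f t)).
Proof.
move=> NK NK' bf; have [g mg Ng] := lip_aemeas NK bf; have [df _ foo] := bf.
pose c := `|K| + 1; have c0 : 0 < c by rewrite ltr_wpDl.
have : L2 D (fun t => c^-1 * N (f t)).
  exists (fun t => c^-1 * g t); split.
  - exact: measurable_funM.
  - apply/integrableP; split.
      by apply/measurable_EFinP; apply: measurable_funX; exact: measurable_funM.
    apply: le_lt_trans foo; apply: le_integral_ae => //.
      by move=> x _; rewrite lee_fin sqr_ge0.
    apply: aeS2 df Ng => t df Ng Dt.
    rewrite abse_EFin lee_fin ger0_norm ?sqr_ge0// -Ng//.
    have nK : `|c^-1 * N (f t)| <= `|nrm (f t)|.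
      rewrite normrM gtr0_norm ?invr_gt0// ler_pdivrMl//.
      rewrite (le_trans (NK' _ (df Dt)))// (le_trans (ler_norm _))// normrM.
      by rewrite ler_wpM2r// lerDl.
    by rewrite -real_normK ?num_real// -[leRHS]real_normK ?num_real// ler_sqr ?nnegrE.
  - exact: (aeq_comp (fun _ u => c^-1 * u)).
move=> /(L2Z c (mitv _)); apply: L2_aeq; apply: aeq_eq => t _.
by rewrite mulrA divff ?mul1r ?gt_eqF.
Qed.

Lemma dual_lin (l : X -> R) : dual X l -> lin_on (dom X) (l : X -> R^o).
Proof. by case=> ll _ k x y Dx Dy; exact: ll. Qed.

Lemma dual_lip (l : X -> R) : dual X l -> exists K,
  (forall x, dom X x -> `|l x| <= K * nrm x) /\
  (forall x y, dom X x -> dom X y -> `|l x - l y| <= K * nrm (x - y)).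
Proof.
move=> dl; have [_ [K HK]] := dl; exists K; split => // x y Dx Dy.
rewrite -(lin_onB (dual_lin dl) Dx Dy); apply: HK; exact: lsubB.
Qed.

Lemma dual_L2 (l : X -> R) f : dual X l -> bochner_L2 X a b f -> L2 D (fun t => l (f t)).
Proof. by move=> /dual_lip[K [H1 H2]]; exact: lip_L2 H2 H1. Qed.

Lemma sweak_dual (l : X -> R) f g : dual X l -> weak_deriv a b f g ->
  sweak a b (fun t => l (f t)) (fun t => l (g t)).
Proof.
by move=> dl [bf bg H]; split; [exact: dual_L2|exact: dual_L2|move=> phi tphi; exact: H].
Qed.

Lemma cont_dual (l : X -> R) f : dual X l -> cont a b f -> ccont a b (fun t => l (f t)).
Proof.
move=> /dual_lip[K [_ H2]] cf x xab e e0.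
have K1 : 0 < `|K| + 1 by rewrite ltr_wpDl.
have [|dfx +] := cf x; first by rewrite /= in_itv.
move=> /cvgrPdist_le/(_ _ (divr_gt0 e0 K1))/nbhs_ballP[d /= d0 h]; exists d => // y yab yx.
have [|dfy _] := cf y; first by rewrite /= in_itv.
have /h : ball x d y by rewrite /ball /= distrC.
rewrite /= in_itv/= => /(_ yab); rewrite sub0r normrN => {}h.
rewrite (le_trans (H2 _ _ dfy dfx))// (le_trans (ler_norm _))// normrM.
apply: (@le_trans _ _ ((`|K| + 1) * (e / (`|K| + 1)))).
  by apply: ler_pM => //; rewrite lerDl.
by rewrite mulrCA divff ?gt_eqF// mulr1.
Qed.

Lemma dual_comp_sub (l : X -> R) x y : dual X l -> dom X x -> dom X y -> nrm (x - y) = 0 ->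
  l x = l y.
Proof.
move=> /dual_lip[K [_ H]] Dx Dy n0; apply/eqP; rewrite -subr_eq0 -normr_le0.
by rewrite (le_trans (H _ _ Dx Dy))// n0 mulr0.
Qed.

(** The equality that vector-valued statements can determine: almost everywhere in time
    and up to a vector of norm zero. *)
Definition ae_same (f g : R -> X) := {ae leb, forall t : rT, D t ->
  [/\ dom X (f t), dom X (g t) & nrm (f t - g t) = 0]}.

Lemma wdiff_spec (f : R -> X) : (exists g, weak_deriv a b f g) ->
  weak_deriv a b f (wdiff a b f) /\
  ((exists g, weak_deriv a b f g /\ cont a b g) -> cont a b (wdiff a b f)).
Proof.
move=> [g fg]; rewrite /wdiff; case: xgetP => [w -> [? ?]//|no].
have [[h [fh ch]]|nc] := pselect (exists h, weak_deriv a b f h /\ cont a b h).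
  by case: (no h).
by case: (no g); split => // -[h fh]; case: nc; exists h.
Qed.

Section hilbertian.
Variable q : X -> X -> R.
Hypothesis hX : hilb q.

Lemma nrm_pnorm x : dom X x -> nrm x = pnorm q x. Proof. by case: hX => _; exact. Qed.

Lemma nrm_ge0 x : dom X x -> 0 <= nrm x.
Proof. by move=> Dx; rewrite nrm_pnorm// sqrtr_ge0. Qed.

Lemma nrm_lip x y : dom X x -> dom X y -> `|nrm x - nrm y| <= nrm (x - y).
Proof.
move=> Dx Dy; rewrite !nrm_pnorm//; last exact: lsubB.
by case: hX => pq _; exact: (pnorm_lip sX pq).
Qed.

Lemma nrm_tri x y : dom X x -> dom X y -> nrm (x + y) <= nrm x + nrm y.
Proof.
move=> Dx Dy; rewrite !nrm_pnorm//; last exact: lsubD.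
by case: hX => pq _; exact: (pnorm_tri sX pq).
Qed.

Lemma nrmZ k x : dom X x -> nrm (k *: x) = `|k| * nrm x.
Proof.
move=> Dx; rewrite !nrm_pnorm//; last exact: lsubZ.
by case: hX => pq _; exact: (pnormZ sX pq).
Qed.

Lemma nrmC x y : dom X x -> dom X y -> nrm (x - y) = nrm (y - x).
Proof.
move=> Dx Dy; rewrite -(opprB y x) -(scaleN1r (y - x)) nrmZ; last exact: lsubB.
by rewrite normrN1 mul1r.
Qed.

Lemma nrm_eq x y z : dom X x -> dom X y -> dom X z -> nrm (x - y) = 0 ->
  nrm (x - z) = nrm (y - z).
Proof.
move=> Dx Dy Dz n0; have xz := lsubB sX Dx Dz; have yz := lsubB sX Dy Dz.
have := nrm_lip xz yz; rewrite opprB addrA subrK n0 normr_le0 subr_eq0.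
by move/eqP.
Qed.

Lemma nrm0 : nrm (0 : X) = 0.
Proof. by rewrite -(scale0r 0) nrmZ ?normr0 ?mul0r//; exact: lsub0. Qed.

Lemma nrm_L2 f : bochner_L2 X a b f -> L2 D (fun t => nrm (f t)).
Proof.
apply: (@lip_L2 (fun x => nrm x) 1) => x; last first.
  by move=> Dx; rewrite mul1r ger0_norm// nrm_ge0.
by move=> y Dx Dy; rewrite mul1r nrm_lip.
Qed.

Lemma bochner_same f g : ae_same f g -> bochner_L2 X a b f -> bochner_L2 X a b g.
Proof.
move=> fg [df [s [ss sf]] foo]; split.
- by apply: aeS fg => t fg Dt; case: (fg Dt).
- exists s; split => //; apply: aeS2 fg sf => t fg sf Dt; have [dft dgt n0] := fg Dt.
  under eq_fun => n do rewrite -(nrm_eq dft dgt (simple_dom t (ss n)) n0).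
  exact: sf.
- apply: le_lt_trans foo; apply: le_integral_ae => //; try by move=> *; rewrite lee_fin sqr_ge0.
  apply: aeS fg => t fg Dt; have [dft dgt n0] := fg Dt.
  have := nrm_eq dft dgt (lsub0 sX) n0; rewrite !subr0 => ->.
  exact: lexx.
Qed.

Lemma dual_same (l : X -> R) f g : dual X l -> ae_same f g ->
  aeq D (fun t => l (f t)) (fun t => l (g t)).
Proof.
by move=> dl; apply: aeS => t fg Dt; have [*] := fg Dt; exact: dual_comp_sub.
Qed.

Lemma weak_deriv_same f f' g : ae_same f f' -> weak_deriv a b f g -> weak_deriv a b f' g.
Proof.
move=> ff' [bf bg H]; split => //; first exact: bochner_same ff' bf.
move=> phi l tphi dl; rewrite -H//; apply: RI_aeq.
exact: (aeq_comp (fun x u => u * derive1n 1 phi x) (aeq_sym (dual_same dl ff'))).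
Qed.

(** Countability turns statements that hold almost everywhere for each functional into
    statements about vectors that hold almost everywhere. *)
Definition separating (l : nat -> X -> R) := (forall n, dual X (l n)) /\
  forall x, dom X x -> (forall n, l n x = 0) -> nrm x = 0.

Variable sep : nat -> X -> R.
Hypothesis sepX : separating sep.

Lemma sep_eq x y : dom X x -> dom X y -> (forall n, sep n x = sep n y) -> nrm (x - y) = 0.
Proof.
move=> Dx Dy e; case: sepX => ds; apply; first exact: lsubB.
by move=> n; rewrite (lin_onB (dual_lin (ds n)))// e subrr.
Qed.

Lemma weak_deriv_uniq f f' g g' : ae_same f f' -> weak_deriv a b f g -> weak_deriv a b f' g' ->
  ae_same g g'.
Proof.
move=> ff' fg fg'; have [ds _] := sepX.
have : {ae leb, forall t : rT, forall n, D t -> sep n (g t) = sep n (g' t)}.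
  apply/ae_foralln => n; apply: (sweak_uniq (sweak_dual (ds n) fg) (sweak_dual (ds n) fg')).
  exact: dual_same.
case: fg fg' => _ [dg _ _] _ [_ [dg' _ _] _].
move=> H; apply: aeS2 H (aeS2 (fun _ => @conj _ _) dg dg') => t H [dg1 dg2] Dt.
by split; [exact: dg1|exact: dg2|apply: sep_eq; [exact: dg1|exact: dg2|move=> n; exact: H]].
Qed.

Lemma cont_same f g : a < b -> cont a b f -> cont a b g -> ae_same f g ->
  forall t, a <= t <= b -> [/\ dom X (f t), dom X (g t) & nrm (f t - g t) = 0].
Proof.
move=> ab cf cg fg t tab.
have [|df _] := cf t; first by rewrite /= in_itv.
have [|dg _] := cg t; first by rewrite /= in_itv.
split => //; apply: sep_eq => // n; have [ds _] := sepX.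
exact: (ccont_aeq ab (cont_dual (ds n) cf) (cont_dual (ds n) cg) (dual_same (ds n) fg)).
Qed.

End hilbertian.

End bochner.

(** Bounded linear operators; only their values on the domain matter. *)
Definition bop (X Y : nspace R) (P : X -> Y) := [/\
  forall x, dom X x -> dom Y (P x), lin_on (dom X) P &
  exists K, forall x, dom X x -> nrm (P x) <= K * nrm x].

Section push.
Variables (X Y : nspace R) (a b : R) (P : X -> Y).
Variables (qX : X -> X -> R) (qY : Y -> Y -> R).
Hypotheses (sX : lsub (dom X)) (sY : lsub (dom Y)) (hX : hilb qX) (hY : hilb qY) (bP : bop P).
Local Notation D := (`]a, b[%classic : set rT).

Lemma bop_dual (l : Y -> R) : dual Y l -> dual X (fun x => l (P x)).
Proof.
move=> [ll [K HK]]; have [dP lP [C HC]] := bP; split.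
  by move=> k x y Dx Dy; rewrite lP// ll//; exact: dP.
exists (`|K| * C) => x Dx; rewrite (le_trans (HK _ (dP _ Dx)))//.
rewrite (@le_trans _ _ (`|K| * nrm (P x)))//.
  by rewrite ler_wpM2r ?ler_norm// (nrm_ge0 hY)//; exact: dP.
by rewrite -mulrA ler_wpM2l// HC.
Qed.

Lemma bop_bochner f : bochner_L2 X a b f -> bochner_L2 Y a b (fun t => P (f t)).
Proof.
move=> bf; have [df [s [ss sf]] foo] := bf; have [dP lP [C HC]] := bP; split.
- by apply: aeS df => t df Dt; exact/dP/df.
- exists (fun n t => P (s n t)); split.
    move=> n; have [m [E [x [mE dx st]]]] := ss n; exists m, E, (fun i => P (x i)); split => //.
      by move=> i; exact: dP.
    move=> t; rewrite st (lin_on_sum sX lP)//; last by move=> i; exact: lsubZ.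
    by apply: eq_bigr => i _; rewrite (lin_onZ sX lP).
  apply: aeS2 df sf => t df sf Dt.
  have bd n : nrm (P (f t) - P (s n t)) <= C * nrm (f t - s n t).
    have Ds := simple_dom sX t (ss n); have Df := df Dt.
    by rewrite -(lin_onB lP)//; apply: HC; exact: lsubB.
  apply: (@squeeze_cvgr _ _ _ _ (fun=> 0) (fun n => C * nrm (f t - s n t))).
  + apply: nearW => n; rewrite bd andbT (nrm_ge0 hY)//; apply: lsubB => //; apply: dP.
      exact: df.
    exact: simple_dom.
  + exact: cvg_cst.
  + rewrite -[X in _ --> X](mulr0 C); apply: cvgM; first exact: cvg_cst.
    exact: sf.
- have : L2 D (fun t => C * nrm (f t)) by apply: L2Z => //; exact: (nrm_L2 sX hX).
  move=> [g [mg /integrableP[_ ig] fg]]; apply: le_lt_trans ig; apply: le_integral_ae => //.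
    by move=> *; rewrite lee_fin sqr_ge0.
  apply: aeS2 df fg => t df fg Dt; rewrite abse_EFin lee_fin ger0_norm ?sqr_ge0// -fg//.
  rewrite -[leLHS]real_normK ?num_real// -[leRHS]real_normK ?num_real// ler_sqr ?nnegrE//.
  by rewrite (ger0_norm (nrm_ge0 hY (dP _ (df Dt)))) (le_trans (HC _ (df Dt)))// ler_norm.
Qed.

Lemma bop_weak f g : weak_deriv a b f g ->
  weak_deriv a b (fun t => P (f t)) (fun t => P (g t)).
Proof.
move=> [bf bg H]; split; [exact: bop_bochner|exact: bop_bochner|].
by move=> phi l tphi dl; exact: (H phi (fun x => l (P x)) tphi (bop_dual dl)).
Qed.

Lemma bop_cont f : cont a b f -> cont a b (fun t => P (f t)).
Proof.
move=> cf t tab; have [df cft] := cf t tab; have [dP lP [C HC]] := bP; split; first exact: dP.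
have FF : Filter (within `[a, b]%classic (nbhs t)) by apply: within_filter; exact: nbhs_filter.
apply: (@squeeze_cvgr _ _ _ _ (fun=> 0) (fun s => C * nrm (f s - f t))).
- rewrite /prop_near1 /within /=; apply: nearW => s sab; have [dfs _] := cf s sab.
  rewrite (nrm_ge0 hY) /=; last by apply: lsubB => //; exact: dP.
  by rewrite -(lin_onB lP)//; apply: HC; exact: lsubB.
- exact: cvg_cst.
- rewrite -[X in _ --> X](mulr0 C); apply: cvgM; first exact: cvg_cst.
  exact: cft.
Qed.

Variable sep : nat -> Y -> R.
Hypothesis sepY : separating sep.

(** Bounded operators commute with weak derivatives, for the representatives that
    [wdiffn] selects in either space. By induction: the image of a selected derivative is a
    weak derivative, continuous whenever the original one is. *)
Lemma sobolev_push m f : a < b -> sobolev X a b m f ->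
  forall j, (j <= m)%N ->
    ae_same a b (fun t => P (wdiffn X a b j f t)) (wdiffn Y a b j (fun t => P (f t))) /\
    ((j < m)%N -> cont a b (wdiffn Y a b j (fun t => P (f t))) /\
      weak_deriv a b (wdiffn Y a b j (fun t => P (f t)))
                     (wdiffn Y a b j.+1 (fun t => P (f t)))).
Proof.
move=> ab [b1 b2]; elim=> [_|j IH jm].
  have n0 : ae_same a b (fun t => P (wdiffn X a b 0 f t)) (wdiffn Y a b 0 (fun t => P (f t))).
    have [df _ _] := b1 0%N isT; have [dP _ _] := bP.
    apply: aeS df => t df Dt; split; try exact/dP/df.
    by rewrite subrr (nrm0 sY hY).
  split=> // m0; have [c0 w0] := b2 0%N m0.
  split; first exact: bop_cont.
  apply: (wdiff_spec _).1; exists (fun t => P (wdiffn X a b 1 f t)).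
  exact: bop_weak.
have [n0 /(_ jm)[cj wj]] := IH (ltnW jm).
have [_ wX] := b2 j jm.
have n1 := weak_deriv_uniq sY sepY n0 (bop_weak wX) wj.
split; first exact: n1.
move=> j1m; have [cX1 wX1] := b2 j.+1 j1m.
have c1 : cont a b (wdiffn Y a b j.+1 (fun t => P (f t))).
  apply: (wdiff_spec _).2; first by exists (wdiffn Y a b j.+1 (fun t => P (f t))).
  exists (fun t => P (wdiffn X a b j.+1 f t)); split; last exact: bop_cont.
  by exact: (weak_deriv_same sY hY n0 (bop_weak wX)).
split; first exact: c1.
apply: (wdiff_spec _).1; exists (fun t => P (wdiffn X a b j.+2 f t)).
by exact: (weak_deriv_same sY hY n1 (bop_weak wX1)).
Qed.

End push.
End nspaces.

(** * Scalar Sobolev functions *)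

Import HBSimple.
Section scalar_sobolev.
Context {R : realType}.
Local Notation leb := (@lebesgue_measure R).
Local Notation rT := (measurableTypeR R).
Local Notation sc := (@scalars R).
Implicit Types (a b : R) (f g w : R -> R).

Lemma sc_lsub : lsub (dom sc). Proof. by []. Qed.
Hint Resolve sc_lsub : core.

Lemma sc_dual_id : dual sc (fun x : sc => x : R).
Proof. by split=> //; exists 1 => x _; rewrite mul1r. Qed.

Lemma sfun_simple (h : {sfun rT >-> R}) : @simple_fun R sc (h : R -> R).
Proof.
pose s := fset_set (h @` setT).
pose e := finmap.enum_fset s.
exists (size e), (fun i => h @^-1` [set e`_i]), (fun i => e`_i); split => //.
  move=> i; have := @measurable_sfunP _ _ _ _ h [set e`_i] (measurable_set1 _).
  exact.
move=> t; rewrite (fimfunEord h); apply: eq_bigr => i _.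
by rewrite /GRing.scale/= mulrC.
Qed.

Lemma bochner_scalarP a b f : bochner_L2 sc a b f <-> L2 `]a, b[%classic f.
Proof.
split=> [bf|[g [mg ig fg]]].
  by apply: (@lip_L2 R sc a b sc_lsub id 1) => // *; rewrite mul1r.
have mD : @measurable _ rT `]a, b[%classic by exact: mitv.
split; first exact: aeW.
- have mg' : measurable_fun (`]a, b[%classic : set rT) (EFin \o g) by exact/measurable_EFinP.
  have [s sg] := approximation_sfun mD mg'.
  exists (fun n => s n); split; first by move=> n; exact: sfun_simple.
  apply: aeS fg => t fg Dt /=.
  have cv : s n t @[n --> \oo] --> g t by have /fine_cvgP[_ h] := sg _ Dt; exact: h.
  rewrite fg//; apply/cvgrPdist_le => e e0; move/cvgrPdist_le : cv => /(_ e e0).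
  by apply: filterS => n; rewrite sub0r normrN normr_id.
- have fg2 := aeq_comp (fun _ u => u ^+ 2) fg.
  rewrite (@int_aeq _ _ _ (fun x => f x ^+ 2)); last first.
    by apply: aeq_eq => x _ /=; rewrite real_normK ?num_real.
  by rewrite (int_aeq fg2); exact: integrable_lty.
Qed.

Lemma weak_deriv_scalarP a b f g : @weak_deriv R sc a b f g <-> sweak a b f g.
Proof.
split=> [H|[Lf Lg H]]; first exact: (sweak_dual sc_lsub sc_dual_id H).
split; [exact/bochner_scalarP|exact/bochner_scalarP|].
move=> phi l tphi [ll _].
have l1 x : l x = l 1 * x.
  have l0 : l 0 = 0.
    by have := ll (-1) 0 0 I I; rewrite scaler0 addr0 mulN1r addNr.
  by have := ll x 1 0 I I; rewrite addr0 l0 addr0 /GRing.scale/= mulr1 mulrC.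
have T1 := test_fun_L2 1 tphi; have T0 := test_fun_L2 0 tphi.
under eq_Rintegral do rewrite l1 -mulrA.
under [X in _ = - X]eq_Rintegral do rewrite l1 -mulrA.
rewrite !RIZ//; try exact: L2_I1M.
by rewrite H// mulrN.
Qed.

Lemma cont_scalarP a b f : @cont R sc a b f <-> ccont a b f.
Proof.
split=> [|cf]; first exact: (cont_dual sc_lsub sc_dual_id).
move=> t tab; split => //.
have FF : Filter (within `[a, b]%classic (nbhs t)) by apply: within_filter; exact: nbhs_filter.
apply/cvgrPdist_le => e e0; have := cf t; rewrite /= in tab; rewrite in_itv/= in tab.
move=> /(_ tab e e0)[d d0 h]; apply/nbhs_ballP; exists d => //= y.
rewrite /ball /= => ty yab; rewrite sub0r normrN normr_id.
by apply: h; [move: yab; rewrite /= in_itv|rewrite distrC].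
Qed.

Lemma wdiff_aeq a b f f' : aeq `]a, b[%classic f f' ->
  @wdiff R sc a b f = @wdiff R sc a b f'.
Proof.
move=> ff; rewrite /wdiff; congr (xget _ _).
have E g : @weak_deriv R sc a b f g = @weak_deriv R sc a b f' g.
  apply/propext; rewrite !weak_deriv_scalarP; split.
    by apply: sweak_aeq => //; exact: aeq_refl.
  by apply: sweak_aeq; [exact: aeq_sym|exact: aeq_refl].
apply/funext => g; apply/propext => /=; rewrite E; split=> -[h1 h2]; split => // -[h];
  by [rewrite -E => ?; apply: h2; exists h|rewrite E => ?; apply: h2; exists h].
Qed.

(** Whatever [wdiff] selects is determined by any chain of derivatives: almost everywhere
    by uniqueness, and at every point where both sides are continuous. *)
Lemma sob_char a b k (g : nat -> R -> R) : a < b ->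
  (forall j, (j < k)%N -> ccont a b (g j) /\ sweak a b (g j) (g j.+1)) ->
  L2 `]a, b[%classic (g k) ->
  sobolev sc a b k (g 0%N) /\ (forall j, (j <= k)%N ->
    aeq `]a, b[%classic (wdiffn sc a b j (g 0%N)) (g j) /\
    ((j < k)%N -> forall x, a <= x <= b -> wdiffn sc a b j (g 0%N) x = g j x)).
Proof.
move=> ab Hg Lk; set W := fun j => wdiffn sc a b j (g 0%N).
have key j : (j <= k)%N -> aeq `]a, b[%classic (W j) (g j) /\
    ((j < k)%N -> ccont a b (W j) /\ sweak a b (W j) (W j.+1)).
  elim: j => [_|j IH jk].
    split; first exact: aeq_refl.
    move=> k0; have [c0 w0] := Hg 0%N k0; split; first exact: c0.
    apply/weak_deriv_scalarP; apply: (wdiff_spec _).1; exists (g 1%N).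
    exact/weak_deriv_scalarP.
  have [a0 /(_ jk)[cj wj]] := IH (ltnW jk); have [_ gj] := Hg j jk.
  have a1 := sweak_uniq wj gj a0.
  split; first exact: a1.
  move=> j1k; have [c1 w1] := Hg j.+1 j1k; split.
    apply/cont_scalarP; apply: (wdiff_spec _).2.
      by exists (W j.+1); apply/weak_deriv_scalarP; exact: wj.
    exists (g j.+1); split; last exact/cont_scalarP.
    apply/weak_deriv_scalarP; apply: sweak_aeq gj; [exact: aeq_sym|exact: aeq_refl].
  apply/weak_deriv_scalarP; apply: (wdiff_spec _).1; exists (g j.+2).
  apply/weak_deriv_scalarP; apply: sweak_aeq w1; [exact: aeq_sym|exact: aeq_refl].
split.
  split=> j jk.
    apply/bochner_scalarP; have [aj] := key j jk.
    move: jk; rewrite leq_eqVlt => /orP[/eqP jk _|jk /(_ jk)[_ [Lj _ _]]]; last exact: Lj.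
    by move: aj; rewrite jk => aj; exact: L2_aeq aj Lk.
  have [_ /(_ jk)[cj wj]] := key j (ltnW jk).
  by split; [exact/cont_scalarP|exact/weak_deriv_scalarP].
move=> j jk; have [aj cwj] := key j jk; split; first exact: aj.
move=> jk'; have [cj _] := cwj jk'; have [gj _] := Hg j jk'.
exact: ccont_aeq ab cj gj aj.
Qed.

Lemma sob_elim a b k w : sobolev sc a b k w ->
  (forall j, (j < k)%N -> ccont a b (wdiffn sc a b j w) /\
     sweak a b (wdiffn sc a b j w) (wdiffn sc a b j.+1 w)) /\
  (forall j, (j <= k)%N -> L2 `]a, b[%classic (wdiffn sc a b j w)).
Proof.
move=> [h1 h2]; split=> j jk; last exact/bochner_scalarP/h1.
have [c s] := h2 j jk; split; [exact/cont_scalarP|exact/weak_deriv_scalarP].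
Qed.

End scalar_sobolev.
#[export] Hint Resolve sc_lsub : core.

(** * The Sobolev spaces of an interval *)

Section Hk_spaces.
Context {R : realType}.
Local Notation leb := (@lebesgue_measure R).
Local Notation rT := (measurableTypeR R).
Local Notation sc := (@scalars R).
Variable L : R.
Hypothesis L0 : 0 < L.
Local Notation Dx := (Dx L).
Local Notation D := (`]0, L[%classic : set rT).
Implicit Types (w : R -> R^o).

Lemma Dx_L2 k w j : dom (Hk L k) w -> (j <= k)%N -> L2 D (Dx j w).
Proof. by move=> /sob_elim[_ H] /H. Qed.

Lemma Dx_sweak k w j : dom (Hk L k) w -> (j < k)%N -> sweak 0 L (Dx j w) (Dx j.+1 w).
Proof. by move=> /sob_elim[H _] /H[]. Qed.

Lemma Dx_ccont k w j : dom (Hk L k) w -> (j < k)%N -> ccont 0 L (Dx j w).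
Proof. by move=> /sob_elim[H _] /H[]. Qed.

Lemma Dx_ftc k w j s t : dom (Hk L k) w -> (j < k)%N -> 0 <= s -> s <= t -> t <= L ->
  Dx j w t - Dx j w s = \int[leb]_(x in `]s, t[%classic) Dx j.+1 w x.
Proof. by move=> dw jk; apply: sweak_ftc; [exact: Dx_sweak dw jk|exact: Dx_ccont dw jk]. Qed.

Lemma DxS w j : Dx j.+1 w = @wdiff R sc 0 L (Dx j w).
Proof. exact: erefl. Qed.

Lemma Dx_aeq w w' j : aeq D w w' -> Dx j.+1 w = Dx j.+1 w'.
Proof.
move=> ww; elim: j => [|j IH]; rewrite DxS [RHS]DxS.
  exact: (wdiff_aeq ww).
by rewrite IH.
Qed.

Lemma Hk_lin k (c : R) w1 w2 : dom (Hk L k) w1 -> dom (Hk L k) w2 ->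
  [/\ dom (Hk L k) (c *: w1 + w2),
     forall j, (j <= k)%N -> aeq D (Dx j (c *: w1 + w2)) (fun x => c * Dx j w1 x + Dx j w2 x) &
     forall j, (j < k)%N -> forall x, 0 <= x <= L ->
       Dx j (c *: w1 + w2) x = c * Dx j w1 x + Dx j w2 x].
Proof.
move=> d1 d2; pose g j := fun x => c * Dx j w1 x + Dx j w2 x.
have := @sob_char R 0 L k g L0.
case=> [j jk||h1 h2].
- split; first by apply: ccontD; [apply: ccontZ; exact: Dx_ccont d1 jk|exact: Dx_ccont d2 jk].
  by apply: sweakD; [apply: sweakZ; exact: Dx_sweak d1 jk|exact: Dx_sweak d2 jk].
- apply: L2D (mitv _) _ (Dx_L2 d2 (leqnn k)); apply: L2Z => //.
  exact: Dx_L2 d1 (leqnn k).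
have eg : c *: w1 + w2 = g 0%N by [].
split; rewrite eg; first exact: h1.
  by move=> j jk; have [H _] := h2 j jk; exact: H.
by move=> j jk; have [_ H] := h2 j (ltnW jk); exact: H.
Qed.

Lemma Hk_sub k w1 w2 : dom (Hk L k) w1 -> dom (Hk L k) w2 ->
  [/\ dom (Hk L k) (w1 - w2),
     forall j, (j <= k)%N -> aeq D (Dx j (w1 - w2)) (fun x => Dx j w1 x - Dx j w2 x) &
     forall j, (j < k)%N -> forall x, 0 <= x <= L -> Dx j (w1 - w2) x = Dx j w1 x - Dx j w2 x].
Proof.
move=> d1 d2; have [h1 h2 h3] := Hk_lin (-1) d2 d1.
have e : w1 - w2 = -1 *: w2 + w1 by rewrite scaleN1r addrC.
rewrite e; split; first exact: h1.
  move=> j jk; apply: aeq_trans (h2 j jk) _; apply: aeq_eq => x _.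
  by rewrite mulN1r addrC.
by move=> j jk x xL; rewrite h3// mulN1r addrC.
Qed.

Lemma Hk0 k : [/\ dom (Hk L k) 0, forall j, (j <= k)%N -> aeq D (Dx j 0) (fun=> 0) &
  forall j, (j < k)%N -> forall x, 0 <= x <= L -> Dx j 0 x = 0].
Proof.
have c0 : ccont 0 L (fun=> 0 : R).
  by move=> x _ e e0; exists 1 => // y _ _; rewrite subrr normr0 ltW.
have l0 : L2 D (fun=> 0) by exact: ccont_L2.
have := @sob_char R 0 L k (fun _ _ => 0) L0.
case=> [j jk||h1 h2].
- split; first exact: c0.
  split; [exact: l0|exact: l0|move=> phi _].
  under eq_Rintegral do rewrite mul0r.
  under [X in _ = - X]eq_Rintegral do rewrite mul0r.
  by rewrite Rintegral_cst// mul0r oppr0.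
- exact: l0.
have eg : (0 : R -> R^o) = (fun=> 0) by [].
split; rewrite eg; first exact: h1.
  by move=> j jk; have [H _] := h2 j jk; exact: H.
by move=> j jk; have [_ H] := h2 j (ltnW jk); exact: H.
Qed.

Lemma Hk_lsub k : lsub (dom (Hk L k)).
Proof.
split; first by have [] := Hk0 k.
by move=> c x y dx dy; have [] := Hk_lin c dx dy.
Qed.

Definition wform j (m : R -> R) (w1 w2 : R -> R^o) : R :=
  \int[leb]_(x in D) (m x * Dx j w1 x * Dx j w2 x).

Lemma wform_I1 k j m w1 w2 : (j <= k)%N -> bmeas D m ->
  dom (Hk L k) w1 -> dom (Hk L k) w2 -> I1 D (fun x => m x * Dx j w1 x * Dx j w2 x).
Proof.
move=> jk bm d1 d2; apply: L2_I1M => //; last exact: Dx_L2 d2 jk.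
by apply: L2M => //; exact: Dx_L2 d1 jk.
Qed.

Lemma wform_psd k j m : (j <= k)%N -> bmeas D m -> (forall x, D x -> 0 <= m x) ->
  psd (dom (Hk L k)) (wform j m).
Proof.
move=> jk bm m0; split.
- by move=> x y dx dy; apply: eq_Rintegral => t _; rewrite mulrAC.
- move=> c x y z dx dy dz; have [_ /(_ j jk) e _] := Hk_lin c dx dy.
  have I1 := wform_I1 jk bm dx dz; have I2 := wform_I1 jk bm dy dz.
  rewrite /wform -RIZ// -RID//; last exact: I1Z.
  rewrite (RI_aeq (aeq_comp (fun t u => m t * u * Dx j z t) e)).
  by apply: eq_Rintegral => t _; ring.
- move=> x dx; apply: RI_ge0; apply: aeW => t Dt; rewrite -mulrA -expr2.
  by rewrite mulr_ge0 ?sqr_ge0 ?m0.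
Qed.

Definition Hk_form k (w1 w2 : R -> R^o) : R := \sum_(j < k.+1) wform j (fun=> 1) w1 w2.

Lemma Hk_psd k : psd (dom (Hk L k)) (Hk_form k).
Proof.
have H n : (n <= k.+1)%N -> psd (dom (Hk L k))
    (fun w1 w2 => \sum_(j < n) wform j (fun=> 1) w1 w2).
  elim: n => [_|n IH nk].
    split; [by move=> *; rewrite !big_ord0| |by move=> *; rewrite big_ord0].
    by move=> *; rewrite !big_ord0 mulr0 addr0.
  have p1 : psd (dom (Hk L k)) (wform n (fun=> 1)).
    by apply: wform_psd => //; exact: bmeas_cst.
  apply: (psd_ext _ (Hk_lsub k) (psdD (IH (ltnW nk)) p1)) => x y _ _.
  by rewrite big_ord_recr.
exact: H.
Qed.

Lemma Hk_hilb k : @hilb R (Hk L k) (Hk_form k).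
Proof.
split; first exact: Hk_psd.
move=> w dw; congr Num.sqrt; apply: eq_bigr => j _; apply: eq_Rintegral => x _ /=.
by rewrite mul1r -expr2 real_normK ?num_real.
Qed.

Lemma Dx_nrm k j w : dom (Hk L k) w -> (j <= k)%N ->
  \int[leb]_(x in D) (Dx j w x ^+ 2) <= nrm (w : Hk L k) ^+ 2.
Proof.
move=> dw jk; have [p ->//] := Hk_hilb k; rewrite sqr_sqrtr ?(psd_ge0 p)//.
have jk' : (j < k.+1)%N by [].
rewrite /Hk_form (bigD1 (Ordinal jk')) //=.
have -> : wform j (fun=> 1) w w = \int[leb]_(x in D) (Dx j w x ^+ 2).
  by apply: eq_Rintegral => x _; rewrite mul1r expr2.
rewrite lerDl sumr_ge0// => i _; apply: RI_ge0; apply: aeW => x _.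
by rewrite mul1r -expr2 sqr_ge0.
Qed.

Lemma Hk_dom_le k k' w : (k' <= k)%N -> dom (Hk L k) w -> dom (Hk L k') w.
Proof.
move=> kk [h1 h2]; split=> j jk; first by apply: h1; exact: leq_trans kk.
by apply: h2; exact: leq_trans kk.
Qed.

Lemma Hk_nrm_le k k' w : (k' <= k)%N -> dom (Hk L k) w ->
  nrm (w : Hk L k') <= nrm (w : Hk L k).
Proof.
move=> kk dw; have [_ ->//] := Hk_hilb k; have [_ ->//] := Hk_hilb k'; last first.
  exact: Hk_dom_le kk dw.
rewrite ler_wsqrtr// /Hk_form -(big_mkord xpredT (fun j => wform j (fun=> 1) w w)).
rewrite -(big_mkord xpredT (fun j => wform j (fun=> 1) w w)) (@big_cat_nat _ _ _ k'.+1 0 k.+1)//=.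
rewrite lerDl sumr_ge0// => i _; apply: RI_ge0; apply: aeW => x _.
by rewrite mul1r -expr2 sqr_ge0.
Qed.

Lemma RI_sqrt (f : rT -> R) K s t : s <= t -> 0 <= K -> L2 `]s, t[%classic f ->
  \int[leb]_(x in `]s, t[%classic) (f x ^+ 2) <= K ^+ 2 ->
  \int[leb]_(x in `]s, t[%classic) `|f x| <= Num.sqrt (t - s) * K.
Proof.
move=> st K0 Lf fK; rewrite -ler_sqr ?nnegrE ?mulr_ge0 ?sqrtr_ge0//; last first.
  by apply: RI_ge0; apply: aeW.
rewrite (le_trans (RI_CS1 st Lf))// exprMn sqr_sqrtr ?subr_ge0//.
by rewrite ler_wpM2l ?subr_ge0.
Qed.

Lemma Hk_nrm_ge0 k w : dom (Hk L k) w -> 0 <= nrm (w : Hk L k).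
Proof. by move=> dw; have [_ ->//] := Hk_hilb k; rewrite sqrtr_ge0. Qed.

Lemma Hk_eval_bound k w x : (0 < k)%N -> dom (Hk L k) w -> 0 <= x <= L ->
  `|w x| <= (L^-1 + 1) * Num.sqrt L * nrm (w : Hk L k).
Proof.
move=> k0 dw xL.
have := sweak_sup L0 (Dx_sweak dw k0) (Dx_ccont dw k0) xL.
move=> /le_trans; apply; rewrite -mulrA mulrDl mul1r subr0.
have b j : (j <= k)%N ->
    \int[leb]_(x in D) `|Dx j w x| <= Num.sqrt L * nrm (w : Hk L k).
  move=> jk; rewrite -[X in Num.sqrt X]subr0; apply: RI_sqrt; first exact: ltW.
  - exact: Hk_nrm_ge0.
  - exact: Dx_L2 dw jk.
  - exact: Dx_nrm.
by apply: lerD; [rewrite ler_wpM2l ?invr_ge0 ?(ltW L0) ?b|rewrite b].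
Qed.

Lemma Hk_eval_dual k x : (0 < k)%N -> 0 <= x <= L -> dual (Hk L k) (fun w => w x).
Proof.
move=> k0 xL; split; first by [].
by exists ((L^-1 + 1) * Num.sqrt L) => w dw; exact: Hk_eval_bound.
Qed.

(** The rational points of the interval, which are dense; 0 is a default value. *)
Definition qpt (n : nat) : R :=
  let x := if unpickle n is Some q then ratr q else 0 in if 0 <= x <= L then x else 0.

Lemma qpt_itv n : 0 <= qpt n <= L.
Proof. by rewrite /qpt; case: ifP => // _; rewrite lexx ltW. Qed.

Lemma qpt_dense f : ccont 0 L f -> (forall n, f (qpt n) = 0) ->
  forall x, 0 <= x <= L -> f x = 0.
Proof.
move=> cf f0 x xL; apply/eqP; rewrite -normr_le0; apply/ler_addgt0Pr => e e0.
rewrite add0r; have [d d0 h] := cf x xL e e0; have /andP[x0 xl] := xL.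
have [q] : exists q, ratr q \in `]Num.max 0 (x - d), Num.min L (x + d)[.
  apply: rat_in_itvoo; rewrite lt_min !gt_max L0 /=; apply/and3P; split; lra.
rewrite in_itv/= gt_max lt_min => /andP[/andP[q0 q1] /andP[q2 q3]].
have eq_ : qpt (pickle q) = ratr q by rewrite /qpt pickleK !ltW.
have := h (qpt (pickle q)) (qpt_itv _).
rewrite f0 sub0r normrN; apply.
by rewrite eq_ ltr_norml; apply/andP; split; lra.
Qed.

Lemma Hk_nrm_eq0 k w : (0 < k)%N -> dom (Hk L k) w ->
  (forall x, 0 <= x <= L -> w x = 0) -> nrm (w : Hk L k) = 0.
Proof.
move=> k0 dw w0; have [_ ->//] := Hk_hilb k.
have [_ z0 _] := Hk0 k.
have ww : aeq D w (0 : R -> R).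
  by apply: aeq_eq => x /=; rewrite in_itv/= => /andP[? ?]; apply: w0; rewrite !ltW.
rewrite /Hk_form big1 ?sqrtr0// => j _.
have wj : aeq D (Dx j w) (fun=> 0).
  move: (ltn_ord j); case: (nat_of_ord j) => [_|i ik]; first exact: ww.
  by rewrite (Dx_aeq i ww); exact: z0.
rewrite /wform (RI_aeq (aeq_comp (fun _ u => 1 * u * u) wj)).
under eq_Rintegral do rewrite mulr0.
by rewrite Rintegral_cst// mul0r.
Qed.

Lemma Hk_sep k : (0 < k)%N -> @separating R (Hk L k) (fun n w => w (qpt n)).
Proof.
move=> k0; split; first by move=> n; apply: Hk_eval_dual => //; exact: qpt_itv.
move=> w dw w0; apply: Hk_nrm_eq0 => //; apply: qpt_dense => //.
exact: (Dx_ccont dw k0).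
Qed.

Lemma Ht_dom k w : dom (Ht L k) w -> dom (Hk L k) w. Proof. by case. Qed.

Lemma Ht_lsub k : (1 < k)%N -> lsub (dom (Ht L k)).
Proof.
move=> k1; have k0 := ltnW k1; split.
  have [d _ /(_ _ k1) z] := Hk0 k; split => //; apply: z.
  by rewrite lexx ltW.
move=> c x y [dx x0 x1] [dy y0 y1]; have [d _ /(_ _ k1) z] := Hk_lin c dx dy.
split; first exact: d.
  by change (c * x 0 + y 0 = 0); rewrite x0 y0 mulr0 addr0.
rewrite z; first by rewrite x1 y1 mulr0 addr0.
by rewrite lexx ltW.
Qed.

Lemma psd_sub (V : lmodType R) (D1 D2 : set V) q : D1 `<=` D2 -> psd D2 q -> psd D1 q.
Proof.
move=> s [a1 a2 a3]; split.
- by move=> x y /s Dx /s Dy; exact: a1.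
- by move=> k x y z /s Dx /s Dy /s Dz; exact: a2.
- by move=> x /s; exact: a3.
Qed.

Lemma Ht_hilb k : @hilb R (Ht L k) (Hk_form k).
Proof.
split; first exact: psd_sub (@Ht_dom k) (Hk_psd k).
by move=> w /Ht_dom dw; have [_ H] := Hk_hilb k; exact: H.
Qed.

Lemma Ht_Hk_bop k : @bop R (Ht L k) (Hk L k) id.
Proof.
split; [exact: Ht_dom|by []|exists 1 => x dx].
by rewrite mul1r.
Qed.

Lemma Ht_bop k k' : (k' <= k)%N -> @bop R (Ht L k) (Ht L k') id.
Proof.
move=> kk; split.
- by move=> w [dw w0 w1]; split => //; exact: Hk_dom_le kk dw.
- by [].
- by exists 1 => w /Ht_dom dw; rewrite mul1r; exact: Hk_nrm_le.
Qed.

Lemma Ht_sep k : (0 < k)%N -> @separating R (Ht L k) (fun n w => w (qpt n)).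
Proof.
move=> k0; have [h1 h2] := Hk_sep k0; split.
  move=> n; have [_ [K HK]] := h1 n; split; first by [].
  by exists K => w /Ht_dom; exact: HK.
by move=> w /Ht_dom; exact: h2.
Qed.

(** The boundary conditions at the origin make this seminorm a norm, see [Dx0_bound]. *)
Definition en (w : R -> R^o) : R := Num.sqrt (\int[leb]_(x in D) (Dx 2 w x ^+ 2)).

Lemma en_sqr w : en w ^+ 2 = \int[leb]_(x in D) (Dx 2 w x ^+ 2).
Proof. by rewrite sqr_sqrtr//; apply: RI_ge0; apply: aeW => x _; rewrite sqr_ge0. Qed.

Lemma en_nrm k w : (1 < k)%N -> dom (Ht L k) w -> en w <= nrm (w : Ht L k).
Proof.
move=> k1 /Ht_dom dw; have n0 := Hk_nrm_ge0 dw.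
by rewrite -ler_sqr ?nnegrE ?sqrtr_ge0// en_sqr; exact: Dx_nrm.
Qed.

Lemma Dx1_bound w x : dom (Ht L 2) w -> 0 <= x <= L -> `|Dx 1 w x| <= Num.sqrt L * en w.
Proof.
move=> [dw w0 w1] /andP[x0 xL].
have L2w : L2 `]0, x[%classic (Dx 2 w) by apply: L2_sub (Dx_L2 dw (leqnn 2)).
have := @Dx_ftc 2 w 1 0 x dw isT (lexx _) x0 xL; rewrite w1 subr0 => ->.
rewrite (le_trans (RI_abs (mitv _) (L2_I1oo L2w)))//.
apply: (@le_trans _ _ (Num.sqrt (x - 0) * en w)).
  apply: RI_sqrt => //; first exact: sqrtr_ge0.
  by rewrite en_sqr; apply: RI_sq_mono => //; exact: Dx_L2 dw (leqnn 2).
by rewrite subr0 ler_wpM2r ?sqrtr_ge0// ler_wsqrtr.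
Qed.

Lemma Dx0_bound w x : dom (Ht L 2) w -> 0 <= x <= L -> `|w x| <= L * (Num.sqrt L * en w).
Proof.
move=> hw /andP[x0 xL]; have [dw w0 w1] := hw.
have L2w : L2 `]0, x[%classic (Dx 1 w) by apply: L2_sub (Dx_L2 dw (isT : (1 <= 2)%N)).
have -> : w x = \int[leb]_(x in `]0, x[) Dx 1 w x.
  have := @Dx_ftc 2 w 0 0 x dw isT (lexx _) x0 xL.
  by rewrite [Dx 0 w 0]w0 subr0.
rewrite (le_trans (RI_abs (mitv _) (L2_I1oo L2w)))//.
apply: (@le_trans _ _ (\int[leb]_(t in `]0, x[%classic) (Num.sqrt L * en w))).
  apply: RI_le => //; first by apply: I1_abs => //; exact: L2_I1oo.
    by apply: L2_I1oo; apply: L2_bmeas => //; exact: bmeas_cst.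
  apply: aeW => t /=; rewrite in_itv/= => /andP[t0 tx]; apply: Dx1_bound => //.
  by rewrite (ltW t0) (le_trans (ltW tx)).
rewrite Rintegral_cst// leb_itvoo// subr0 mulrC ler_wpM2r//.
by rewrite mulr_ge0 ?sqrtr_ge0.
Qed.

End Hk_spaces.

(* From here on only [wdiff_spec] is used of the choice made in [wdiff]. *)
#[global] Opaque wdiff.

(** * The energy forms of the beam *)

Section beam_forms.
Context {R : realType}.
Local Notation leb := (@lebesgue_measure R).
Local Notation rT := (measurableTypeR R).
Variable B : beam R.
Hypothesis hB : beam_ok B.
Local Notation L := (bL B).
Local Notation Dx := (Dx L).
Local Notation D := (`]0, L[%classic : set rT).
Implicit Types (w : R -> R^o).

Lemma bL_gt0 : 0 < L. Proof. by case: hB => -[]. Qed.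
Local Notation L0 := bL_gt0.

Lemma L_itv : 0 <= L <= L. Proof. by rewrite lexx ltW ?L0. Qed.

Lemma Ck_ccont k f : Ck L k f -> ccont 0 L f.
Proof. by case=> g [<- cg _]; apply/ccontP; exact: cg. Qed.

Lemma pos_coef f : Ck L 4 f -> (forall x, `[0, L]%classic x -> 0 < f x) ->
  [/\ bmeas D f, (forall x, D x -> 0 <= f x) &
   exists c C, [/\ 0 < c, 0 <= C, forall x, D x -> c <= f x & forall x, D x -> f x <= C]].
Proof.
move=> /Ck_ccont cf fpos; have bf := ccont_bmeas cf.
have DL x : D x -> x \in `[0, L] by rewrite /= !in_itv/= => /andP[/ltW-> /ltW->].
split => //; first by move=> x /DL h; apply/ltW/fpos.
have /ccontP wf := cf; have [x xI Hx] := EVT_min (ltW L0) wf.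
have [y yI Hy] := EVT_max (ltW L0) wf.
exists (f x), (f y); split.
- exact: fpos.
- exact/ltW/fpos.
- by move=> t /DL; exact: Hx.
- by move=> t /DL; exact: Hy.
Qed.

Lemma Lam_ok : [/\ bmeas D (bLam B), (forall x, D x -> 0 <= bLam B x) &
   exists c C, [/\ 0 < c, 0 <= C, forall x, D x -> c <= bLam B x & forall x, D x -> bLam B x <= C]].
Proof. by case: hB => _ _ H _ H'; exact: pos_coef. Qed.

Lemma mu_ok : [/\ bmeas D (bmu B), (forall x, D x -> 0 <= bmu B x) &
   exists c C, [/\ 0 < c, 0 <= C, forall x, D x -> c <= bmu B x & forall x, D x -> bmu B x <= C]].
Proof. by case: hB => _ H _ H' _; exact: pos_coef. Qed.

Lemma form_aE w1 w2 : form_a B w1 w2 =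
  wform L 2 (bLam B) w1 w2 + bk1 B * (Dx 1 w1 L * Dx 1 w2 L) + bk2 B * (w1 L * w2 L).
Proof. by rewrite /form_a RI_cc_oo !mulrA. Qed.

(** The mass form, with the two inertias of the tip of the beam. *)
Definition form_m w1 w2 := ipH B (hat B w1) (hat B w2).

Lemma form_mE w1 w2 : form_m w1 w2 =
  bJ B * (Dx 1 w1 L * Dx 1 w2 L) + bM B * (w1 L * w2 L) + wform L 0 (bmu B) w1 w2.
Proof. by rewrite /form_m /ipH /hat /= RI_cc_oo !mulrA. Qed.

Local Notation HT := (dom (Ht L 2)).

Lemma HT_lsub : lsub HT. Proof. exact: (Ht_lsub L0 (isT : (1 < 2)%N)). Qed.

Lemma Dx1_lin x : 0 <= x <= L -> lin_on HT (fun w => Dx 1 w x : R^o).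
Proof.
move=> xL c w1 w2 /Ht_dom d1 /Ht_dom d2; have [_ _ H] := Hk_lin L0 c d1 d2.
by rewrite H.
Qed.

Lemma eval_lin x : lin_on HT (fun w => w x : R^o).
Proof. by []. Qed.

Lemma wform_psdT j m : (j <= 2)%N -> bmeas D m -> (forall x, D x -> 0 <= m x) ->
  psd HT (wform L j m).
Proof. by move=> j2 bm m0; apply: psd_sub (@Ht_dom _ _ 2) _; exact: (wform_psd L0 j2 bm m0). Qed.

Lemma form_a_psd : psd HT (form_a B).
Proof.
have [bm m0 _] := Lam_ok; have [[_ _ _ k1 k2] _ _ _ _] := hB.
apply: (psd_ext _ HT_lsub (psdD (psdD (wform_psdT (leqnn 2) bm m0)
  (psdZ (ltW k1) (psd_rank1 (Dx1_lin L_itv)))) (psdZ (ltW k2) (psd_rank1 (@eval_lin L))))).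
by move=> x y _ _; rewrite form_aE.
Qed.

Lemma form_m_psd : psd HT form_m.
Proof.
have [bm m0 _] := mu_ok; have [[_ M0 J0 _ _] _ _ _ _] := hB.
apply: (psd_ext _ HT_lsub (psdD (psdD (psdZ (ltW J0) (psd_rank1 (Dx1_lin L_itv)))
  (psdZ (ltW M0) (psd_rank1 (@eval_lin L)))) (wform_psdT (leq0n 2) bm m0))).
by move=> x y _ _; rewrite form_mE.
Qed.

Local Notation na := (pnorm (form_a B)).
Local Notation nm := (pnorm form_m).

Lemma wform_upper j m C w : (j <= 2)%N -> bmeas D m -> (forall x, D x -> m x <= C) -> HT w ->
  wform L j m w w <= C * \int[leb]_(x in D) (Dx j w x ^+ 2).
Proof.
move=> j2 bm mC /Ht_dom dw; rewrite -RIZ//; last exact: L2_I1sq (Dx_L2 dw j2).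
apply: RI_le => //; first exact: (wform_I1 j2 bm dw dw).
  by apply: I1Z => //; exact: L2_I1sq (Dx_L2 dw j2).
by apply: aeW => x Dx'; rewrite -mulrA -expr2 ler_wpM2r ?sqr_ge0// mC.
Qed.

Lemma en_ge0 w : 0 <= en L w. Proof. exact: sqrtr_ge0. Qed.

Lemma na_lower : exists2 c, 0 <= c & forall w, HT w -> en L w <= c * na w.
Proof.
have [bm m0 [c [C [c0 _ cl _]]]] := Lam_ok; have [[_ _ _ k1 k2] _ _ _ _] := hB.
exists (Num.sqrt c^-1); first exact: sqrtr_ge0.
move=> w dw; rewrite -ler_sqr ?nnegrE ?mulr_ge0 ?sqrtr_ge0// exprMn.
have ci : 0 <= c^-1 by rewrite invr_ge0 ltW.
rewrite (sqr_sqrtr ci).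
rewrite (pnorm_sqr form_a_psd)// ler_pdivlMl// en_sqr.
have dw' := Ht_dom dw; have I2 := L2_I1sq (mitv _) (Dx_L2 dw' (leqnn 2)).
rewrite form_aE -RIZ// -[leLHS]addr0 -addrA; apply: lerD; last first.
  by rewrite -!expr2; apply: addr_ge0; apply: mulr_ge0; rewrite ?sqr_ge0// ltW.
apply: RI_le => //; [exact: I1Z|exact: (wform_I1 (leqnn 2) bm dw' dw')|].
by apply: aeW => x Dx'; rewrite -mulrA -expr2 ler_wpM2r ?sqr_ge0// cl.
Qed.

Lemma tr1_sq w : HT w -> Dx 1 w L * Dx 1 w L <= L * en L w ^+ 2.
Proof.
move=> dw; rewrite -expr2 -real_normK ?num_real//.
rewrite -[X in X * _](sqr_sqrtr (ltW L0)) -exprMn ler_sqr ?nnegrE ?mulr_ge0 ?sqrtr_ge0//.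
exact: (Dx1_bound dw L_itv).
Qed.

Lemma tr0_sq w x : HT w -> 0 <= x <= L -> w x ^+ 2 <= L ^+ 3 * en L w ^+ 2.
Proof.
move=> dw xL; rewrite -real_normK ?num_real//.
rewrite (_ : L ^+ 3 * _ = (L * (Num.sqrt L * en L w)) ^+ 2); last first.
  by rewrite !exprMn (sqr_sqrtr (ltW L0)); ring.
have r0 : 0 <= L * (Num.sqrt L * en L w).
  by apply: mulr_ge0; [exact: ltW L0|rewrite mulr_ge0 ?sqrtr_ge0].
rewrite ler_sqr ?nnegrE//.
exact: (Dx0_bound dw xL).
Qed.

Lemma na_upper : exists2 c, 0 <= c & forall w, HT w -> na w <= c * en L w.
Proof.
have [bm m0 [_ [C [_ C0 _ CU]]]] := Lam_ok; have [[_ _ _ k1 k2] _ _ _ _] := hB.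
exists (Num.sqrt (C + bk1 B * L + bk2 B * L ^+ 3)); first exact: sqrtr_ge0.
have K0 : 0 <= C + bk1 B * L + bk2 B * L ^+ 3.
  have l0 := ltW L0; do ![apply: addr_ge0]; do ?[apply: mulr_ge0]; rewrite ?exprn_ge0//; exact: ltW.
move=> w dw; rewrite -ler_sqr ?nnegrE ?mulr_ge0 ?sqrtr_ge0// exprMn (sqr_sqrtr K0).
rewrite (pnorm_sqr form_a_psd)// form_aE.
have h1 := wform_upper (leqnn 2) bm CU dw; rewrite -en_sqr in h1.
have h2 := ler_wpM2l (ltW k1) (tr1_sq dw).
have h3 := ler_wpM2l (ltW k2) (tr0_sq dw L_itv); rewrite expr2 in h3.
lra.
Qed.

Lemma nm_upper : exists2 c, 0 <= c & forall w, HT w -> nm w <= c * en L w.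
Proof.
have [bm m0 [_ [C [_ C0 _ CU]]]] := mu_ok; have [[_ M0 J0 _ _] _ _ _ _] := hB.
exists (Num.sqrt (bJ B * L + bM B * L ^+ 3 + C * (L * L ^+ 3))); first exact: sqrtr_ge0.
have K0 : 0 <= bJ B * L + bM B * L ^+ 3 + C * (L * L ^+ 3).
  have l0 := ltW L0; do ![apply: addr_ge0]; do ?[apply: mulr_ge0]; rewrite ?exprn_ge0//; exact: ltW.
move=> w dw; rewrite -ler_sqr ?nnegrE ?mulr_ge0 ?sqrtr_ge0// exprMn (sqr_sqrtr K0).
rewrite (pnorm_sqr form_m_psd)// form_mE.
have h1 := wform_upper (leq0n 2) bm CU dw.
have h2 := ler_wpM2l (ltW J0) (tr1_sq dw).
have h3 := ler_wpM2l (ltW M0) (tr0_sq dw L_itv); rewrite expr2 in h3.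
have h4 : \int[leb]_(x in D) (Dx 0 w x ^+ 2) <= L * (L ^+ 3 * en L w ^+ 2).
  have -> : L * (L ^+ 3 * en L w ^+ 2) = \int[leb]_(x in D) (L ^+ 3 * en L w ^+ 2).
    by rewrite Rintegral_cst// leb_itvoo ?(ltW L0)// subr0 mulrC.
  apply: RI_le => //; first exact: L2_I1sq (Dx_L2 (Ht_dom dw) (leq0n 2)).
    by apply: L2_I1oo; apply: L2_bmeas => //; exact: bmeas_cst.
  apply: aeW => x /=; rewrite in_itv/= => /andP[x0 xL]; apply: (tr0_sq dw).
  by rewrite !ltW.
have h5 := ler_wpM2l C0 h4.
lra.
Qed.

Lemma nm_tr1 w : HT w -> Num.sqrt (bJ B) * `|Dx 1 w L| <= nm w.
Proof.
move=> dw; have [bm m0 _] := mu_ok; have [[_ M0 J0 _ _] _ _ _ _] := hB.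
rewrite -ler_sqr ?nnegrE ?mulr_ge0 ?sqrtr_ge0// exprMn (sqr_sqrtr (ltW J0)).
rewrite (pnorm_sqr form_m_psd)// form_mE real_normK ?num_real// -addrA -!expr2 lerDl addr_ge0//.
  by apply: mulr_ge0; [exact: ltW|exact: sqr_ge0].
exact: (psd_ge0 (wform_psdT (leq0n 2) bm m0)).
Qed.

Lemma nm_tr0 w : HT w -> Num.sqrt (bM B) * `|w L| <= nm w.
Proof.
move=> dw; have [bm m0 _] := mu_ok; have [[_ M0 J0 _ _] _ _ _ _] := hB.
rewrite -ler_sqr ?nnegrE ?mulr_ge0 ?sqrtr_ge0// exprMn (sqr_sqrtr (ltW M0)).
rewrite (pnorm_sqr form_m_psd)// form_mE real_normK ?num_real// -!expr2 addrAC lerDr addr_ge0//.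
  by apply: mulr_ge0; [exact: ltW|exact: sqr_ge0].
exact: (psd_ge0 (wform_psdT (leq0n 2) bm m0)).
Qed.

Lemma na_en0 w : HT w -> na w = 0 -> forall x, 0 <= x <= L -> w x = 0.
Proof.
move=> dw n0 x xL; have [c _ H] := na_lower.
have e0 : en L w = 0 by apply/eqP; rewrite eq_le en_ge0 andbT (le_trans (H _ dw))// n0 mulr0.
by apply/eqP; rewrite -normr_le0 (le_trans (Dx0_bound dw xL))// e0 !mulr0.
Qed.

(** Every functional used below is bounded by the energy, hence on each space. *)
Lemma en_dual k (l : (R -> R^o) -> R^o) K : (1 < k)%N -> lin_on (dom (Ht L k)) l ->
  (forall w, dom (Ht L k) w -> `|l w| <= K * en L w) -> dual (Ht L k) l.
Proof.
move=> k1 ll lK; split; first by move=> c x y dx dy; exact: ll.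
exists `|K| => w dw; rewrite (le_trans (lK w dw))//.
apply: (@le_trans _ _ (`|K| * en L w)).
  by apply: ler_wpM2r; [exact: en_ge0|exact: ler_norm].
by apply: ler_wpM2l => //; exact: (en_nrm L0 k1 dw).
Qed.

End beam_forms.

(** * Hermite elements *)

Section Hermite_space.
Context {R : realType}.
Local Notation leb := (@lebesgue_measure R).
Local Notation rT := (measurableTypeR R).
Variable B : beam R.
Hypothesis hB : beam_ok B.
Local Notation L := (bL B).
Local Notation L0 := (bL_gt0 hB).
Local Notation Dx := (Dx L).
Local Notation D := (`]0, L[%classic : set rT).
Variable P : nat.
Hypothesis P0 : (0 < P)%N.
Implicit Types (w : R -> R^o) (p : {poly R}).

Definition node (m : nat) : R := m%:R * (L / P%:R).

Lemma mesh_gt0 : 0 < L / P%:R.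
Proof. by apply: divr_gt0; [exact: L0|rewrite ltr0n]. Qed.

Lemma node0 : node 0 = 0. Proof. by rewrite /node mul0r. Qed.

Lemma nodeP : node P = L.
Proof. by rewrite /node mulrCA divff ?mulr1// pnatr_eq0 -lt0n. Qed.

Lemma node_le m n : (m <= n)%N -> node m <= node n.
Proof. by move=> mn; rewrite /node ler_pM2r ?mesh_gt0// ler_nat. Qed.

Lemma nodeS m : node m.+1 = node m + L / P%:R.
Proof. by rewrite /node -natr1 mulrDl mul1r. Qed.

Lemma node_lt m : node m < node m.+1.
Proof. by rewrite nodeS ltrDl mesh_gt0. Qed.

Lemma node_ge0 m : 0 <= node m. Proof. by rewrite -node0; exact: node_le. Qed.

Lemma node_leL m : (m <= P)%N -> node m <= L. Proof. by move=> mP; rewrite -nodeP; exact: node_le. Qed.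

Lemma node_sub m : (m < P)%N -> `]node m, node m.+1[%classic `<=` `]0, L[%classic.
Proof. by move=> mP; apply: subset_oo; [exact: node_ge0|exact: node_leL]. Qed.

Lemma RI_elems (f : rT -> R) : I1 D f ->
  \int[leb]_(x in D) f x = \sum_(m < P) \int[leb]_(x in `]node m, node m.+1[%classic) f x.
Proof.
move=> If; have H n : (n <= P)%N -> \int[leb]_(x in `]0, node n[%classic) f x =
    \sum_(m < n) \int[leb]_(x in `]node m, node m.+1[%classic) f x.
  elim: n => [_|n IH nP]; first by rewrite big_ord0 node0 RI_oo_ge.
  rewrite big_ord_recr /= -IH ?(ltnW nP)// (@RI_split _ 0 (node n))//.
    by rewrite node_ge0 ltW ?node_lt.
  by apply: I1_sub If => //; exact: node_leL.
by rewrite -H// nodeP.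
Qed.

Lemma horner_ccont a b p : ccont a b (horner p).
Proof.
apply: continuous_ccont => x.
by case: (is_derive_poly p x) => /derivable1_diffP/differentiable_continuous.
Qed.

Lemma test_fun_smooth a b (phi : R -> R) : test_fun a b phi ->
  [/\ forall s t, ccont s t phi, forall s t, ccont s t (derive1n 1 phi),
      forall x, is_derive x (1 : R) phi (derive1n 1 phi x), phi a = 0 & phi b = 0].
Proof.
move=> [sm [c [d [ac db z]]]].
have cc n : continuous (derive1n n phi).
  by move=> x; have /derivable1_diffP/differentiable_continuous := sm n x.
split.
- by move=> s t; apply: continuous_ccont; exact: (cc 0%N).
- by move=> s t; apply: continuous_ccont; exact: (cc 1%N).
- by move=> x; split; [exact: (sm 0%N x)|rewrite derive1n1 derive1E].
- by apply: z => /=; rewrite in_itv/= => /andP[h _]; have := lt_le_trans ac h; rewrite ltxx.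
- by apply: z => /=; rewrite in_itv/= => /andP[_ h]; have := le_lt_trans h db; rewrite ltxx.
Qed.

Lemma ccontM a b (f g : R -> R) : ccont a b f -> ccont a b g -> ccont a b (fun x => f x * g x).
Proof.
move=> /ccontP/subspace_continuousP cf /ccontP/subspace_continuousP cg.
apply/ccontP/subspace_continuousP => x xab.
by apply: cvgM; [exact: cf|exact: cg].
Qed.

Lemma ibp s t (f f' : R -> R) phi a b : test_fun a b phi -> s <= t ->
  ccont s t f -> ccont s t f' -> (forall x, s < x < t -> is_derive x (1 : R) f (f' x)) ->
  \int[leb]_(x in `]s, t[%classic) (f x * derive1n 1 phi x + f' x * phi x) =
  f t * phi t - f s * phi s.
Proof.
move=> /test_fun_smooth[cp cp' dp _ _] st cf cf' df.
apply: (@RI_FTC2 _ _ _ (fun x => f x * phi x)) => //.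
- by apply: ccontD; apply: ccontM.
- exact: ccontM.
- move=> x xst; have := is_deriveM (df x xst) (dp x).
  by move=> h; apply: (is_derive_eq h); rewrite /GRing.scale/= [phi x * _]mulrC.
Qed.

Lemma C1_sweak a b (f f' : R -> R) : a <= b -> ccont a b f -> ccont a b f' ->
  (forall x, a < x < b -> is_derive x (1 : R) f (f' x)) -> sweak a b f f'.
Proof.
move=> ab cf cf' df; have Lf := ccont_L2 cf; have Lf' := ccont_L2 cf'; split => //.
move=> phi tphi; have h := ibp tphi ab cf cf' df.
have [_ _ _ pa pb] := test_fun_smooth tphi; rewrite pa pb !mulr0 subrr in h.
have T1 := test_fun_L2 1 tphi; have T0 := test_fun_L2 0 tphi.
rewrite RID// in h; try exact: L2_I1M.
by apply/eqP; rewrite -addr_eq0 h.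
Qed.

Lemma Ck1_elim w : Ck L 1 w -> exists w', [/\ ccont 0 L w, ccont 0 L w' &
  forall x, 0 < x < L -> is_derive x (1 : R) w (w' x)].
Proof.
move=> [g [<- cg dg]]; exists (g 1%N); split; [exact/ccontP/cg|exact/ccontP/cg|].
by move=> x xL; apply: (dg 0%N) => //=; rewrite in_itv.
Qed.

Lemma Ck1_intro w w' : ccont 0 L w -> ccont 0 L w' ->
  (forall x, 0 < x < L -> is_derive x (1 : R) w (w' x)) -> Ck L 1 w.
Proof.
move=> cw cw' dw; exists (fun j => if j is 0%N then w else w'); split => //.
  by case=> [_|j _]; apply/ccontP.
by case=> // _ x /=; rewrite in_itv; exact: dw.
Qed.

(** The selected weak derivative is the classical one, by uniqueness and continuity. *)
Lemma C1_Dx1 w w' : ccont 0 L w -> ccont 0 L w' ->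
  (forall x, 0 < x < L -> is_derive x (1 : R) w (w' x)) ->
  forall x, 0 <= x <= L -> Dx 1 w x = w' x.
Proof.
move=> cw cw' dw; have sw := C1_sweak (ltW L0) cw cw' dw.
have ww : @weak_deriv R (@scalars R) 0 L w w' by exact/weak_deriv_scalarP.
have [h1 h2] := @wdiff_spec R (@scalars R) 0 L w (ex_intro _ w' ww).
have c1 : ccont 0 L (Dx 1 w).
  by apply/cont_scalarP; apply: h2; exists w'; split => //; exact/cont_scalarP.
apply: (ccont_aeq L0 c1 cw').
exact: (sweak_uniq ((weak_deriv_scalarP _ _ _ _).1 h1) sw (aeq_refl _ _)).
Qed.

Lemma derive_local (f g : R -> R) s t x df dg : s < x < t ->
  (forall y, s < y < t -> f y = g y) -> is_derive x (1 : R) f df -> is_derive x (1 : R) g dg ->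
  df = dg.
Proof.
move=> /andP[sx xt] fg [_ <-] [_ <-]; apply: near_eq_derive.
near=> y; apply: fg; apply/andP; split; near: y; [exact: lt_nbhsr|exact: lt_nbhsl].
Unshelve. all: by end_near. Qed.

Lemma bmeasD (E : set rT) f g : @measurable _ rT E -> bmeas E f -> bmeas E g ->
  bmeas E (fun x => f x + g x).
Proof.
move=> mE [mf [K HK]] [mg [K' HK']]; split; first exact: measurable_funD.
by exists (K + K') => x Ex; rewrite (le_trans (ler_normD _ _))// lerD ?HK ?HK'.
Qed.

Lemma elem_sum (F : nat -> R -> R) m x : (m < P)%N -> node m < x < node m.+1 ->
  \sum_(i < P) (\1_(`[node i, node i.+1[%classic) x : R) * F i x = F m x.
Proof.
move=> mP /andP[mx xm]; rewrite (bigD1 (Ordinal mP))//= big1 ?addr0 => [|i im].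
  by rewrite indicE mem_set ?mul1r//= in_itv/= (ltW mx).
rewrite indicE memNset ?mul0r//= in_itv/= => /andP[ix xi].
have : (m < i.+1)%N.
  by rewrite ltnNge; apply/negP => /node_le h; have := lt_le_trans xi h; rewrite ltNge (ltW mx).
rewrite ltnS leq_eqVlt => /orP[/eqP e|mi].
  by move/eqP : im; apply; apply: val_inj.
by have := node_le mi => h; have := lt_le_trans xm h; rewrite ltNge ix.
Qed.

(** Integration by parts on each mesh interval: the terms at interior nodes cancel since
    the first derivative is continuous, those at both ends since test functions vanish there. *)
Lemma Wh_weak w : Wh B P w -> exists w1 w2, [/\ ccont 0 L w, ccont 0 L w1, sweak 0 L w w1,
  sweak 0 L w1 w2 & forall x, 0 <= x <= L -> Dx 1 w x = w1 x].
Proof.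
move=> [/Ck1_elim[w1 [cw cw1 dw]] pw _ _].
have [p Hp] : exists p : nat -> {poly R}, forall m, (m < P)%N -> forall x,
    node m <= x <= node m.+1 -> w x = (p m).[x].
  have : forall m, exists p : {poly R}, (m < P)%N -> forall x,
      node m <= x <= node m.+1 -> w x = p.[x].
    move=> m; have [mP|mP] := boolP (m < P)%N; last by exists 0.
    have [p [_ Hp]] := pw m mP; exists p => _ x xm; apply: Hp => /=.
    by rewrite in_itv.
  by move/choice => [p Hp]; exists p.
have Hp1 m : (m < P)%N -> forall x, node m <= x <= node m.+1 -> w1 x = (p m)^`().[x].
  move=> mP; apply: (ccont_aeq (node_lt m)).
  - by apply: ccontS cw1; [exact: node_ge0|exact: node_leL].
  - exact: horner_ccont.
  apply: aeq_eq => x /=; rewrite in_itv/= => xm.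
  have xL : 0 < x < L by have := @node_sub m mP x; rewrite /= !in_itv/=; exact.
  apply: (derive_local (f := w) (g := horner (p m)) xm _ (dw x xL)) => //.
  by move=> y /andP[h1 h2]; apply: Hp => //; rewrite !ltW.
pose F m := horner (p m)^`()^`().
pose w2 x := \sum_(i < P) (\1_(`[node i, node i.+1[%classic) x : R) * F i x.
have bw2 : bmeas D w2.
  rewrite /w2; elim: (P) => [|n IH].
    have -> : (fun x : R => \sum_(i < 0) (\1_(`[node i, node i.+1[%classic) x : R) * F i x)
       = (fun=> 0) by apply/funext => x; rewrite big_ord0.
    exact: bmeas_cst.
  have -> : (fun x : R => \sum_(i < n.+1) (\1_(`[node i, node i.+1[%classic) x : R) * F i x)
     = (fun x => (\sum_(i < n) (\1_(`[node i, node i.+1[%classic) x : R) * F i x) +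
         (\1_(`[node n, node n.+1[%classic) x : R) * F n x).
    by apply/funext => x; rewrite big_ord_recr.
  apply: bmeasD => //.
  have [mF [K HK]] := ccont_bmeas (@horner_ccont 0 L ((p n)^`()^`())).
  split; first by apply: measurable_funM => //; exact: measurable_indic (mitv _).
  exists K => x Dx'; rewrite normrM; apply: le_trans (HK x Dx').
  rewrite indicE; case: (_ \in _) => /=; first by rewrite normr1 mul1r.
  by rewrite normr0 mul0r.
have Lw2 : L2 D w2 by exact: L2_bmeas.
have Lw1 := ccont_L2 cw1.
exists w1, w2; split => //; [exact: C1_sweak (ltW L0) cw cw1 dw| |exact: C1_Dx1].
split => // phi tphi; have T1 := test_fun_L2 1 tphi; have T0 := test_fun_L2 0 tphi.
have [_ _ _ pa pb] := test_fun_smooth tphi.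
apply/eqP; rewrite -addr_eq0 -RID//; try exact: L2_I1M.
rewrite RI_elems; last by apply: I1D => //; exact: L2_I1M.
have E (m : 'I_P) : \int[leb]_(x in `]node m, node m.+1[%classic)
    (w1 x * derive1n 1 phi x + w2 x * phi x) =
    w1 (node m.+1) * phi (node m.+1) - w1 (node m) * phi (node m).
  have lm := ltW (node_lt m).
  rewrite (Hp1 m)// ?lexx ?andbT//.
  rewrite [in X in _ = _ - X](Hp1 m)// ?lexx//=.
  have dp x : node m < x < node m.+1 ->
      is_derive x (1 : R) (horner (p m)^`()) ((p m)^`()^`()).[x].
    by move=> _; exact: is_derive_poly.
  rewrite -(ibp tphi lm (@horner_ccont _ _ _) (@horner_ccont _ _ _) dp).
  apply: eq_Rintegral => x; rewrite inE /= in_itv/= => xm; rewrite /w2 (elem_sum F _ xm)//.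
  by rewrite (Hp1 m)//; case/andP: xm => ? ?; rewrite !ltW.
rewrite (eq_bigr (fun m : 'I_P => w1 (node m.+1) * phi (node m.+1) - w1 (node m) * phi (node m))) //.
rewrite -(big_mkord xpredT (fun m => w1 (node m.+1) * phi (node m.+1) - w1 (node m) * phi (node m))).
by rewrite telescope_sumr// node0 nodeP pa pb !mulr0 subrr.
Qed.

Lemma Wh_Ht2 w : Wh B P w -> dom (Ht L 2) w.
Proof.
move=> hw; have [w1 [w2 [c0 c1 s0 s1 _]]] := Wh_weak hw; have [_ _ w0 w10] := hw.
split => //.
pose g (j : nat) := match j with 0 => w | 1 => w1 | _ => w2 end%N.
have [//||h _] := @sob_char R 0 L 2 g L0.
- by case=> [|[|]].
- by case: s1.
exact: h.
Qed.

(** Increments over subintervals are those of the polynomial, and they determine the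
    next derivative almost everywhere; this is applied twice. *)
Lemma Dx2_local w p s t : dom (Hk L 2) w -> 0 <= s -> s < t -> t <= L ->
  (forall x, s < x < t -> w x = p.[x]) ->
  aeq `]s, t[%classic (Dx 2 w) (horner p^`()^`()).
Proof.
move=> dw s0 st tL wp.
have step j q : (j < 2)%N -> aeq `]s, t[%classic (Dx j w) (horner q) ->
    aeq `]s, t[%classic (Dx j.+1 w) (horner q^`()).
  move=> j2 wq; have cj := ccontS s0 tL (Dx_ccont dw j2).
  have eqj := ccont_aeq st cj (@horner_ccont s t q) wq.
  have Lj : L2 `]s, t[%classic (Dx j.+1 w) by apply: L2_sub s0 tL (Dx_L2 dw j2).
  have Lq := ccont_L2 (@horner_ccont s t q^`()).
  have := ae0_of_int (L2B (mitv _) Lj Lq).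
  have z s' t' : s <= s' -> s' <= t' -> t' <= t ->
      \int[leb]_(x in `]s', t'[%classic) (Dx j.+1 w x - q^`().[x]) = 0.
    move=> ss st' tt; rewrite RIB//; last 2 first.
    - by apply: L2_I1oo; exact: L2_sub Lj.
    - by apply: L2_I1oo; exact: L2_sub Lq.
    have h1 := le_trans s0 ss; have h2 := le_trans tt tL.
    have h3 := le_trans st' tt; have h4 := le_trans ss st'.
    rewrite -(Dx_ftc dw j2 h1 st' h2) !eqj ?ss ?tt ?h3 ?h4//.
    have -> // : \int[leb]_(x in `]s', t'[%classic) q^`().[x] = q.[t'] - q.[s'].
      by apply: (@RI_FTC2 _ _ _ (horner q)) => //; exact: horner_ccont.
    by rewrite subrr.
  move=> /(_ z); apply: aeS => x h Dx'; apply/eqP; rewrite -subr_eq0; apply/eqP; exact: h.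
have w0 : aeq `]s, t[%classic (Dx 0 w) (horner p).
  by apply: aeq_eq => x /=; rewrite in_itv/=; exact: wp.
exact: (step 1%N _ isT (step 0%N _ isT w0)).
Qed.

Lemma Wh_lsub : lsub [set w : R -> R^o | Wh B P w].
Proof.
split.
  split.
  - apply: (@Ck1_intro _ (fun=> 0)); try by move=> x _ e e0; exists 1 => // y _ _; rewrite subrr normr0 ltW.
  - by move=> m mP; exists 0; rewrite size_poly0; split => // x _; rewrite horner0.
  - by [].
  - have [_ _ h] := Hk0 L0 2; apply: h => //; by rewrite lexx ltW ?L0.
move=> c u v hu hv; have [du _ _] := Wh_Ht2 hu; have [dv _ _] := Wh_Ht2 hv.
have [_ _ dl] := Hk_lin L0 c du dv.
move: hu hv => [/Ck1_elim[u' [cu cu' du']] pu u0 u1] [/Ck1_elim[v' [cv cv' dv']] pv v0 v1].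
split.
- apply: (@Ck1_intro _ (fun x => c * u' x + v' x)).
  + by apply: ccontD => //; exact: ccontZ.
  + by apply: ccontD => //; exact: ccontZ.
  + move=> x xL; have := is_deriveD (is_deriveZ c (du' x xL)) (dv' x xL).
    exact.
- move=> m mP; have [p [sp hp]] := pu m mP; have [q [sq hq]] := pv m mP.
  exists (c *: p + q); split.
    rewrite (leq_trans (size_polyD _ _))// geq_max sq andbT.
    by rewrite (leq_trans (size_scale_leq _ _)).
  by move=> x xm; rewrite hornerD hornerZ -hp// -hq.
- by change (c * u 0 + v 0 = 0); rewrite u0 v0 mulr0 addr0.
- by rewrite dl ?u1 ?v1 ?mulr0 ?addr0// lexx ltW ?L0.
Qed.

(** Truncated powers: their second derivatives span the piecewise affine functions. *)
Definition trunc (c : R) (k : nat) (x : R) : R := Num.max 0 (x - c) ^+ k.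

Lemma trunc_le c k x : (0 < k)%N -> x <= c -> trunc c k x = 0.
Proof. by move=> k0 xc; rewrite /trunc max_l ?subr_le0// expr0n -leqn0 leqNgt k0. Qed.

Lemma trunc_ge c k x : c <= x -> trunc c k x = (x - c) ^+ k.
Proof. by move=> xc; rewrite /trunc max_r ?subr_ge0. Qed.

Lemma is_derive_trunc2 c x : is_derive x (1 : R) (trunc c 2) (2 * trunc c 1 x).
Proof.
have shift (f : R -> R) (l : R) : is_derive (x - c) (1 : R) f l ->
    is_derive x (1 : R) (fun t => f (t - c)) l.
  move=> df; have d : is_derive x (1 : R) (fun t : R => t - c) 1.
    by have := is_deriveB (is_derive_id x (1 : R)) (is_derive_cst c x (1 : R)); rewrite subr0.
  by have := @is_derive1_comp R f (fun t => t - c) x _ _ df d; rewrite mulr1.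
apply: (shift (fun y => Num.max 0 y ^+ 2)); rewrite /trunc expr1.
set y := x - c; have [y0|y0|<-] := ltgtP 0 y.
- apply: (@near_eq_is_derive R R R (fun z : R => z ^+ 2)).
    near=> z; rewrite /= max_r//; apply: ltW; near: z; exact: lt_nbhsr.
  have -> : (fun z : R => z ^+ 2) = (id * id : R -> R) by apply/funext => z; rewrite expr2.
  have h := @is_deriveM R R id id y 1 1 1 (is_derive_id y (1 : R)) (is_derive_id y (1 : R)).
  by apply: (is_derive_eq h); rewrite /GRing.scale/= !mulr1 -mulr2n mulr_natl.
- rewrite mulr0; apply: (@near_eq_is_derive R R R (cst 0)).
  near=> z; rewrite /= max_l ?expr0n//; apply: ltW; near: z; exact: lt_nbhsl.
- rewrite mulr0; apply: (@is_derive_quadratic R _ 1) => z.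
  rewrite mul1r ger0_norm ?sqr_ge0//; have [z0|z0] := leP 0 z; first by [].
  by rewrite expr0n sqr_ge0.
Unshelve. all: by end_near. Qed.

Lemma trunc1_continuous c : continuous (trunc c 1 : R -> R).
Proof.
move=> x; apply/cvgrPdist_le => e e0; near=> y; rewrite /trunc !expr1.
apply: (@le_trans _ _ `|x - y|).
  have := ler_norm (x - y); have := ler_norm (- (x - y)); rewrite normrN => n1 n2.
  by rewrite ler_norml; have [h1|h1] := leP 0 (x - c); have [h2|h2] := leP 0 (y - c);
    apply/andP; split; lra.
by near: y; apply/nbhs_ballP; exists e => //= y; rewrite /ball /= => /ltW.
Unshelve. all: by end_near. Qed.

(** The cubic truncated power, written as a product so that it can be differentiated. *)
Lemma trunc3E c x : trunc c 3 x = trunc c 2 x * (x - c).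
Proof.
rewrite /trunc; have [h|h] := leP 0 (x - c); first by rewrite exprSr.
by rewrite !expr0n mul0r.
Qed.

Lemma is_derive_trunc3 c x : is_derive x (1 : R) (trunc c 3) (3 * trunc c 2 x).
Proof.
have -> : trunc c 3 = (trunc c 2 * (id - cst c) : R -> R).
  by apply/funext => y; exact: trunc3E.
have d2 := is_derive_trunc2 c x.
have d1 := is_deriveB (is_derive_id x (1 : R)) (is_derive_cst c x (1 : R)).
apply: (is_derive_eq (is_deriveM d2 d1)).
rewrite /GRing.scale/= subr0 mulr1 /trunc.
rewrite -[(id - cst c) x]/(x - c); have [h|h] := leP 0 (x - c); first by ring.
by rewrite !expr0n /= ; ring.
Qed.

Lemma trunc_ccont c k a b : ccont a b (trunc c k : R -> R).
Proof.
have h : ccont a b (trunc c 1) by apply: continuous_ccont; exact: trunc1_continuous.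
elim: k => [|k IH].
  by move=> x _ e e0; exists 1 => // y _ _; rewrite /trunc !expr0 subrr normr0 ltW.
apply: (@ccont_eq _ _ _ (fun x => trunc c 1 x * trunc c k x)); last exact: ccontM.
by move=> x _; rewrite /trunc -exprD add1n.
Qed.

Lemma trunc_Wh j k : (k == 2) || (k == 3) -> (j < P)%N -> Wh B P (trunc (node j) k : R -> R^o).
Proof.
move=> k23 jP.
have k0 : (0 < k)%N by case/orP: k23 => /eqP ->.
have k4 : (k < 4)%N by case/orP: k23 => /eqP ->.
have k1 : (0 < k.-1)%N by case/orP: k23 => /eqP ->.
have d : forall x, is_derive x (1 : R) (trunc (node j) k) (k%:R * trunc (node j) k.-1 x).
  by case/orP: k23 => /eqP -> x; [exact: is_derive_trunc2|exact: is_derive_trunc3].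
have c1 : ccont 0 L (fun x => k%:R * trunc (node j) k.-1 x).
  by apply: ccontZ; exact: trunc_ccont.
split.
- by apply: (Ck1_intro (@trunc_ccont _ _ _ _) c1) => x _; exact: d.
- move=> m mP; have [mj|jm] := ltnP m j.
    exists 0; rewrite size_poly0; split => // x /=; rewrite in_itv/= => /andP[_ xm].
    by rewrite horner0 trunc_le// (le_trans xm)// -/(node m.+1) node_le.
  exists (('X - (node j)%:P) ^+ k); split; first by rewrite size_exp_XsubC.
  move=> x /=; rewrite in_itv/= => /andP[mx _].
  rewrite !hornerE trunc_ge// (le_trans _ mx)// -/(node m) node_le//.
- by rewrite trunc_le// node_ge0.
- rewrite (C1_Dx1 (@trunc_ccont _ _ _ _) c1 (fun x _ => d x)) ?lexx ?(ltW L0)//.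
  by rewrite trunc_le ?mulr0// node_ge0.
Qed.

(** From left to right: a quadratic and a cubic truncated power at the current node
    correct the second derivative to its right and leave everything to its left unchanged. *)
Lemma Wh_interp (al be : nat -> R) n : (n <= P)%N -> exists2 w, Wh B P w &
  forall m, (m < n)%N -> aeq `]node m, node m.+1[%classic (Dx 2 w)
    (fun x => al m + be m * (x - node m)).
Proof.
elim: n => [_|n IH nP].
  by exists 0 => //; have [] := Wh_lsub.
have [w hw Hw] := IH (ltnW nP).
have [_ pw _ _] := hw; have [p [sp hp]] := pw n nP.
pose q := p^`()^`(); pose a := al n - q.[node n]; pose b := be n - q^`().[node n].
pose T2 := trunc (node n) 2 : R -> R^o; pose T3 := trunc (node n) 3 : R -> R^o.
have hT2 : Wh B P T2 by exact: trunc_Wh.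
have hT3 : Wh B P T3 by exact: trunc_Wh.
pose v := (b / 6) *: T3 + ((a / 2) *: T2 + w).
have hv1 : Wh B P ((a / 2) *: T2 + w) by have [_] := Wh_lsub; apply.
have hv : Wh B P v by have [_] := Wh_lsub; apply.
have dv : dom (Hk L 2) v by have [] := Wh_Ht2 hv.
exists v => // m; rewrite ltnS leq_eqVlt => /orP[/eqP ->|mn].
  have E x : node n < x < node n.+1 ->
      v x = ((b / 6) *: ('X - (node n)%:P) ^+ 3 + ((a / 2) *: ('X - (node n)%:P) ^+ 2 + p)).[x].
    move=> /andP[x1 x2].
    have wx : w x = p.[x].
      by apply: hp; rewrite /= in_itv/= -/(node n) -/(node n.+1) (ltW x1) (ltW x2).
    rewrite !(hornerXsubC, horner_exp, hornerZ, hornerD) -wx.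
    rewrite -[v x]/(b / 6 * trunc (node n) 3 x + (a / 2 * trunc (node n) 2 x + w x)).
    by rewrite !trunc_ge ?(ltW x1).
  apply: aeq_trans (Dx2_local dv (node_ge0 n) (node_lt n) (node_leL nP) E) _.
  apply: aeq_eq => x _.
  have qE : q = (q^`().[node n])%:P * ('X - (node n)%:P) + (q.[node n])%:P.
    have sq : (size q <= 2)%N.
      rewrite (leq_trans (size_poly _ _))//.
      have : (size p^`() <= 3)%N by rewrite (leq_trans (size_poly _ _))//; case: (size p) sp.
      by case: (size _).
    have -> : q = (q`_1)%:P * 'X + (q`_0)%:P.
      apply/polyP => i; rewrite coefD coefMX !coefC; case: i => [|[|i]] /=.
      - by rewrite add0r.
      - by rewrite addr0.
      - by rewrite addr0 nth_default// (leq_trans sq).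
    set c1 := q`_1; set c0 := q`_0.
    rewrite !poly.derivE !(hornerD, hornerM, hornerC, hornerX) polyCD polyCM; ring.
  rewrite !poly.derivE -/q qE !(mul0r, mul1r, mulr1, mulr0, add0r, addr0) -polyC1.
  rewrite !(hornerXsubC, hornerC, hornerZ, hornerM, hornerD) /a /b; by field.
have mP : (m < P)%N by exact: ltn_trans mn nP.
apply: aeq_trans (Hw m mn); have [_ pm _ _] := hw; have [pp [_ hpp]] := pm m mP.
have dw : dom (Hk L 2) w by have [] := Wh_Ht2 hw.
have E u : (forall x, node m < x < node m.+1 -> u x = pp.[x]) -> dom (Hk L 2) u ->
    aeq `]node m, node m.+1[%classic (Dx 2 u) (horner pp^`()^`()).
  by move=> up du; exact: Dx2_local du (node_ge0 m) (node_lt m) (node_leL mP) up.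
have wp x : node m < x < node m.+1 -> w x = pp.[x].
  by move=> /andP[x1 x2]; apply: hpp; rewrite /= in_itv/= !ltW.
apply: aeq_trans (aeq_sym (E w wp dw)); apply: E => // x xm; rewrite -wp//.
rewrite -[v x]/(b / 6 * trunc (node n) 3 x + (a / 2 * trunc (node n) 2 x + w x)).
have xn : x <= node n by case/andP: xm => _ /ltW /le_trans; apply; exact: node_le.
by rewrite !trunc_le// !mulr0 !add0r.
Qed.

(** The second derivative of [w] is, on each mesh interval, the Taylor expansion of [v_xx]
    at the left node. Its remainder is a double integral of [v_xxxx], of order [h ^ 2] in L^2. *)
Lemma Wh_approx (v : R -> R^o) : dom (Ht L 4) v -> exists2 w, Wh B P w &
  en L (v - w) <= (L / P%:R) ^+ 2 * Num.sqrt (\int[leb]_(x in D) (Dx 4 v x ^+ 2)).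
Proof.
move=> hv; have dv := Ht_dom hv.
have [w hw Hw] := Wh_interp (fun m => Dx 2 v (node m)) (fun m => Dx 3 v (node m)) (leqnn P).
exists w => //; set h := L / P%:R; have h0 : 0 < h by exact: mesh_gt0.
have hv2 : dom (Ht L 2) v.
  by case: (hv) => _ v0 v1; split => //; exact: (Hk_dom_le (isT : (2 <= 4)%N) dv).
have dw := Wh_Ht2 hw.
have [_ /(_ 2%N isT) e2 _] := Hk_sub L0 (Ht_dom hv2) (Ht_dom dw).
have L4 : L2 D (Dx 4 v) by exact: (Dx_L2 dv (leqnn 4)).
have N4 : 0 <= \int[leb]_(x in D) (Dx 4 v x ^+ 2).
  by apply: RI_ge0; apply: aeW => x _; rewrite sqr_ge0.
rewrite -ler_sqr ?nnegrE ?sqrtr_ge0 ?mulr_ge0 ?sqr_ge0 ?sqrtr_ge0//.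
rewrite en_sqr exprMn (sqr_sqrtr N4).
have Lvw : L2 D (fun x => Dx 2 v x - Dx 2 w x).
  exact: (L2B (mitv _) (Dx_L2 dv (isT : (2 <= 4)%N)) (Dx_L2 (Ht_dom dw) (leqnn 2))).
apply: (@le_trans _ _ (\int[leb]_(x in D) ((Dx 2 v x - Dx 2 w x) ^+ 2))).
  rewrite le_eqVlt; apply/orP; left; apply/eqP.
  exact: (RI_aeq (@aeq_comp R D _ _ (fun (_ : rT) (u : R) => u ^+ 2) e2)).
rewrite (RI_elems (L2_I1sq (mitv _) L4)) (RI_elems (L2_I1sq (mitv _) Lvw)).
rewrite mulr_sumr; apply: ler_sum => m _; set N := \int[leb]_(x in _) (Dx 4 v x ^+ 2).
have mP := ltn_ord m; have m0 := node_ge0 m; have mL := node_leL mP; have lm := node_lt m.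
have hm : node m.+1 - node m = h by rewrite nodeS addrAC subrr add0r.
have L4m : L2 `]node m, node m.+1[%classic (Dx 4 v) by exact: L2_sub m0 mL L4.
have N0 : 0 <= N by apply: RI_ge0; apply: aeW => x _; rewrite sqr_ge0.
have d3 y : node m <= y <= node m.+1 ->
    `|Dx 3 v y - Dx 3 v (node m)| <= Num.sqrt h * Num.sqrt N.
  move=> /andP[y0 y1]; rewrite (Dx_ftc dv (isT : (3 < 4)%N) m0 y0 (le_trans y1 mL)).
  have L4y : L2 `]node m, y[%classic (Dx 4 v) by exact: L2_sub (lexx _) y1 L4m.
  rewrite (le_trans (RI_abs (mitv _) (L2_I1oo L4y)))//.
  rewrite (@le_trans _ _ (Num.sqrt (y - node m) * Num.sqrt N))//.
    apply: RI_sqrt; [exact: y0|exact: sqrtr_ge0|exact: L4y|].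
    by rewrite (sqr_sqrtr N0); apply: RI_sq_mono.
  by rewrite ler_wpM2r ?sqrtr_ge0// ler_wsqrtr// -hm lerB.
have d2 x : node m <= x <= node m.+1 ->
    `|Dx 2 v x - Dx 2 v (node m) - Dx 3 v (node m) * (x - node m)| <= h * (Num.sqrt h * Num.sqrt N).
  move=> /andP[x0 x1]; rewrite (Dx_ftc dv (isT : (2 < 4)%N) m0 x0 (le_trans x1 mL)).
  have I3 : I1 `]node m, x[%classic (Dx 3 v).
    by apply: L2_I1oo; apply: L2_sub m0 (le_trans x1 mL) (Dx_L2 dv _).
  have Ic c : I1 `]node m, x[%classic (fun=> c).
    by apply: L2_I1oo; apply: L2_bmeas => //; exact: bmeas_cst.
  have C c : \int[leb]_(t in `]node m, x[%classic) c = c * (x - node m).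
    by rewrite Rintegral_cst// leb_itvoo.
  rewrite -C -RIB// (le_trans (RI_abs (mitv _) (I1B (mitv _) I3 (Ic _))))//.
  rewrite (@le_trans _ _ (\int[leb]_(t in `]node m, x[%classic) (Num.sqrt h * Num.sqrt N)))//.
    apply: RI_le => //; first by apply: I1_abs => //; exact: I1B.
    apply: aeW => t /=; rewrite in_itv/= => /andP[t0 t1]; apply: d3.
    by rewrite (ltW t0) (le_trans (ltW t1)).
  by rewrite C mulrC ler_wpM2r ?mulr_ge0 ?sqrtr_ge0// -hm lerB.
have -> : h ^+ 2 ^+ 2 * N = \int[leb]_(x in `]node m, node m.+1[%classic) (h ^+ 3 * N).
  by rewrite Rintegral_cst// leb_itvoo ?(ltW lm)// hm; ring.
apply: RI_le => //.
- by apply: L2_I1sq => //; exact: L2_sub m0 mL Lvw.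
- by apply: L2_I1oo; apply: L2_bmeas => //; exact: bmeas_cst.
apply: aeS (Hw m mP) => x Hx Dx'; rewrite Hx//.
move: Dx'; rewrite /= in_itv/= => /andP[x0 x1].
have := d2 x; rewrite (ltW x0) (ltW x1) => /(_ isT) b.
rewrite -real_normK ?num_real//.
rewrite (_ : h ^+ 3 * N = (h * (Num.sqrt h * Num.sqrt N)) ^+ 2); last first.
  rewrite [RHS]exprMn (exprMn 2 (Num.sqrt h)) (sqr_sqrtr N0) (sqr_sqrtr (ltW h0)); ring.
rewrite ler_sqr ?nnegrE ?mulr_ge0 ?sqrtr_ge0 ?(ltW h0)//.
  by rewrite opprD addrA.
all: exact: (ltW L0).
Qed.

End Hermite_space.

(** * The elliptic projection *)

Section projection.
Context {R : realType}.
Local Notation leb := (@lebesgue_measure R).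
Local Notation rT := (measurableTypeR R).
Variable B : beam R.
Hypothesis hB : beam_ok B.
Local Notation L := (bL B).
Local Notation L0 := (bL_gt0 hB).
Local Notation Dx := (Dx L).
Local Notation D := (`]0, L[%classic : set rT).
Local Notation HT := (dom (Ht L 2)).
Local Notation na := (pnorm (form_a B)).
Local Notation nm := (pnorm (form_m B)).
Implicit Types (u v : R -> R^o).

Lemma en_eq0 u v : HT u -> HT v -> (forall x, 0 <= x <= L -> u x = v x) -> en L (u - v) = 0.
Proof.
move=> du dv uv; have duv := lsubB (HT_lsub hB) du dv.
have n0 : nrm ((u - v) : Hk L 2) = 0.
  apply: (Hk_nrm_eq0 L0 (isT : (0 < 2)%N) (Ht_dom duv)) => x xL.
  by change (u x - v x = 0); rewrite uv// subrr.
apply/eqP; rewrite eq_le en_ge0 andbT.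
have := en_nrm L0 (isT : (1 < 2)%N) duv; rewrite -n0; exact.
Qed.

Lemma na_ext u v : HT u -> HT v -> (forall x, 0 <= x <= L -> u x = v x) -> na (u - v) = 0.
Proof.
move=> du dv uv; have duv := lsubB (HT_lsub hB) du dv.
have [c _ H] := na_upper hB; apply/eqP; rewrite eq_le sqrtr_ge0 andbT.
by rewrite (le_trans (H _ duv))// en_eq0// mulr0.
Qed.

Lemma form_a_ext v u u' : HT v -> HT u -> HT u' -> (forall x, 0 <= x <= L -> u x = u' x) ->
  form_a B v u = form_a B v u'.
Proof.
move=> dv du du' uu; apply/eqP; rewrite -subr_eq0 -normr_le0.
have duu := lsubB (HT_lsub hB) du du'.
rewrite -(lin_onB (psd_linr (HT_lsub hB) (form_a_psd hB) dv) du du').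
by rewrite (le_trans (psd_CSn (HT_lsub hB) (form_a_psd hB) dv duu))// na_ext// mulr0.
Qed.

Lemma nrm2_upper : exists2 c, 0 <= c & forall v, HT v -> nrm (v : Ht L 2) <= c * en L v.
Proof.
exists (Num.sqrt (L * L ^+ 3 + L * L + 1)); first exact: sqrtr_ge0.
have l0 := ltW L0.
have K0 : 0 <= L * L ^+ 3 + L * L + 1 by rewrite !addr_ge0 ?mulr_ge0 ?exprn_ge0.
move=> v dv; have dv' := Ht_dom dv.
have n0 : 0 <= nrm (v : Ht L 2) := Hk_nrm_ge0 L0 dv'.
have r0 : 0 <= Num.sqrt (L * L ^+ 3 + L * L + 1) * en L v by rewrite mulr_ge0 ?sqrtr_ge0.
rewrite -ler_sqr ?nnegrE//.
rewrite exprMn (sqr_sqrtr K0).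
have [p e] := Hk_hilb L0 2; rewrite [nrm _]e// sqr_sqrtr ?(psd_ge0 p)//.
rewrite /Hk_form !big_ord_recr big_ord0 /= add0r.
have I0 c : \int[leb]_(x in D) c = L * c.
  by rewrite Rintegral_cst// leb_itvoo// subr0 mulrC.
have Ic c : I1 D (fun=> c) by apply: L2_I1oo; apply: L2_bmeas => //; exact: bmeas_cst.
have bd j c : (j <= 2)%N -> (forall x, 0 <= x <= L -> Dx j v x ^+ 2 <= c) ->
    wform L j (fun=> 1) v v <= L * c.
  move=> j2 h; rewrite -I0; apply: RI_le => //.
    by apply: (wform_I1 j2 _ dv' dv'); exact: bmeas_cst.
  apply: aeW => x /=; rewrite in_itv/= => /andP[x0 x1].
  by rewrite mul1r -expr2; apply: h; rewrite (ltW x0) (ltW x1).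
have b0 := bd 0%N (L ^+ 3 * en L v ^+ 2) isT (fun x xL => tr0_sq hB dv xL).
have b1 : wform L 1 (fun=> 1) v v <= L * (L * en L v ^+ 2).
  apply: bd => // x xL; rewrite -real_normK ?num_real//.
  rewrite -[X in X * _](sqr_sqrtr l0) -exprMn ler_sqr ?nnegrE ?mulr_ge0 ?sqrtr_ge0//.
  exact: (Dx1_bound dv xL).
have b2 : wform L 2 (fun=> 1) v v <= en L v ^+ 2.
  rewrite en_sqr le_eqVlt; apply/orP; left; apply/eqP.
  by apply: eq_Rintegral => x _; rewrite mul1r expr2.
apply: le_trans (lerD (lerD b0 b1) b2) _.
by rewrite !mulrDl mul1r !mulrA.
Qed.

Variables (P N : nat) (w : 'I_N -> R -> R).
Hypotheses (P0 : (0 < P)%N) (bw : is_basis B P w).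

Lemma combE c : (comb w c : R -> R^o) = \sum_i c i 0 *: (w i : R -> R^o).
Proof. by apply/funext => x; rewrite /comb fct_sumE; apply: eq_bigr. Qed.

Lemma basis_Wh i : Wh B P (w i). Proof. by case: bw => H _ _; exact: H. Qed.

Lemma basis_HT i : HT (w i). Proof. exact: (Wh_Ht2 hB P0 (basis_Wh i)). Qed.

Lemma comb_Wh c : Wh B P (comb w c).
Proof.
rewrite combE; have sW := Wh_lsub hB P0.
apply: (lsub_sum sW) => i; apply: (lsubZ sW); exact: basis_Wh.
Qed.

Lemma comb_HT c : HT (comb w c). Proof. exact: (Wh_Ht2 hB P0 (comb_Wh c)). Qed.

Lemma lin_comb (l : (R -> R^o) -> R^o) c : lin_on HT l -> l (comb w c) = \sum_i c i 0 * l (w i).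
Proof.
move=> ll; rewrite combE (lin_on_sum (HT_lsub hB) ll).
  by apply: eq_bigr => i _; rewrite (lin_onZ (HT_lsub hB) ll)//; exact: basis_HT.
by move=> i; apply: (lsubZ (HT_lsub hB)); exact: basis_HT.
Qed.

Lemma comb_lin k c d : (comb w (k *: c + d) : R -> R^o) = k *: (comb w c : R -> R^o) + comb w d.
Proof.
rewrite !combE scaler_sumr -big_split /=; apply: eq_bigr => i _.
by rewrite !mxE scalerDl scalerA.
Qed.

(** The form is definite on functions satisfying the boundary conditions, and the basis
    is free. *)
Lemma mxKT_unit : (mxK B w)^T \in unitmx.
Proof.
rewrite -row_free_unit; apply: inj_row_free => c cK.
have aj j : form_a B (comb w c^T) (w j) = 0.
  rewrite (lin_comb c^T (psd_linl (form_a_psd hB) (basis_HT j))).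
  have := congr1 (fun M : 'rV_N => M 0 j) cK; rewrite !mxE => cj.
  rewrite -[RHS]cj; apply: eq_bigr => i _; rewrite !mxE.
  by rewrite (psdC (form_a_psd hB) (basis_HT i) (basis_HT j)).
have aa : form_a B (comb w c^T) (comb w c^T) = 0.
  rewrite (lin_comb c^T (psd_linr (HT_lsub hB) (form_a_psd hB) (comb_HT c^T))).
  by rewrite big1// => i _; rewrite aj mulr0.
have n0 : na (comb w c^T) = 0 by rewrite /pnorm aa sqrtr0.
have z := na_en0 hB (comb_HT c^T) n0; case: bw => _ inj _.
by apply: trmx_inj; rewrite trmx0; apply: inj => x; rewrite /= in_itv/=; exact: z.
Qed.

(** The coefficients solve the normal equations of [form_a] in the given basis. *)
Definition projc v : 'cV[R]_N := invmx (mxK B w)^T *m (\col_j form_a B v (w j)).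

Definition proj v : R -> R^o := comb w (projc v).

Lemma proj_Wh v : Wh B P (proj v). Proof. exact: comb_Wh. Qed.
Lemma proj_HT v : HT (proj v). Proof. exact: comb_HT. Qed.

Lemma proj_basis v j : form_a B (proj v) (w j) = form_a B v (w j).
Proof.
rewrite (lin_comb (projc v) (psd_linl (form_a_psd hB) (basis_HT j))).
have : (mxK B w)^T *m projc v = \col_j form_a B v (w j).
  by rewrite /projc mulmxA mulmxV ?mxKT_unit// mul1mx.
move=> /(congr1 (fun M : 'cV_N => M j 0)); rewrite !mxE => <-.
by apply: eq_bigr => i _; rewrite !mxE mulrC.
Qed.

Lemma proj_comb v c : HT v -> form_a B (proj v) (comb w c) = form_a B v (comb w c).
Proof.
move=> dv; rewrite (lin_comb c (psd_linr (HT_lsub hB) (form_a_psd hB) (proj_HT v))).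
rewrite (lin_comb c (psd_linr (HT_lsub hB) (form_a_psd hB) dv)).
by apply: eq_bigr => i _; rewrite proj_basis.
Qed.

Lemma proj_spec v wh : HT v -> Wh B P wh -> form_a B (proj v) wh = form_a B v wh.
Proof.
move=> dv hw; case: (bw) => _ _ /(_ wh hw)[c ec].
have e x : 0 <= x <= L -> wh x = comb w c x by move=> xL; apply: ec; rewrite /= in_itv.
have dw := Wh_Ht2 hB P0 hw.
rewrite (form_a_ext (proj_HT v) dw (comb_HT c) e) (form_a_ext dv dw (comb_HT c) e).
exact: proj_comb.
Qed.

Lemma proj_lin : lin_on HT proj.
Proof.
move=> k x y dx dy; rewrite /proj -comb_lin; congr comb.
rewrite /projc -linearP /=; congr (_ *m _); apply/matrixP => i j; rewrite !mxE.
exact: (psd_linl (form_a_psd hB) (basis_HT i) k dx dy).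
Qed.

Lemma proj_na v : HT v -> na (proj v) <= na v.
Proof.
move=> dv; have [->|n0] := eqVneq (na (proj v)) 0; first exact: sqrtr_ge0.
have np : 0 < na (proj v) by rewrite lt_neqAle eq_sym n0 sqrtr_ge0.
rewrite -(ler_pM2r np) -expr2 (pnorm_sqr (form_a_psd hB) (proj_HT v)).
rewrite (proj_spec dv (proj_Wh v)) (le_trans (ler_norm _))//.
exact: (psd_CSn (HT_lsub hB) (form_a_psd hB) dv (proj_HT v)).
Qed.

Lemma proj_bop : @bop R (Ht L 2) (Ht L 2) proj.
Proof.
split; [by move=> v _; exact: proj_HT|exact: proj_lin|].
have [c1 c10 h1] := nrm2_upper; have [c2 c20 h2] := na_lower hB; have [c3 c30 h3] := na_upper hB.
exists (c1 * (c2 * c3)) => v dv.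
rewrite (le_trans (h1 _ (proj_HT v)))// -mulrA ler_wpM2l//.
rewrite (le_trans (h2 _ (proj_HT v)))// -mulrA ler_wpM2l//.
rewrite (le_trans (proj_na dv))// (le_trans (h3 _ dv))// ler_wpM2l//.
exact: (en_nrm L0 (isT : (1 < 2)%N) dv).
Qed.

(** Tested with the difference, by definiteness of [form_a]. *)
Lemma Wh_uniq v v' : Wh B P v -> Wh B P v' ->
  (forall wh, Wh B P wh -> form_a B v wh = form_a B v' wh) ->
  forall x, 0 <= x <= L -> v x = v' x.
Proof.
move=> hv hv' e x xL; have dv := Wh_Ht2 hB P0 hv; have dv' := Wh_Ht2 hB P0 hv'.
have hd : Wh B P (v - v' : R -> R^o) := lsubB (Wh_lsub hB P0) hv hv'.
have dd := Wh_Ht2 hB P0 hd.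
have a0 : form_a B (v - v') (v - v') = 0.
  by rewrite (lin_onB (psd_linl (form_a_psd hB) dd) dv dv') e// subrr.
have n0 : na (v - v') = 0 by rewrite /pnorm a0 sqrtr0.
have := na_en0 hB dd n0 xL; change ((v - v') x) with (v x - v' x).
by move/eqP; rewrite subr_eq0 => /eqP.
Qed.

(** The error is orthogonal to every element of [Wh]. *)
Lemma proj_cea v wh : HT v -> Wh B P wh -> na (proj v - v) <= na (v - wh).
Proof.
move=> dv hw; have sT := HT_lsub hB; have pa := form_a_psd hB.
have dw := Wh_Ht2 hB P0 hw; have dp := proj_HT v.
have de := lsubB sT dp dv; have df := lsubB sT dv dw.
have [->|n0] := eqVneq (na (proj v - v)) 0; first exact: sqrtr_ge0.
have np : 0 < na (proj v - v) by rewrite lt_neqAle eq_sym n0 sqrtr_ge0.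
rewrite -(ler_pM2r np) -expr2 (pnorm_sqr pa de).
have hd : Wh B P (proj v - wh : R -> R^o) := lsubB (Wh_lsub hB P0) (proj_Wh v) hw.
have dd := Wh_Ht2 hB P0 hd.
have orth : form_a B (proj v - v) (proj v - wh) = 0.
  by rewrite (lin_onB (psd_linl pa dd) dp dv) proj_spec// subrr.
have e : (proj v - v : R -> R^o) = (proj v - wh) - (v - wh).
  by rewrite opprB addrA subrK.
rewrite {2}e (lin_onB (psd_linr sT pa de) dd df) orth sub0r.
rewrite (le_trans (ler_norm _))// normrN mulrC.
exact: (psd_CSn sT pa de df).
Qed.

(** By [proj_cea] any approximation in [Wh] will do, and only second derivatives enter. *)
Lemma proj_err c : (forall v, HT v -> na v <= c * en L v) -> 0 <= c ->
  forall v, dom (Ht L 4) v -> na (proj v - v) <= c * (L / P%:R) ^+ 2 * nrm (v : Ht L 4).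
Proof.
move=> hc c0 v hv; have [wh hw ew] := Wh_approx hB P0 hv.
have dv : HT v by case: (@Ht_bop R L L0 4 2 isT) => /(_ v hv).
have dw := Wh_Ht2 hB P0 hw.
rewrite (le_trans (proj_cea dv hw))// (le_trans (hc _ (lsubB (HT_lsub hB) dv dw)))//.
rewrite -mulrA ler_wpM2l// (le_trans ew)// ler_wpM2l ?sqr_ge0//.
have n0 : 0 <= nrm (v : Hk L 4) := Hk_nrm_ge0 L0 (Ht_dom hv).
rewrite -ler_sqr ?nnegrE ?sqrtr_ge0// sqr_sqrtr; first exact: (Dx_nrm L0 (Ht_dom hv) (leqnn 4)).
by apply: RI_ge0; apply: aeW => x _; rewrite sqr_ge0.
Qed.

End projection.

(** * The trapezoidal rule and the Sobolev embedding in time *)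

Section time_lemmas.
Context {R : realType}.
Local Notation leb := (@lebesgue_measure R).
Local Notation rT := (measurableTypeR R).
Implicit Types (a b s t : R).

Lemma ccont_I1 s t (f : R -> R) : ccont s t f -> I1 `]s, t[%classic f.
Proof. by move=> cf; apply: L2_I1oo; exact: ccont_L2. Qed.

(** Taylor expansion at the left end point; the constant adds 1/2 for the values of [F1]
    and 1 for their integral. *)
Lemma trapezoid a b (F0 F1 F2 F3 : R -> R) s t :
  sweak a b F0 F1 -> sweak a b F1 F2 -> sweak a b F2 F3 ->
  ccont a b F0 -> ccont a b F1 -> ccont a b F2 -> a <= s -> s <= t -> t <= b ->
  `|(t - s) / 2 * (F1 t + F1 s) - (F0 t - F0 s)| <=
  3 / 2 * (t - s) ^+ 2 * \int[leb]_(x in `]s, t[%classic) `|F3 x|.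
Proof.
move=> w0 w1 w2 c0 c1 c2 as_ st tb.
set I := \int[leb]_(x in _) `|F3 x|; set d := t - s.
have d0 : 0 <= d by rewrite subr_ge0.
have I0 : 0 <= I by apply: RI_ge0; apply: aeW.
have L3 : L2 `]s, t[%classic F3 by case: w2 => _ h _; exact: L2_sub h.
have b2 x : s <= x -> x <= t -> `|F2 x - F2 s| <= I.
  move=> sx xt; rewrite (sweak_ftc w2 c2 as_ sx (le_trans xt tb)).
  have L3x : L2 `]s, x[%classic F3 by exact: L2_sub L3.
  rewrite (le_trans (RI_abs (mitv _) (L2_I1oo L3x)))//.
  rewrite /I (@RI_split _ s x t) ?sx//; last exact: I1_abs (L2_I1oo L3).
  by rewrite lerDl; apply: RI_ge0; apply: aeW.
have cc c u v : I1 `]u, v[%classic (fun=> c : R).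
  by apply: L2_I1oo; apply: L2_bmeas => //; exact: bmeas_cst.
have Cc c u v : u <= v -> \int[leb]_(x in `]u, v[%classic) c = c * (v - u).
  by move=> uv; rewrite Rintegral_cst// leb_itvoo.
have b1 x : s <= x -> x <= t -> `|F1 x - F1 s - F2 s * (x - s)| <= d * I.
  move=> sx xt; rewrite (sweak_ftc w1 c1 as_ sx (le_trans xt tb)) -Cc//.
  have I2 : I1 `]s, x[%classic F2.
    by apply: ccont_I1; apply: ccontS c2; [|exact: le_trans tb].
  rewrite -RIB// (le_trans (RI_abs (mitv _) (I1B (mitv _) I2 (cc _ _ _))))//.
  apply: (@le_trans _ _ (\int[leb]_(y in `]s, x[%classic) I)).
    apply: RI_le => //; first by apply: I1_abs => //; exact: I1B.
    apply: aeW => y /=; rewrite in_itv/= => /andP[sy yx].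
    by apply: b2; [exact: ltW|rewrite (le_trans (ltW yx))].
  by rewrite Cc// mulrC ler_wpM2r// /d lerB.
have I1' : I1 `]s, t[%classic F1 by apply: ccont_I1; exact: ccontS c1.
pose lin := fun x : R => F1 s + F2 s * (x - s).
have clin : ccont s t lin.
  apply: continuous_ccont => x; apply: cvgD; first exact: cvg_cst.
  by apply: cvgM; [exact: cvg_cst|apply: cvgB => //; exact: cvg_cst].
have Ilin : \int[leb]_(x in `]s, t[%classic) lin x = F1 s * d + F2 s * d ^+ 2 / 2.
  pose Q : {poly R} := F1 s *: ('X - s%:P) + (F2 s / 2) *: ('X - s%:P) ^+ 2.
  have QE x : Q.[x] = F1 s * (x - s) + F2 s / 2 * (x - s) ^+ 2.
    by rewrite /Q !(hornerXsubC, horner_exp, hornerZ, hornerD).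
  have -> : F1 s * d + F2 s * d ^+ 2 / 2 = Q.[t] - Q.[s].
    by rewrite !QE /d; field.
  apply: (@RI_FTC2 _ _ _ (horner Q)) => //.
    apply: continuous_ccont => x.
    by case: (is_derive_poly Q x) => /derivable1_diffP/differentiable_continuous.
  move=> x _; apply: (is_derive_eq (is_derive_poly Q x)).
  rewrite /Q !poly.derivE !(mul0r, mul1r, mulr1, mulr0, add0r, addr0) -polyC1.
  by rewrite !(hornerXsubC, hornerC, hornerZ, hornerM, hornerD) /lin; field.
have bF : `|\int[leb]_(x in `]s, t[%classic) F1 x - (F1 s * d + F2 s * d ^+ 2 / 2)| <= d ^+ 2 * I.
  have Il := ccont_I1 clin.
  rewrite -Ilin -RIB// (le_trans (RI_abs (mitv _) (I1B (mitv _) I1' Il)))//.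
  apply: (@le_trans _ _ (\int[leb]_(y in `]s, t[%classic) (d * I))).
    apply: RI_le => //; first by apply: I1_abs => //; exact: I1B.
    apply: aeW => y /=; rewrite in_itv/= => /andP[sy yt]; rewrite /lin opprD addrA.
    by apply: b1; exact: ltW.
  by rewrite Cc// -/d le_eqVlt; apply/orP; left; apply/eqP; ring.
have b1t := b1 t st (lexx t); rewrite -/d in b1t.
rewrite (sweak_ftc w0 c0 as_ st tb).
have -> : d / 2 * (F1 t + F1 s) - \int[leb]_(x in `]s, t[%classic) F1 x =
  d / 2 * (F1 t - F1 s - F2 s * d) -
  (\int[leb]_(x in `]s, t[%classic) F1 x - (F1 s * d + F2 s * d ^+ 2 / 2)) by field.
rewrite (le_trans (ler_normB _ _))//.
have h1 : `|d / 2 * (F1 t - F1 s - F2 s * d)| <= d / 2 * (d * I).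
  by rewrite normrM ger0_norm ?divr_ge0// ler_wpM2l ?divr_ge0.
rewrite (le_trans (lerD h1 bF))// le_eqVlt; apply/orP; left; apply/eqP; by field.
Qed.

Variable X : nspace R.
Variable q : X -> X -> R.
Hypotheses (sX : lsub (dom X)) (hX : hilb q).

Lemma hilb_dual y : dom X y -> dual X (fun x => q x y).
Proof.
move=> Dy; have [p e] := hX; split.
  by move=> k x z Dx Dz; exact: (psd_linl p Dy k Dx Dz).
exists (nrm y) => x Dx; rewrite !e// mulrC.
exact: (psd_CSn sX p Dx Dy).
Qed.

Lemma int_dual_le (l : X -> R) K a b s t (f : R -> X) : dual X l -> (forall x, dom X x -> `|l x| <= K * nrm x) ->
  bochner_L2 X a b f -> a <= s -> t <= b ->
  \int[leb]_(x in `]s, t[%classic) `|l (f x)| <= K * \int[leb]_(x in `]s, t[%classic) nrm (f x).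
Proof.
move=> dl lK bf as_ tb.
have Ll : L2 `]s, t[%classic (fun x => l (f x)) by apply: L2_sub as_ tb (dual_L2 sX dl bf).
have Ln : L2 `]s, t[%classic (fun x => nrm (f x)) by apply: L2_sub as_ tb (nrm_L2 sX hX bf).
rewrite -RIZ//; last exact: L2_I1oo.
apply: RI_le => //; [exact: I1_abs (L2_I1oo Ll)|exact: I1Z (L2_I1oo Ln)|].
case: bf => df _ _; apply: aeS df => x df Dx; apply: lK; apply: df.
exact: (subset_oo as_ tb).
Qed.

Lemma nrm_int a b (f : R -> X) : a <= b -> bochner_L2 X a b f ->
  \int[leb]_(x in `]a, b[%classic) nrm (f x) <=
  Num.sqrt (b - a) * Num.sqrt (\int[leb]_(x in `]a, b[%classic) (nrm (f x) ^+ 2)).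
Proof.
move=> ab bf; have Ln := nrm_L2 sX hX bf.
have N0 : 0 <= \int[leb]_(x in `]a, b[%classic) (nrm (f x) ^+ 2).
  by apply: RI_ge0; apply: aeW => x _; rewrite sqr_ge0.
rewrite (RI_aeq (_ : aeq _ _ (fun x => `|nrm (f x)|))); last first.
  case: bf => df _ _; apply: aeS df => x df Dx; rewrite ger0_norm//.
  by apply: (nrm_ge0 hX); exact: df.
apply: RI_sqrt; [exact: ab|exact: sqrtr_ge0|exact: Ln|].
by rewrite (sqr_sqrtr N0).
Qed.

(** The embedding of [H^1(a,b;X)] in [C([a,b];X)]: a Hilbert space is normed by the
    functionals given by its own elements. *)
Lemma hilb_sup a b (f g : R -> X) : a < b -> weak_deriv a b f g -> cont a b f ->
  forall t, a <= t <= b -> nrm (f t) <=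
    (b - a)^-1 * \int[leb]_(x in `]a, b[%classic) nrm (f x)
    + \int[leb]_(x in `]a, b[%classic) nrm (g x).
Proof.
move=> ab fg cf t tab; have [bf bg _] := fg.
have dft : dom X (f t) by have [] := cf t; rewrite /= ?in_itv.
have [p e] := hX; have n0 := nrm_ge0 hX dft.
have ba : 0 <= (b - a)^-1 by rewrite invr_ge0 subr_ge0 ltW.
have i0 h : bochner_L2 X a b h -> 0 <= \int[leb]_(x in `]a, b[%classic) nrm (h x).
  move=> [dh _ _]; apply: RI_ge0; apply: aeS dh => x dh Dx.
  by apply: (nrm_ge0 hX); exact: dh.
have [->|nz] := eqVneq (nrm (f t)) 0; first by rewrite addr_ge0 ?mulr_ge0 ?i0.
have np : 0 < nrm (f t) by rewrite lt_neqAle eq_sym nz.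
have dl := hilb_dual dft.
have := sweak_sup ab (sweak_dual sX dl fg) (cont_dual sX dl cf) tab.
rewrite -(pnorm_sqr p dft) -/(pnorm q (f t)) -(nrm_pnorm hX dft) => h.
rewrite -(ler_pM2l np) -expr2 -[leLHS]ger0_norm ?sqr_ge0// (le_trans h)//.
have lK x : dom X x -> `|q x (f t)| <= nrm (f t) * nrm x.
  by move=> Dx; rewrite !e// mulrC; exact: (psd_CSn sX p Dx dft).
rewrite mulrDr mulrCA lerD//.
  by rewrite ler_wpM2l//; exact: (int_dual_le dl lK bf (lexx _) (lexx _)).
exact: (int_dual_le dl lK bg (lexx _) (lexx _)).
Qed.

End time_lemmas.

(** * Dissipativity of the controllers *)

Section controllers.
Context {R : realType}.
Variable r : nat.
Implicit Types (x y : 'cV[R]_r) (A : 'M[R]_r).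

Lemma dotpE m (x y : 'cV[R]_m) : dotp x y = (x^T *m y) 0 0.
Proof. by rewrite /dotp mxE; apply: eq_bigr => i _; rewrite mxE. Qed.

Lemma dotpC x y : dotp x y = dotp y x.
Proof. by apply: eq_bigr => i _; exact: mulrC. Qed.

Lemma dotp_linl y : lin_on setT (fun x => dotp x y : R^o).
Proof.
move=> k x z _ _; rewrite /GRing.scale/= /dotp mulr_sumr -big_split/=.
by apply: eq_bigr => i _; rewrite !mxE; ring.
Qed.

Lemma dotp_linr x : lin_on setT (fun y => dotp x y : R^o).
Proof. by move=> k y z _ _; rewrite !(dotpC x); exact: dotp_linl. Qed.

Lemma dotp_mulmx m (A : 'M[R]_(r, m)) x (y : 'cV[R]_m) :
  dotp x (A *m y) = dotp (A^T *m x) y.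
Proof. by rewrite !dotpE trmx_mul trmxK mulmxA. Qed.

Lemma dotp_xx x : 0 <= dotp x x.
Proof. by apply: sumr_ge0 => i _; rewrite -expr2 sqr_ge0. Qed.

Lemma euclid_lsub : lsub (dom (@euclid R r)). Proof. by []. Qed.

Lemma euclid_psd : psd (dom (@euclid R r)) (@dotp R r).
Proof.
split; first by move=> x y _ _; exact: dotpC.
  by move=> k x y z _ _ _; exact: (dotp_linl z k I I).
by move=> x _; exact: dotp_xx.
Qed.

Lemma euclid_hilb : @hilb R (@euclid R r) (@dotp R r).
Proof. by split; [exact: euclid_psd|]. Qed.

Variable S : controller R r.
Hypothesis hS : controller_ok S.

Definition pform x y := dotp x (cP S *m y).

Lemma pform_psd : psd (setT : set 'cV[R]_r) pform.
Proof.
have [_ _ _ [PT Ppos] _] := hS; split.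
- by move=> x y _ _; rewrite /pform dotp_mulmx PT dotpC.
- by move=> k x y z _ _ _; exact: (dotp_linl _ k I I).
- move=> x _; have [->|x0] := eqVneq x 0; last exact: ltW (Ppos x x0).
  by rewrite /pform mulmx0 dotp_xx.
Qed.

Lemma pform_upper : exists2 c, 0 <= c & forall x, pnorm pform x <= c * Num.sqrt (dotp x x).
Proof.
pose K := \sum_i \sum_j `|cP S i j|.
have K0 : 0 <= K by apply: sumr_ge0 => i _; apply: sumr_ge0.
have comp x i : `|x i 0| <= Num.sqrt (dotp x x).
  rewrite -sqrtr_sqr ler_wsqrtr// /dotp (bigD1 i)//= expr2 lerDl sumr_ge0// => j _.
  by rewrite -expr2 sqr_ge0.
exists (Num.sqrt K) => [|x]; first exact: sqrtr_ge0.
rewrite /pnorm -sqrtrM// ler_wsqrtr// /pform /dotp.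
apply: (@le_trans _ _ (\sum_i \sum_j `|cP S i j| * \sum_k x k 0 * x k 0)); last first.
  by rewrite /K mulr_suml; apply: ler_sum => i _; rewrite mulr_suml.
apply: ler_sum => i _; rewrite mxE mulr_sumr; apply: ler_sum => j _.
rewrite mulrCA (le_trans (ler_norm _))// !normrM ler_wpM2l//.
have -> : \sum_k x k 0 * x k 0 = Num.sqrt (dotp x x) * Num.sqrt (dotp x x).
  by rewrite -expr2 sqr_sqrtr// dotp_xx.
by apply: ler_pM => //; exact: comp.
Qed.

(** Dissipativity of the controller, by completing the square in the
    Kalman-Yakubovich-Popov identities. *)
Lemma KYP_dissipative x (y : R) :
  pform (cA S *m x + y *: cb S) x - cd S * y ^+ 2 - dotp (cc S) x * y <= 0.
Proof.
have [_ [dl0 dld] _ [PT Ppos] [ep0 E1 E2]] := hS.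
set k := Num.sqrt (2 * (cd S - cdelta S)).
have k2 : k ^+ 2 = 2 * (cd S - cdelta S).
  by rewrite sqr_sqrtr// mulr_ge0// subr_ge0.
have p0 := psd_ge0 pform_psd I : 0 <= pform x x.
have sR : lsub (setT : set 'cV[R]_r) by [].
have qq : dotp x (cq S *m (cq S)^T *m x) = dotp (cq S) x ^+ 2.
  by rewrite -mulmxA dotp_mulmx /dotp big_ord1 -dotpE expr2.
have e1 : 2 * pform (cA S *m x) x = - dotp (cq S) x ^+ 2 - ceps S * pform x x.
  have a1 : pform (cA S *m x) x = dotp x ((cA S)^T *m cP S *m x).
    by rewrite /pform -mulmxA [RHS]dotp_mulmx trmxK.
  have a2 : pform (cA S *m x) x = dotp x (cP S *m cA S *m x).
    by rewrite (psdC pform_psd I I) /pform mulmxA.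
  have -> : 2 * pform (cA S *m x) x = dotp x ((cP S *m cA S + (cA S)^T *m cP S) *m x).
    by rewrite mulmxDl (lin_onD (dotp_linr x) I I) -a1 -a2 /=; ring.
  rewrite E1 mulmxBl mulNmx -scalemxAl -scaleN1r (lin_onB (dotp_linr x) I I).
  rewrite !(lin_onZ sR (dotp_linr x) _ I) qq /pform /GRing.scale/=.
  by ring.
have e2 : pform (y *: cb S) x = y * (dotp (cc S) x - k * dotp (cq S) x).
  rewrite (psdC pform_psd I I) /pform -scalemxAr (lin_onZ sR (dotp_linr x) _ I).
  rewrite E2 (lin_onB (dotp_linr x) I I) (lin_onZ sR (dotp_linr x) _ I).
  by rewrite /GRing.scale/= !(dotpC x).
rewrite (lin_onD (psd_linl pform_psd I) I I) e2.
have e3 : 0 <= ceps S * pform x x by rewrite mulr_ge0// ltW.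
have := sqr_ge0 (dotp (cq S) x + k * y).
have y2 : 0 <= cdelta S * y ^+ 2 by rewrite mulr_ge0 ?sqr_ge0// ltW.
rewrite sqrrD exprMn k2; move: e1 e3 y2.
set A1 := pform (cA S *m x) x; set Q := dotp (cq S) x; set Pxx := ceps S * _.
set C := dotp (cc S) x.
rewrite /GRing.scale/=; move=> e1 e3 y2.
have -> : 2 * (cd S - cdelta S) * y ^+ 2 = 2 * (cd S * y ^+ 2) - 2 * (cdelta S * y ^+ 2) by ring.
have -> : y * (C - k * Q) = C * y - Q * (k * y) by ring.
by move: e1 e3 y2; lra.
Qed.

End controllers.

(** * The energy of the error *)

Section energy.
Context {R : realType}.
Variable B : beam R.
Hypothesis hB : beam_ok B.
Variables (r : nat) (S1 S2 : controller R r).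
Hypotheses (hS1 : controller_ok S1) (hS2 : controller_ok S2).
Local Notation L := (bL B).
Local Notation Dx := (Dx L).
Local Notation HT := (dom (Ht L 2)).
Local Notation na := (pnorm (form_a B)).
Local Notation nm := (pnorm (form_m B)).
Local Notation cV := 'cV[R]_r.

(** Displacement, velocity and the states of the two controllers. *)
Definition state := ((R -> R^o) * (R -> R^o) * (cV * cV))%type.
Definition sdom : set state := [set z | HT z.1.1 /\ HT z.1.2].

(** The bilinear form whose quadratic form is the square of [znorm]. *)
Definition eform (z z' : state) : R :=
  2^-1 * (form_a B z.1.1 z'.1.1 + form_m B z.1.2 z'.1.2 +
    pform S1 z.2.1 z'.2.1 + pform S2 z.2.2 z'.2.2).

Lemma sdom_lsub : lsub sdom.
Proof.
have sT := HT_lsub hB; split; first by split; exact: lsub0 sT.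
move=> k x y [x1 x2] [y1 y2]; case: sT => _ h.
by split; [exact: (h k _ _ x1 y1)|exact: (h k _ _ x2 y2)].
Qed.

Lemma eform_psd : psd sdom eform.
Proof.
have sR : lsub (setT : set cV) by [].
apply: psdZ; first by rewrite invr_ge0.
apply: psdD; first apply: psdD; first apply: psdD.
- apply: (@psd_comp R _ _ sdom HT (form_a B) (fun z : state => z.1.1)); [by []| |exact: form_a_psd].
  by move=> z [].
- apply: (@psd_comp R _ _ sdom HT (form_m B) (fun z : state => z.1.2)); [by []| |exact: form_m_psd].
  by move=> z [].
- exact: (@psd_comp R _ _ sdom setT (pform S1) (fun z : state => z.2.1) _ _ (pform_psd hS1)).
- exact: (@psd_comp R _ _ sdom setT (pform S2) (fun z : state => z.2.2) _ _ (pform_psd hS2)).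
Qed.

Local Notation nz := (pnorm eform).

Lemma znormE (u v : R -> R^o) (x y : cV) : HT u -> HT v ->
  znorm B S1 S2 u v x y = nz ((u, v), (x, y)).
Proof.
move=> du dv; rewrite /znorm /pnorm; congr Num.sqrt.
rewrite /eform /= form_aE form_mE !RI_cc_oo /wform /pform.
under eq_Rintegral do rewrite expr2 mulrA.
under [X in _ + 2^-1 * X]eq_Rintegral do rewrite expr2 mulrA.
set I1 := Rintegral _ _ _; set I2 := Rintegral _ _ _.
rewrite /Dx /=; ring.
Qed.

Lemma nz_parts (z : state) : sdom z -> [/\ na z.1.1 <= 2 * nz z, nm z.1.2 <= 2 * nz z,
  pnorm (pform S1) z.2.1 <= 2 * nz z & pnorm (pform S2) z.2.2 <= 2 * nz z].
Proof.
move=> dz; have [d1 d2] := dz.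
have a0 := psd_ge0 (form_a_psd hB) d1; have m0 := psd_ge0 (form_m_psd hB) d2.
have p0 := psd_ge0 (pform_psd hS1) (I : setT z.2.1).
have q0 := psd_ge0 (pform_psd hS2) (I : setT z.2.2).
have e0 : 0 <= 2 * nz z by rewrite mulr_ge0 ?sqrtr_ge0.
have e2 : (2 * nz z) ^+ 2 = 2 * (form_a B z.1.1 z.1.1 + form_m B z.1.2 z.1.2 +
    pform S1 z.2.1 z.2.1 + pform S2 z.2.2 z.2.2).
  by rewrite exprMn (pnorm_sqr eform_psd dz) /eform; field.
have bd x : 0 <= x -> x <= (2 * nz z) ^+ 2 -> Num.sqrt x <= 2 * nz z.
  by move=> x0 h; rewrite -ler_sqr ?nnegrE ?sqrtr_ge0// sqr_sqrtr.
split; apply: bd => //; rewrite e2; move: a0 m0 p0 q0; lra.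
Qed.

Lemma energy_arith (h a X1 X2 c1 c2 t1 t2 rho1 rho2 p1 p2 n : R) : 0 <= h ->
  X1 - c1 - t1 <= 0 -> X2 - c2 - t2 <= 0 ->
  `|rho1| <= n -> `|rho2| <= n -> `|p1| <= n -> `|p2| <= n ->
  2^-1 * (h * a + rho1 + (- h * (a + c1 + c2 + t1 + t2) + rho2) + (h * X1 + p1) + (h * X2 + p2))
    <= 2 * n.
Proof.
move=> h0 k1 k2 r1 r2 q1 q2.
have := mulr_ge0_le0 h0 k1; have := mulr_ge0_le0 h0 k2.
have := le_trans (ler_norm _) r1; have := le_trans (ler_norm _) r2.
have := le_trans (ler_norm _) q1; have := le_trans (ler_norm _) q2.
rewrite !mulrBr !mulNr !mulrDr; lra.
Qed.

(** Tested with the sums over both time levels, the elastic terms cancel and the damping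
    absorbs the controllers by [KYP_dissipative]. What remains is the residual times the sum
    of the two norms, by which the difference of squares is divided; hence the bound is
    additive and no factor exponential in time arises. *)
Lemma energy_step (dt Rn : R) (z0 z1 : state) (rho1 rho2 : R) (g1 g2 : cV) :
  let s := z1 + z0 in
  let al := Dx 1 s.1.2 L in let be := s.1.2 L in
  0 <= dt -> 0 <= Rn -> sdom z0 -> sdom z1 ->
  form_a B (z1.1.1 - z0.1.1) s.1.1 = dt / 2 * form_a B s.1.2 s.1.1 + rho1 ->
  form_m B (z1.1.2 - z0.1.2) s.1.2 = - (dt / 2) * (form_a B s.1.1 s.1.2 +
     cd S1 * al ^+ 2 + cd S2 * be ^+ 2 + dotp (cc S1) s.2.1 * al + dotp (cc S2) s.2.2 * be) + rho2 ->
  z1.2.1 - z0.2.1 = (dt / 2) *: (cA S1 *m s.2.1 + al *: cb S1) + g1 ->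
  z1.2.2 - z0.2.2 = (dt / 2) *: (cA S2 *m s.2.2 + be *: cb S2) + g2 ->
  `|rho1| <= Rn * na s.1.1 -> `|rho2| <= Rn * nm s.1.2 ->
  pnorm (pform S1) g1 <= Rn -> pnorm (pform S2) g2 <= Rn ->
  nz z1 <= nz z0 + 4 * Rn.
Proof.
move=> s al be dt0 Rn0 d0 d1 H1 H2 H3 H4 B1 B2 B3 B4.
have sR : lsub (setT : set cV) by [].
have ds : sdom s := lsubD sdom_lsub d1 d0.
have [ds1 ds2] := ds.
have dm : sdom (z1 - z0) := lsubB sdom_lsub d1 d0.
have k1 := KYP_dissipative hS1 s.2.1 al; have k2 := KYP_dissipative hS2 s.2.2 be.
(* The difference of two squares is the product of difference and sum. *)
have E : nz z1 ^+ 2 - nz z0 ^+ 2 = eform (z1 - z0) s.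
  rewrite !(pnorm_sqr eform_psd)// (lin_onB (psd_linl eform_psd ds) d1 d0).
  rewrite (lin_onD (psd_linr sdom_lsub eform_psd d1) d1 d0).
  rewrite (lin_onD (psd_linr sdom_lsub eform_psd d0) d1 d0).
  by rewrite (psdC eform_psd d0 d1) /=; ring.
have p1 : pform S1 (z1.2.1 - z0.2.1) s.2.1 =
    dt / 2 * pform S1 (cA S1 *m s.2.1 + al *: cb S1) s.2.1 + pform S1 g1 s.2.1.
  rewrite H3 (lin_onD (psd_linl (pform_psd hS1) I) I I).
  by rewrite (lin_onZ sR (psd_linl (pform_psd hS1) I) _ I).
have p2 : pform S2 (z1.2.2 - z0.2.2) s.2.2 =
    dt / 2 * pform S2 (cA S2 *m s.2.2 + be *: cb S2) s.2.2 + pform S2 g2 s.2.2.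
  rewrite H4 (lin_onD (psd_linl (pform_psd hS2) I) I I).
  by rewrite (lin_onZ sR (psd_linl (pform_psd hS2) I) _ I).
have [n1 n2 n3 n4] := nz_parts ds.
have q1 : `|pform S1 g1 s.2.1| <= Rn * (2 * nz s).
  rewrite (le_trans (psd_CSn sR (pform_psd hS1) I I))//.
  by apply: ler_pM => //; exact: sqrtr_ge0.
have q2 : `|pform S2 g2 s.2.2| <= Rn * (2 * nz s).
  rewrite (le_trans (psd_CSn sR (pform_psd hS2) I I))//.
  by apply: ler_pM => //; exact: sqrtr_ge0.
have r1 : `|rho1| <= Rn * (2 * nz s) by rewrite (le_trans B1)// ler_wpM2l.
have r2 : `|rho2| <= Rn * (2 * nz s) by rewrite (le_trans B2)// ler_wpM2l.
have sym : form_a B s.1.2 s.1.1 = form_a B s.1.1 s.1.2 := psdC (form_a_psd hB) ds2 ds1.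
have bound : eform (z1 - z0) s <= 4 * Rn * nz s.
  rewrite /eform -[(z1 - z0).1.1]/(z1.1.1 - z0.1.1) -[(z1 - z0).1.2]/(z1.1.2 - z0.1.2).
  rewrite -[(z1 - z0).2.1]/(z1.2.1 - z0.2.1) -[(z1 - z0).2.2]/(z1.2.2 - z0.2.2).
  rewrite H1 H2 p1 p2 sym.
  have dt2 : 0 <= dt / 2 by rewrite divr_ge0.
  apply: le_trans (energy_arith _ dt2 k1 k2 r1 r2 q1 q2) _.
  by rewrite le_eqVlt; apply/orP; left; apply/eqP; ring.
have tri := pnorm_tri sdom_lsub eform_psd d1 d0; rewrite -/s in tri.
have z00 : 0 <= nz z0 := sqrtr_ge0 _; have z10 : 0 <= nz z1 := sqrtr_ge0 _.
have R4 : 0 <= 4 * Rn by rewrite mulr_ge0.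
have := le_trans bound (ler_wpM2l R4 tri); rewrite -E => fin.
rewrite -lerBlDl; have [z|zn] := eqVneq (nz z1 + nz z0) 0.
  move/eqP: z; rewrite paddr_eq0// => /andP[/eqP-> /eqP->]; by rewrite subrr.
have zp : 0 < nz z1 + nz z0 by rewrite lt_neqAle eq_sym zn addr_ge0.
by rewrite -(ler_pM2r zp) -subr_sqr.
Qed.

End energy.

(** * The weak equation at every time *)

Section duals.
Context {R : realType}.
Local Notation leb := (@lebesgue_measure R).
Local Notation rT := (measurableTypeR R).
Variable B : beam R.
Hypothesis hB : beam_ok B.
Local Notation L := (bL B).
Local Notation L0 := (bL_gt0 hB).
Local Notation Dx := (Dx L).
Local Notation X2 := (Ht L 2).
Local Notation HT := (dom X2).
Local Notation na := (pnorm (form_a B)).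
Local Notation nm := (pnorm (form_m B)).

Lemma form_a_dual y : HT y -> dual X2 (fun v => form_a B v y).
Proof.
move=> dy; have [c c0 hc] := na_upper hB.
have ll := psd_linl (form_a_psd hB) dy.
apply: (@en_dual R B hB 2 _ (c * na y) isT ll) => v dv; rewrite (le_trans (psd_CSn (HT_lsub hB) (form_a_psd hB) dv dy))//.
by rewrite mulrAC ler_wpM2r ?sqrtr_ge0// hc.
Qed.

Lemma form_m_dual y : HT y -> dual X2 (fun v => form_m B v y).
Proof.
move=> dy; have [c c0 hc] := nm_upper hB.
have ll := psd_linl (form_m_psd hB) dy.
apply: (@en_dual R B hB 2 _ (c * nm y) isT ll) => v dv; rewrite (le_trans (psd_CSn (HT_lsub hB) (form_m_psd hB) dv dy))//.
by rewrite mulrAC ler_wpM2r ?sqrtr_ge0// hc.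
Qed.

Lemma tr1_dual : dual X2 (fun v => Dx 1 v L).
Proof.
have ll := Dx1_lin hB (L_itv hB).
by apply: (@en_dual R B hB 2 _ (Num.sqrt L) isT ll) => v dv; exact: (Dx1_bound dv (L_itv hB)).
Qed.

Lemma tr0_dual : dual X2 (fun v => v L).
Proof.
apply: (@en_dual R B hB 2 (fun v => v L) (L * Num.sqrt L)) => // v dv.
by rewrite -mulrA; exact: (Dx0_bound dv (L_itv hB)).
Qed.

Lemma Hsp_lsub : lsub (dom (Hsp B)).
Proof.
have [z0 zl] := Hk_lsub L0 0; split.
  by change (dom (Hk L 0) (0 : R -> R^o)); exact: z0.
move=> k x y dx dy; change (dom (Hk L 0) (k *: x.2 + y.2 : R -> R^o)).
exact: (zl k x.2 y.2 dx dy).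
Qed.

Lemma ipH_ge (p : Hsp B) : bJ B * p.1.1 ^+ 2 <= ipH B p p /\ bM B * p.1.2 ^+ 2 <= ipH B p p.
Proof.
have [[_ M0 J0 _ _] _ _ mp _] := hB.
have i0 : 0 <= \int[leb]_(x in `[0, L]%classic) (bmu B x * p.2 x * p.2 x).
  apply: RI_ge0; apply: aeW => x xL; rewrite -mulrA -expr2 mulr_ge0 ?sqr_ge0//.
  exact/ltW/mp.
have j0 : 0 <= bJ B * p.1.1 ^+ 2 by rewrite mulr_ge0 ?sqr_ge0// ltW.
have m0 : 0 <= bM B * p.1.2 ^+ 2 by rewrite mulr_ge0 ?sqr_ge0// ltW.
rewrite /ipH -!(mulrA (bJ B)) -!(mulrA (bM B)) -!expr2.
by split; lra.
Qed.

Lemma sqrt_dual_bound (c x y : R) : 0 < c -> c * x ^+ 2 <= y ->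
  `|x| <= (Num.sqrt c)^-1 * Num.sqrt y.
Proof.
move=> c0 h; have sc : 0 < Num.sqrt c by rewrite sqrtr_gt0.
have y0 : 0 <= y by apply: le_trans h; rewrite mulr_ge0 ?sqr_ge0// ltW.
rewrite mulrC ler_pdivlMr// -ler_sqr ?nnegrE ?mulr_ge0 ?sqrtr_ge0//.
by rewrite exprMn (sqr_sqrtr (ltW c0)) (sqr_sqrtr y0) real_normK ?num_real// mulrC.
Qed.

Lemma Hsp_fst_dual : dual (Hsp B) (fun p => p.1.1).
Proof.
have [[_ M0 J0 _ _] _ _ _ _] := hB; split; first by [].
by exists (Num.sqrt (bJ B))^-1 => p _; apply: sqrt_dual_bound => //; case: (ipH_ge p).
Qed.

Lemma Hsp_snd_dual : dual (Hsp B) (fun p => p.1.2).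
Proof.
have [[_ M0 J0 _ _] _ _ _ _] := hB; split; first by [].
by exists (Num.sqrt (bM B))^-1 => p _; apply: sqrt_dual_bound => //; case: (ipH_ge p).
Qed.

Definition Vform (w1 w2 : R -> R^o) : R :=
  \int[leb]_(x in `[0, L]%classic) (bLam B x * Dx 2 w1 x * Dx 2 w2 x).

Lemma Vsp_hilb : @hilb R (Vsp B) Vform.
Proof.
split; last by [].
have [bm m0 _] := Lam_ok hB.
apply: (psd_ext _ (HT_lsub hB) (wform_psdT hB (leqnn 2) bm m0)) => x y _ _.
by rewrite /Vform RI_cc_oo.
Qed.

Lemma Vdual_lsub : lsub (dom (Vdual B)).
Proof.
split.
  split; first by move=> k x y _ _; rewrite mulr0 addr0.
  by exists 0 => x _; rewrite normr0 mul0r.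
move=> k l1 l2 [ll1 [K1 H1]] [ll2 [K2 H2]]; split.
  move=> c x y dx dy.
  change (k * l1 (c *: x + y) + l2 (c *: x + y) =
    c * (k * l1 x + l2 x) + (k * l1 y + l2 y)).
  by rewrite ll1// ll2//; ring.
exists (`|k| * K1 + K2) => x dx; change (`|k * l1 x + l2 x| <= (`|k| * K1 + K2) * nrm (x : Vsp B)).
rewrite (le_trans (ler_normD _ _))// mulrDl lerD ?H2// normrM -mulrA ler_wpM2l//.
exact: H1.
Qed.

(** The value at the normalised [w] is one of those in the supremum. *)
Lemma Vdual_eval_dual w : dom (Vsp B) w -> dual (Vdual B) (fun l => l w).
Proof.
move=> dw; split; first by [].
have n0 := nrm_ge0 Vsp_hilb dw.
exists (nrm (w : Vsp B)) => l dl; have [ll [K HK]] := dl.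
have [z|nz] := eqVneq (nrm (w : Vsp B)) 0.
  by rewrite (le_trans (HK w dw))// z mulr0 mul0r.
have np : 0 < nrm (w : Vsp B) by rewrite lt_neqAle eq_sym nz.
set n := nrm (w : Vsp B) in n0 nz np *.
have sV : lsub (dom (Vsp B)) := HT_lsub hB.
have dw' : dom (Vsp B) (n^-1 *: w) := lsubZ sV n^-1 dw.
have nw' : nrm (n^-1 *: w : Vsp B) = 1.
  by rewrite (nrmZ sV Vsp_hilb)// -/n gtr0_norm ?invr_gt0// mulVf.
have lw' : l (n^-1 *: w) = n^-1 * l w.
  exact: (lin_onZ sV (ll : lin_on (dom (Vsp B)) (l : Vsp B -> R^o)) n^-1 dw).
have : `|l (n^-1 *: w)| <= nrm (l : Vdual B).
  apply: ub_le_sup; last by exists (n^-1 *: w); rewrite nw'.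
  exists `|K| => y [v [dv v1 ->]]; rewrite (le_trans (HK v dv))//.
  have v0 := nrm_ge0 Vsp_hilb dv.
  rewrite (le_trans (ler_norm _))// normrM (ger0_norm v0) -[leRHS]mulr1.
  by rewrite ler_wpM2l.
by rewrite lw' normrM gtr0_norm ?invr_gt0// ler_pdivrMl.
Qed.

Section solution.
Variables (r : nat) (S1 S2 : controller R r) (T : R) (hT : 0 < T).
Variables (u : R -> R -> R) (z1 z2 : R -> 'cV[R]_r).
Variables (u0 : R -> R) (v0 : Hsp B) (z10 z20 : 'cV[R]_r).
Hypothesis hw : weak_solution S1 S2 T u z1 z2 u0 v0 z10 z20.
Hypothesis hu : sobolev X2 0 T 4 u.
Hypotheses (hz1 : sobolev (euclid r) 0 T 3 z1) (hz2 : sobolev (euclid r) 0 T 3 z2).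
Local Notation D := (`]0, T[%classic : set rT).
Local Notation U j := (wdiffn X2 0 T j u).
Local Notation Zd j z := (wdiffn (euclid r) 0 T j z).

Lemma U_cont j : (j < 4)%N -> cont 0 T (U j).
Proof. by move=> j4; case: hu => _ /(_ j j4)[]. Qed.

Lemma U_weak j : (j < 4)%N -> weak_deriv 0 T (U j) (U j.+1).
Proof. by move=> j4; case: hu => _ /(_ j j4)[]. Qed.

Lemma U_HT j t : (j < 4)%N -> 0 <= t <= T -> HT (U j t).
Proof. by move=> j4 tT; have [] := U_cont j4 (_ : `[0, T]%classic t); rewrite /= ?in_itv. Qed.

Lemma U_sweak (l : X2 -> R) j : (j < 4)%N -> dual X2 l ->
  sweak 0 T (fun t => l (U j t)) (fun t => l (U j.+1 t)).
Proof. by move=> j4 dl; exact: (sweak_dual (HT_lsub hB) dl (U_weak j4)). Qed.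

Lemma U_ccont (l : X2 -> R) j : (j < 4)%N -> dual X2 l -> ccont 0 T (fun t => l (U j t)).
Proof. by move=> j4 dl; exact: (cont_dual (HT_lsub hB) dl (U_cont j4)). Qed.

(** For a fixed test function both sides are second weak derivatives of the same scalar
    function of time. *)
Lemma uhat_tt_ae w : HT w -> aeq D
  (fun t => wdiffn (Vdual B) 0 T 2 (fun t => embH (hat B (u t) : Hsp B)) t w)
  (fun t => form_m B (U 2 t) w).
Proof.
move=> dw; case: hw => -[_ _ [_ hV] _ _] _ _ _ _.
have dl := Vdual_eval_dual dw; have dm := form_m_dual dw.
have w01 := sweak_dual Vdual_lsub dl (hV 0%N isT).2.
have w12 := sweak_dual Vdual_lsub dl (hV 1%N isT).2.
have a1 := sweak_uniq w01 (U_sweak (isT : (0 < 4)%N) dm) (aeq_refl _ _).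
exact: (sweak_uniq w12 (U_sweak (isT : (1 < 4)%N) dm) a1).
Qed.

Lemma uhat_t_ae : aeq D
    (fun t => (wdiffn (Hsp B) 0 T 1 (fun t => hat B (u t) : Hsp B) t).1.1)
    (fun t => Dx 1 (U 1 t) L) /\
  aeq D (fun t => (wdiffn (Hsp B) 0 T 1 (fun t => hat B (u t) : Hsp B) t).1.2)
    (fun t => U 1 t L).
Proof.
case: hw => -[_ [_ hH] _ _ _] _ _ _ _.
have w1 := sweak_dual Hsp_lsub Hsp_fst_dual (hH 0%N isT).2.
have w2 := sweak_dual Hsp_lsub Hsp_snd_dual (hH 0%N isT).2.
split.
  exact: (sweak_uniq w1 (U_sweak (isT : (0 < 4)%N) tr1_dual) (aeq_refl _ _)).
exact: (sweak_uniq w2 (U_sweak (isT : (0 < 4)%N) tr0_dual) (aeq_refl _ _)).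
Qed.

Lemma Z_ccont z j y : sobolev (euclid r) 0 T 3 z -> (j < 3)%N ->
  ccont 0 T (fun t => dotp (Zd j z t) y).
Proof.
move=> hz j3; case: hz => _ /(_ j j3)[cz _].
have dl := hilb_dual (@euclid_lsub R r) (@euclid_hilb R r) (I : dom (euclid r) y).
have := cont_dual (@euclid_lsub R r) dl cz.
exact.
Qed.

(** For a fixed test function all terms are continuous in time, so the weak formulation
    holds at every time and not only almost everywhere. *)
Lemma weak_eq_all w t : HT w -> 0 <= t <= T ->
  form_m B (U 2 t) w + form_a B (u t) w + cd S1 * Dx 1 (U 1 t) L * Dx 1 w L
  + cd S2 * U 1 t L * w L + dotp (cc S1) (z1 t) * Dx 1 w L + dotp (cc S2) (z2 t) * w L = 0.
Proof.
move=> dw tT.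
pose F := fun t => form_m B (U 2 t) w + form_a B (U 0 t) w + (cd S1 * Dx 1 w L) * Dx 1 (U 1 t) L
  + (cd S2 * w L) * U 1 t L + Dx 1 w L * dotp (Zd 0 z1 t) (cc S1) + w L * dotp (Zd 0 z2 t) (cc S2).
have cF : ccont 0 T F.
  apply: ccontD; last by apply: ccontZ; exact: Z_ccont.
  apply: ccontD; last by apply: ccontZ; exact: Z_ccont.
  apply: ccontD; last by apply: ccontZ; exact: (U_ccont (isT : (1 < 4)%N) tr0_dual).
  apply: ccontD; last by apply: ccontZ; exact: (U_ccont (isT : (1 < 4)%N) tr1_dual).
  apply: ccontD; first exact: (U_ccont (isT : (2 < 4)%N) (form_m_dual dw)).
  exact: (U_ccont (isT : (0 < 4)%N) (form_a_dual dw)).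
have c0 : ccont 0 T (fun=> 0 : R).
  by move=> x _ e e0; exists 1 => // y _ _; rewrite subrr normr0 ltW.
have arith (m a c x d y p q w1 w2 : R) : m + a + c * x * w1 + d * y * w2 + p * w1 + q * w2 =
    m + a + (c * w1) * x + (d * w2) * y + w1 * p + w2 * q by ring.
have FE s : form_m B (U 2 s) w + form_a B (u s) w + cd S1 * Dx 1 (U 1 s) L * Dx 1 w L
    + cd S2 * U 1 s L * w L + dotp (cc S1) (z1 s) * Dx 1 w L + dotp (cc S2) (z2 s) * w L = F s.
  by rewrite arith (dotpC (cc S1)) (dotpC (cc S2)).
have F0 : aeq D F (fun=> 0).
  case: (hw) => _ eqn _ _ _; have [e1 e2] := uhat_t_ae.
  have H := aeS2 (fun _ => @conj _ _) (uhat_tt_ae dw) (aeS2 (fun _ => @conj _ _) e1 e2).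
  apply: aeS2 eqn H => s eqs [h1 [h2 h3]] Ds.
  have := eqs Ds w dw; rewrite (h1 Ds) (h2 Ds) (h3 Ds) => <-.
  exact: esym (FE s).
by rewrite FE; exact: (ccont_aeq hT cF c0 F0 tT).
Qed.

Lemma dotp_inj (x y : 'cV[R]_r) : (forall v, dotp x v = dotp y v) -> x = y.
Proof.
move=> h; apply/matrixP => i j; rewrite ord1.
have H (v : 'cV[R]_r) : dotp v (delta_mx i 0) = v i 0.
  rewrite /dotp (bigD1 i)//= mxE !eqxx mulr1 big1 ?addr0// => k ki.
  by rewrite mxE (negbTE ki) mulr0.
by rewrite -!H h.
Qed.

Lemma control_eq_all (S : controller R r) z (l : X2 -> R) (tr : R -> R) t :
  sobolev (euclid r) 0 T 3 z -> dual X2 l -> aeq D tr (fun t => l (U 1 t)) ->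
  {ae leb, forall t, D t -> Zd 1 z t = cA S *m z t + tr t *: cb S} ->
  0 <= t <= T -> Zd 1 z t = cA S *m z t + l (U 1 t) *: cb S.
Proof.
move=> hz dl etr eqn tT; apply: dotp_inj => v.
have sR : lsub (setT : set 'cV[R]_r) by [].
have E (s c : R) : dotp (cA S *m z s + c *: cb S) v =
    dotp (Zd 0 z s) ((cA S)^T *m v) + dotp (cb S) v * c.
  rewrite (lin_onD (dotp_linl v) I I) (lin_onZ sR (dotp_linl v) _ I).
  by rewrite [dotp _ ((cA S)^T *m v)]dotp_mulmx trmxK /GRing.scale/= [c * _]mulrC.
rewrite E; apply: (ccont_aeq hT (f := fun t => dotp (Zd 1 z t) v)
  (g := fun t => dotp (Zd 0 z t) ((cA S)^T *m v) + dotp (cb S) v * l (U 1 t)) _ _ _ tT).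
- exact: Z_ccont.
- apply: ccontD; first exact: Z_ccont.
  by apply: ccontZ; exact: (U_ccont (isT : (1 < 4)%N) dl).
- by apply: aeS2 etr eqn => s es eqs Ds; rewrite (eqs Ds) E (es Ds).
Qed.

Lemma control1_eq t : 0 <= t <= T -> Zd 1 z1 t = cA S1 *m z1 t + Dx 1 (U 1 t) L *: cb S1.
Proof.
move=> tT; case: (hw) => _ _ e1 _ _; have [h1 _] := uhat_t_ae.
exact: (control_eq_all hz1 tr1_dual h1 e1 tT).
Qed.

Lemma control2_eq t : 0 <= t <= T -> Zd 1 z2 t = cA S2 *m z2 t + U 1 t L *: cb S2.
Proof.
move=> tT; case: (hw) => _ _ _ e1 _; have [_ h1] := uhat_t_ae.
exact: (control_eq_all hz2 tr0_dual h1 e1 tT).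
Qed.

End solution.
End duals.

(** * One step of the scheme *)

Section one_step.
Context {R : realType}.
Variable B : beam R.
Hypothesis hB : beam_ok B.
Variables (r : nat) (S1 S2 : controller R r).
Hypotheses (hS1 : controller_ok S1) (hS2 : controller_ok S2).
Local Notation L := (bL B).
Local Notation Dx := (Dx L).
Local Notation HT := (dom (Ht L 2)).
Local Notation na := (pnorm (form_a B)).
Local Notation nm := (pnorm (form_m B)).
Local Notation cV := 'cV[R]_r.
Variables (P N : nat) (w : 'I_N -> R -> R).
Hypotheses (P0 : (0 < P)%N) (bw : is_basis B P w).
Local Notation proj := (proj B w).
Local Notation projc := (projc B w).
Implicit Types (v : R -> R^o) (c d : 'cV[R]_N).

Lemma lin_comb_lin (l : (R -> R^o) -> R^o) : lin_on HT l ->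
  lin_on setT (fun c => l (comb w c) : R^o).
Proof.
move=> ll k c d _ _; rewrite comb_lin.
exact: (ll k _ _ (comb_HT hB P0 bw c) (comb_HT hB P0 bw d)).
Qed.

Lemma combD c d : (comb w (c + d) : R -> R^o) = (comb w c : R -> R^o) + comb w d.
Proof. by have := comb_lin w 1 c d; rewrite !scale1r. Qed.

Lemma mx_form (q : (R -> R^o) -> (R -> R^o) -> R) (A : 'M[R]_N) c i : psd HT q ->
  (forall i j, A i j = q (w i) (w j)) -> (A *m c) i 0 = q (comb w c) (w i).
Proof.
move=> pq Aq; have wi := basis_HT hB P0 bw.
rewrite mxE (lin_comb hB P0 bw c (psd_linl pq (wi i))); apply: eq_bigr => j _.
by rewrite Aq mulrC (psdC pq (wi i) (wi j)).
Qed.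

Lemma form_b_psd : psd HT (fun v1 v2 => cd S1 * (Dx 1 v1 L * Dx 1 v2 L) + cd S2 * (v1 L * v2 L)).
Proof.
have [_ [a1 a2] _ _ _] := hS1; have [_ [b1 b2] _ _ _] := hS2.
apply: psdD; apply: psdZ.
- exact: le_trans (ltW a1) a2.
- exact: (psd_rank1 (Dx1_lin hB (L_itv hB))).
- exact: le_trans (ltW b1) b2.
- exact: (@psd_rank1 R _ HT (fun v : R -> R^o => v L : R^o) (@eval_lin R B L)).
Qed.

(** The scheme is stated for basis functions, and both sides are linear in the test
    function. *)
Lemma scheme_test (dt : R) c0 c1 d0 d1 (x0 x1 y0 y1 : cV) : 0 < dt ->
  dt^-1 *: (mxA B w *m d1 - mxA B w *m d0) =
        - (2^-1 *: (mxK B w *m c1 + mxK B w *m c0))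
        - 2^-1 *: (mxB B S1 S2 w *m d1 + mxB B S1 S2 w *m d0)
        - 2^-1 *: (vecC B S1 S2 w x1 y1 + vecC B S1 S2 w x0 y0) ->
  forall c, let X := comb w c in
  form_m B (comb w d1) X - form_m B (comb w d0) X = - (dt / 2) *
    (form_a B (comb w c1) X + form_a B (comb w c0) X
     + cd S1 * (Dx 1 (comb w d1) L + Dx 1 (comb w d0) L) * Dx 1 X L
     + cd S2 * (comb w d1 L + comb w d0 L) * X L
     + dotp (cc S1) (x1 + x0) * Dx 1 X L + dotp (cc S2) (y1 + y0) * X L).
Proof.
move=> dt0 eqn c X.
have H := comb_HT hB P0 bw.
have am c0' := psd_linr (HT_lsub hB) (form_m_psd hB) (H c0').
have aa c0' := psd_linr (HT_lsub hB) (form_a_psd hB) (H c0').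
have t1 := Dx1_lin hB (L_itv hB); have t0 := @eval_lin R B L.
move Ef1 : (Dx 1 (comb w d1) L) => f1; move Ef0 : (Dx 1 (comb w d0) L) => f0.
move Eg1 : (comb w d1 L) => g1; move Eg0 : (comb w d0 L) => g0.
rewrite (lin_comb hB P0 bw c (am d1)) (lin_comb hB P0 bw c (am d0)).
rewrite (lin_comb hB P0 bw c (aa c1)) (lin_comb hB P0 bw c (aa c0)).
rewrite (lin_comb hB P0 bw c t1).
have -> : X L = \sum_i c i 0 * w i L := lin_comb hB P0 bw c t0.
rewrite !mulr_sumr -sumrB -!big_split mulr_sumr; apply: eq_bigr => i _; cbv beta.
have mA i' j' : mxA B w i' j' = form_m B (w i') (w j').
  by rewrite mxE /form_m /ipH /=; ring.
have mK i' j' : mxK B w i' j' = form_a B (w i') (w j') by rewrite mxE.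
have mB i' j' : mxB B S1 S2 w i' j' =
    cd S1 * (Dx 1 (w i') L * Dx 1 (w j') L) + cd S2 * (w i' L * w j' L).
  by rewrite mxE !mulrA.
have := congr1 (fun M : 'cV_N => M i 0) eqn.
rewrite mxE [X in _ * X]mxE [X in _ * (_ + X)]mxE.
rewrite (mx_form d1 i (form_m_psd hB) mA) (mx_form d0 i (form_m_psd hB) mA).
rewrite [RHS]mxE [X in _ = X + _]mxE [X in _ = X + _ + _]mxE [X in _ = - X + _ + _]mxE.
rewrite [X in _ = - (_ * X) + _ + _]mxE.
rewrite (mx_form c1 i (form_a_psd hB) mK) (mx_form c0 i (form_a_psd hB) mK).
rewrite [X in _ = _ + X + _]mxE [X in _ = _ - X + _]mxE [X in _ = _ - (_ * X) + _]mxE.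
rewrite (mx_form d1 i form_b_psd mB) (mx_form d0 i form_b_psd mB).
rewrite [X in _ = _ + X]mxE [X in _ = _ - X]mxE [X in _ = _ - (_ * X)]mxE.
rewrite [X in _ = _ - (_ * (X + _))]mxE [X in _ = _ - (_ * (_ + X))]mxE.
have sR : lsub (setT : set cV) by [].
rewrite (lin_onD (dotp_linr (cc S1)) I I) (lin_onD (dotp_linr (cc S2)) I I).
rewrite Ef1 Ef0 Eg1 Eg0.
move: (form_m B (comb w d1) _) (form_m B (comb w d0) _) => m1 m0.
move: (form_a B (comb w c1) _) (form_a B (comb w c0) _) => a1 a0.
move: (Dx 1 (w i) L) (w i L) => p1 p0.
move: (dotp _ x1) (dotp _ x0) (dotp _ y1) (dotp _ y0) (c i 0) => e1 e2 e3 e4 k E.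
have h : dt * dt^-1 = 1 by rewrite divff// gt_eqF.
rewrite -mulrBr; have -> : m1 - m0 = dt * (dt^-1 * (m1 - m0)) by rewrite mulrA h mul1r.
by rewrite E /=; field.
Qed.

(** How strongly the boundary traces enter the velocity and controller equations. *)
Definition trace_cst : R := 2^-1 * (cd S1 / bJ B + cd S2 / bM B
  + pnorm (pform S1) (cb S1) / Num.sqrt (bJ B) + pnorm (pform S2) (cb S2) / Num.sqrt (bM B)).

(** The error against the projected solution. Its first two components are combinations
    of the basis, and so are admissible test functions. *)
Definition err_state c d v1 v2 (x X y Y : cV) : state r :=
  ((comb w (c - projc v1), comb w (d - projc v2)), (x - X, y - Y)).

Lemma err_state_dom c d v1 v2 x X y Y : sdom B (err_state c d v1 v2 x X y Y).
Proof. by split; exact: (comb_HT hB P0 bw). Qed.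

Lemma err_lin (l : (R -> R^o) -> R^o) c v : lin_on HT l ->
  l (comb w (c - projc v)) = l (comb w c) - l (proj v).
Proof. by move=> ll; rewrite (lin_onB (lin_comb_lin ll) I I). Qed.

(** A vector is normed by the functional that it represents. *)
Lemma pnorm_le (V : lmodType R) (D : set V) (q : V -> V -> R) x E : psd D q -> D x ->
  0 <= E -> `|q x x| <= pnorm q x * E -> pnorm q x <= E.
Proof.
move=> pq Dx E0; rewrite -(pnorm_sqr pq Dx) ger0_norm ?sqr_ge0// expr2.
have [->//|nz] := eqVneq (pnorm q x) 0.
by rewrite ler_pM2l// lt_neqAle eq_sym nz sqrtr_ge0.
Qed.

Lemma trace_bound (d J p x Es n : R) : 0 <= d -> 0 < J -> Num.sqrt J * `|p| <= Es ->
  Num.sqrt J * `|x| <= n -> 0 <= Es -> `|d * p * x| <= d / J * Es * n.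
Proof.
move=> d0 J0 hp hx E0; have sJ : 0 < Num.sqrt J by rewrite sqrtr_gt0.
have -> : `|d * p * x| = d / J * ((Num.sqrt J * `|p|) * (Num.sqrt J * `|x|)).
  rewrite !normrM (ger0_norm d0) [Num.sqrt J * _ * _]mulrACA -expr2 (sqr_sqrtr (ltW J0)).
  by field; rewrite gt_eqF.
rewrite -[leRHS]mulrA; apply: ler_wpM2l; first by rewrite divr_ge0// ltW.
by apply: ler_pM => //; apply: mulr_ge0 => //; exact: ltW.
Qed.

(** The tested scheme minus the average of the weak equation at both times: the
    trapezoidal error of the velocity, the projection error of its increment and the traces
    of the projection error remain. *)
Lemma velocity_arith (h s1 s2 md1 md0 mp1 mp0 mv1 mv0 mq1 mq0 ac1 ac0 au1 au0 D1 D0 G1 G0 V1 V0 x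
    E1 E0 Q1 Q0 W1 W0 y cx X1 X0 cy Y1 Y0 : R) :
  md1 - md0 = - h * (ac1 + ac0 + s1 * (D1 + D0) * x + s2 * (E1 + E0) * y + cx * x + cy * y) ->
  mq1 + au1 + s1 * V1 * x + s2 * W1 * y + X1 * x + Y1 * y = 0 ->
  mq0 + au0 + s1 * V0 * x + s2 * W0 * y + X0 * x + Y0 * y = 0 ->
  md1 - mp1 - (md0 - mp0) - - h * (ac1 - au1 + (ac0 - au0) + s1 * ((D1 - G1 + (D0 - G0)) * x)
    + s2 * ((E1 - Q1 + (E0 - Q0)) * y) + (cx - X1 - X0) * x + (cy - Y1 - Y0) * y)
  = (h * (mq1 + mq0) - (mv1 - mv0)) - (mp1 - mp0 - (mv1 - mv0))
    - h * (s1 * (G1 + G0 - (V1 + V0)) * x) - h * (s2 * (Q1 + Q0 - (W1 + W0)) * y).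
Proof.
move=> e1 e2 e3.
have {}e1 : md1 = md0 - h * (ac1 + ac0 + s1 * (D1 + D0) * x + s2 * (E1 + E0) * y + cx * x + cy * y).
  by rewrite -mulNr -e1 addrC subrK.
have {}e2 : mq1 = - (au1 + s1 * V1 * x + s2 * W1 * y + X1 * x + Y1 * y).
  by apply/eqP; rewrite -addr_eq0 !addrA e2.
have {}e3 : mq0 = - (au0 + s1 * V0 * x + s2 * W0 * y + X0 * x + Y0 * y).
  by apply/eqP; rewrite -addr_eq0 !addrA e3.
by rewrite e1 e2 e3; ring.
Qed.

(** The same difference for a controller, driven by the trace of the projection error. *)
Lemma controller_defect (S : controller R r) (dt t1 t0 p1 p0 v1 v0 s pe : R)
    (x1 x0 X1 X0 X1' X0' : cV) : dt != 0 ->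
  dt^-1 *: (x1 - x0) = cA S *m (2^-1 *: (x1 + x0)) + ((t1 + t0) / 2) *: cb S ->
  X0' = cA S *m X0 + v0 *: cb S -> X1' = cA S *m X1 + v1 *: cb S ->
  s = t1 - p1 + (t0 - p0) -> pe = p1 + p0 - (v1 + v0) ->
  x1 - X1 - (x0 - X0) - (dt / 2) *: (cA S *m (x1 - X1 + (x0 - X0)) + s *: cb S) =
  ((dt / 2) *: (X1' + X0') - (X1 - X0)) + (dt / 2 * pe) *: cb S.
Proof.
move=> dtn eqn -> -> -> ->.
have e : x1 = x0 + dt *: (cA S *m (2^-1 *: (x1 + x0)) + ((t1 + t0) / 2) *: cb S).
  by rewrite -eqn scalerA divff// scale1r addrC subrK.
have -> : x1 - X1 + (x0 - X0) = x1 + x0 - X1 - X0 by rewrite addrACA addrA.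
rewrite !mulmxBr; rewrite -scalemxAr in e.
move: (cb S) (_ *m (x1 + x0)) (_ *m X1) (_ *m X0) e => b y y1 y0 e.
apply/matrixP => i j; have := congr1 (fun M : cV => M i j) e; rewrite !mxE => {}e.
by rewrite e; field.
Qed.

Lemma trace_div (c x E : R) : 0 < c -> c * `|x| <= E -> `|x| <= E / c.
Proof. by move=> c0 h; rewrite ler_pdivlMr// mulrC. Qed.

(** All residuals of [energy_step] are trapezoidal errors or projection errors of the
    velocity. The stiffness form sees no projection error, by definition of the projection. *)
Lemma step_error (dt : R) c0 c1 d0 d1 (x0 x1 y0 y1 : cV)
    (u0 u1 v0 v1 q0 q1 : R -> R^o) (X0 X1 Y0 Y1 X0' X1' Y0' Y1' : cV) (Ea Em Ep Es E1 E2 : R) :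
  0 < dt ->
  dt^-1 *: (c1 - c0) = 2^-1 *: (d1 + d0) ->
  dt^-1 *: (mxA B w *m d1 - mxA B w *m d0) =
        - (2^-1 *: (mxK B w *m c1 + mxK B w *m c0))
        - 2^-1 *: (mxB B S1 S2 w *m d1 + mxB B S1 S2 w *m d0)
        - 2^-1 *: (vecC B S1 S2 w x1 y1 + vecC B S1 S2 w x0 y0) ->
  dt^-1 *: (x1 - x0) = cA S1 *m (2^-1 *: (x1 + x0))
        + ((Dx 1 (comb w d1) L + Dx 1 (comb w d0) L) / 2) *: cb S1 ->
  dt^-1 *: (y1 - y0) = cA S2 *m (2^-1 *: (y1 + y0))
        + ((comb w d1 L + comb w d0 L) / 2) *: cb S2 ->
  HT u0 -> HT u1 -> HT v0 -> HT v1 -> HT q0 -> HT q1 ->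
  let weak q v u X Y := forall y, HT y ->
    form_m B q y + form_a B u y + cd S1 * Dx 1 v L * Dx 1 y L
    + cd S2 * v L * y L + dotp (cc S1) X * Dx 1 y L + dotp (cc S2) Y * y L = 0 in
  weak q0 v0 u0 X0 Y0 -> weak q1 v1 u1 X1 Y1 ->
  X0' = cA S1 *m X0 + Dx 1 v0 L *: cb S1 -> X1' = cA S1 *m X1 + Dx 1 v1 L *: cb S1 ->
  Y0' = cA S2 *m Y0 + v0 L *: cb S2 -> Y1' = cA S2 *m Y1 + v1 L *: cb S2 ->
  (forall y, HT y -> `|dt / 2 * (form_a B v1 y + form_a B v0 y) -
     (form_a B u1 y - form_a B u0 y)| <= Ea * na y) ->
  (forall y, HT y -> `|dt / 2 * (form_m B q1 y + form_m B q0 y) -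
     (form_m B v1 y - form_m B v0 y)| <= Em * nm y) ->
  pnorm (pform S1) ((dt / 2) *: (X1' + X0') - (X1 - X0)) <= E1 ->
  pnorm (pform S2) ((dt / 2) *: (Y1' + Y0') - (Y1 - Y0)) <= E2 ->
  nm (proj (v1 - v0) - (v1 - v0)) <= Ep -> nm (proj (v1 + v0) - (v1 + v0)) <= Es ->
  0 <= Ea -> 0 <= Em ->
  pnorm (eform B S1 S2) (err_state c1 d1 u1 v1 x1 X1 y1 Y1) <=
  pnorm (eform B S1 S2) (err_state c0 d0 u0 v0 x0 X0 y0 Y0) +
    4 * (Ea + Em + Ep + E1 + E2 + dt * trace_cst * Es).
Proof.
move=> dt0 CN1 CN2 CN3 CN4 du0 du1 dv0 dv1 dq0 dq1 weak W0 W1 HX0 HX1 HY0 HY1 Ta Tm T1 T2 Tp Ts Ea0 Em0.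
have [[_ M0 J0 _ _] _ _ _ _] := hB.
have sT := HT_lsub hB; have H := comb_HT hB P0 bw; have Hp := proj_HT hB P0 bw.
have sR : lsub (setT : set cV) by [].
have dtn : dt != 0 by rewrite gt_eqF.
have h2 : 0 <= dt / 2 by rewrite divr_ge0// ltW.
have Ep0 : 0 <= Ep by apply: le_trans Tp; exact: sqrtr_ge0.
have Es0 : 0 <= Es by apply: le_trans Ts; exact: sqrtr_ge0.
have E10 : 0 <= E1 by apply: le_trans T1; exact: sqrtr_ge0.
have E20 : 0 <= E2 by apply: le_trans T2; exact: sqrtr_ge0.
have [_ [a1 a2] _ _ _] := hS1; have [_ [b1 b2] _ _ _] := hS2.
have d10 : 0 <= cd S1 := le_trans (ltW a1) a2.
have d20 : 0 <= cd S2 := le_trans (ltW b1) b2.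
have sJ : 0 < Num.sqrt (bJ B) by rewrite sqrtr_gt0.
have sM : 0 < Num.sqrt (bM B) by rewrite sqrtr_gt0.
set k1 := cd S1 / bJ B; set k2 := cd S2 / bM B.
set k3 := pnorm (pform S1) (cb S1) / Num.sqrt (bJ B).
set k4 := pnorm (pform S2) (cb S2) / Num.sqrt (bM B).
have k10 : 0 <= k1 by rewrite divr_ge0// ltW.
have k20 : 0 <= k2 by rewrite divr_ge0// ltW.
have k30 : 0 <= k3 by rewrite divr_ge0// sqrtr_ge0.
have k40 : 0 <= k4 by rewrite divr_ge0// sqrtr_ge0.
have kE : trace_cst = 2^-1 * (k1 + k2 + k3 + k4) by [].
have e0 k : 0 <= k -> 0 <= dt / 2 * k * Es.
  move=> k0; apply: mulr_ge0 => //; exact: mulr_ge0.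
have f1 := e0 _ k10; have f2 := e0 _ k20; have f3 := e0 _ k30; have f4 := e0 _ k40.
have RE : dt * trace_cst * Es = dt / 2 * k1 * Es + dt / 2 * k2 * Es + dt / 2 * k3 * Es + dt / 2 * k4 * Es.
  by rewrite kE; field.
set Rn := Ea + Em + Ep + E1 + E2 + _.
have Rn0 : 0 <= Rn.
  rewrite /Rn RE; clear -Ea0 Em0 Ep0 E10 E20 f1 f2 f3 f4; lra.
set z1 := err_state c1 _ _ _ _ _ _ _; set z0 := err_state c0 _ _ _ _ _ _ _.
have d1' : sdom B z1 := err_state_dom _ _ _ _ _ _ _ _.
have d0' : sdom B z0 := err_state_dom _ _ _ _ _ _ _ _.
have [ds1 ds2] := lsubD (sdom_lsub hB r) d1' d0'.
pose ci := (c1 - projc u1) + (c0 - projc u0); pose di := (d1 - projc v1) + (d0 - projc v0).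
have c1E : (z1 + z0).1.1 = comb w ci :> (R -> R^o) by rewrite combD.
have d1E : (z1 + z0).1.2 = comb w di :> (R -> R^o) by rewrite combD.
have t1 := Dx1_lin hB (L_itv hB); have t0 := @eval_lin R B L.
pose pe := (proj (v1 + v0) - (v1 + v0) : R -> R^o).
have dpe : HT pe := lsubB sT (Hp _) (lsubD sT dv1 dv0).
have pl (l : (R -> R^o) -> R^o) : lin_on HT l -> l pe = l (proj v1) + l (proj v0) - (l v1 + l v0).
  move=> ll; rewrite /pe (lin_onB ll (Hp _) (lsubD sT dv1 dv0)) (lin_onD ll dv1 dv0).
  by rewrite (lin_onD (proj_lin hB P0 bw) dv1 dv0) (lin_onD ll (Hp _) (Hp _)).
have se (l : (R -> R^o) -> R^o) (c c' : 'cV[R]_N) v v' : lin_on HT l ->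
    l ((comb w (c - projc v) : R -> R^o) + comb w (c' - projc v')) =
    l (comb w c) - l (proj v) + (l (comb w c') - l (proj v')).
  by move=> ll; rewrite (lin_onD ll (H _) (H _)) !(err_lin _ _ ll).
have de (l : (R -> R^o) -> R^o) (c c' : 'cV[R]_N) v v' : lin_on HT l ->
    l ((comb w (c - projc v) : R -> R^o) - comb w (c' - projc v')) =
    l (comb w c) - l (proj v) - (l (comb w c') - l (proj v')).
  by move=> ll; rewrite (lin_onB ll (H _) (H _)) !(err_lin _ _ ll).
have RnE : Ea <= Rn /\ Em + Ep + dt / 2 * k1 * Es + dt / 2 * k2 * Es <= Rn /\
    E1 + dt / 2 * k3 * Es <= Rn /\ E2 + dt / 2 * k4 * Es <= Rn.
  rewrite /Rn RE; clear -Ea0 Em0 Ep0 E10 E20 f1 f2 f3 f4; do !split; lra.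
(* The residuals are what the first four hypotheses of [energy_step] require them to
   be; the work is in their bounds. *)
have AB (V : zmodType) (x m : V) : x = m + (x - m) by rewrite addrCA subrr addr0.
apply: (@energy_step R B hB r S1 S2 hS1 hS2 dt Rn z0 z1
  (form_a B (z1.1.1 - z0.1.1) (z1 + z0).1.1 - dt / 2 * form_a B (z1 + z0).1.2 (z1 + z0).1.1)
  (form_m B (z1.1.2 - z0.1.2) (z1 + z0).1.2 - (- (dt / 2) * (form_a B (z1 + z0).1.1 (z1 + z0).1.2 +
     cd S1 * Dx 1 (z1 + z0).1.2 L ^+ 2 + cd S2 * (z1 + z0).1.2 L ^+ 2
     + dotp (cc S1) (z1 + z0).2.1 * Dx 1 (z1 + z0).1.2 L
     + dotp (cc S2) (z1 + z0).2.2 * (z1 + z0).1.2 L)))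
  (z1.2.1 - z0.2.1 - (dt / 2) *: (cA S1 *m (z1 + z0).2.1 + Dx 1 (z1 + z0).1.2 L *: cb S1))
  (z1.2.2 - z0.2.2 - (dt / 2) *: (cA S2 *m (z1 + z0).2.2 + (z1 + z0).1.2 L *: cb S2))
  (ltW dt0) Rn0 d0' d1').
- exact: AB.
- exact: AB.
- exact: AB.
- exact: AB.
- have la := psd_linl (form_a_psd hB) ds1.
  have -> : form_a B (z1.1.1 - z0.1.1) (z1 + z0).1.1 - dt / 2 * form_a B (z1 + z0).1.2 (z1 + z0).1.1
     = dt / 2 * (form_a B v1 (z1 + z0).1.1 + form_a B v0 (z1 + z0).1.1) -
       (form_a B u1 (z1 + z0).1.1 - form_a B u0 (z1 + z0).1.1).
    rewrite (de _ c1 c0 u1 u0 la) (se _ d1 d0 v1 v0 la).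
    have pr v : HT v -> form_a B (proj v) (z1 + z0).1.1 = form_a B v (z1 + z0).1.1.
      by move=> dv; rewrite c1E (proj_comb hB P0 bw).
    rewrite !pr//.
    have cn : c1 - c0 = (dt / 2) *: (d1 + d0).
      by rewrite -scalerA -CN1 scalerA divff// scale1r.
    have := congr1 (fun c => form_a B (comb w c) (z1 + z0).1.1 : R^o) cn.
    rewrite (lin_onB (lin_comb_lin la) I I) (lin_onZ (_ : lsub setT) (lin_comb_lin la) _ I)//.
    rewrite (lin_onD (lin_comb_lin la) I I) /GRing.scale/=.
    move: (form_a B (comb w c1) _) (form_a B (comb w c0) _) => A1 A0 E.
    have -> : A1 = A0 + (A1 - A0) by rewrite addrC subrK.
    by rewrite E; ring.
  apply: le_trans (Ta _ ds1) _; apply: ler_wpM2r; first exact: sqrtr_ge0.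
  by case: RnE.
- have CN := scheme_test dt0 CN2 di.
  set X := (z1 + z0).1.2 in ds2 d1E *; rewrite -d1E in CN.
  have lm := psd_linl (form_m_psd hB) ds2; have la := psd_linl (form_a_psd hB) ds2.
  pose pd := (proj (v1 - v0) - (v1 - v0) : R -> R^o).
  have dpd : HT pd := lsubB sT (Hp _) (lsubB sT dv1 dv0).
  have pdE : form_m B pd X = form_m B (proj v1) X - form_m B (proj v0) X
      - (form_m B v1 X - form_m B v0 X).
    rewrite /pd (lin_onB lm (Hp _) (lsubB sT dv1 dv0)) (lin_onB lm dv1 dv0).
    by rewrite (lin_onB (proj_lin hB P0 bw) dv1 dv0) (lin_onB lm (Hp _) (Hp _)).
  have pr v : HT v -> form_a B (proj v) X = form_a B v X.
    by move=> dv; rewrite d1E (proj_comb hB P0 bw).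
  have alE : Dx 1 X L = _ := se _ d1 d0 v1 v0 t1.
  have beE : X L = _ := se _ d1 d0 v1 v0 t0.
  have xE : dotp (cc S1) (z1 + z0).2.1 = dotp (cc S1) (x1 + x0) - dotp (cc S1) X1 - dotp (cc S1) X0.
    have -> : (z1 + z0).2.1 = (x1 + x0) - X1 - X0 by rewrite /= addrACA addrA.
    by rewrite !(lin_onB (dotp_linr (cc S1)) I I).
  have yE : dotp (cc S2) (z1 + z0).2.2 = dotp (cc S2) (y1 + y0) - dotp (cc S2) Y1 - dotp (cc S2) Y0.
    have -> : (z1 + z0).2.2 = (y1 + y0) - Y1 - Y0 by rewrite /= addrACA addrA.
    by rewrite !(lin_onB (dotp_linr (cc S2)) I I).
  have pe1 := pl _ t1; have pe0 := pl _ t0; cbv beta in pe1, pe0.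
  have w1 := W1 X ds2; have w0 := W0 X ds2.
  have := Tm X ds2.
  have bpd : `|form_m B pd X| <= Ep * nm X.
    apply: le_trans (psd_CSn sT (form_m_psd hB) dpd ds2) _.
    by apply: ler_wpM2r Tp; exact: sqrtr_ge0.
  have [n1 n2] := (nm_tr1 hB ds2, nm_tr0 hB ds2).
  have [m1 m2] := (le_trans (nm_tr1 hB dpe) Ts, le_trans (nm_tr0 hB dpe) Ts).
  have b1' := trace_bound d10 J0 m1 n1 Es0; have b2' := trace_bound d20 M0 m2 n2 Es0.
  rewrite -/k1 in b1'; rewrite -/k2 in b2'.
  rewrite (de _ d1 d0 v1 v0 lm) (se _ c1 c0 u1 u0 la) !pr// xE yE.
  have al2 : Dx 1 X L ^+ 2 = (Dx 1 (comb w d1) L - Dx 1 (proj v1) L +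
    (Dx 1 (comb w d0) L - Dx 1 (proj v0) L)) * Dx 1 X L by rewrite expr2 {1}alE.
  have be2 : X L ^+ 2 = (comb w d1 L - proj v1 L + (comb w d0 L - proj v0 L)) * X L.
    by rewrite expr2 {1}beE.
  rewrite al2 be2 (velocity_arith _ _ (form_m B v1 X) (form_m B v0 X) _ _ _ _ CN w1 w0).
  rewrite -pdE -pe1 -pe0 => bT.
  apply: le_trans (ler_normB _ _) _; apply: le_trans (lerD (ler_normB _ _) _) _.
    exact: lexx.
  apply: le_trans (lerD (lerD (ler_normB _ _) (lexx _)) (lexx _)) _.
  have s1 : `|dt / 2 * (cd S1 * Dx 1 pe L * Dx 1 X L)| <= dt / 2 * k1 * Es * nm X.
    rewrite normrM (ger0_norm h2) -2![leRHS]mulrA; apply: ler_wpM2l => //.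
    by rewrite mulrA.
  have s2 : `|dt / 2 * (cd S2 * pe L * X L)| <= dt / 2 * k2 * Es * nm X.
    rewrite normrM (ger0_norm h2) -2![leRHS]mulrA; apply: ler_wpM2l => //.
    by rewrite mulrA.
  apply: le_trans (lerD (lerD (lerD bT bpd) s1) s2) _; rewrite -!mulrDl.
  by apply: ler_wpM2r; [exact: sqrtr_ge0|case: RnE => _ []].
- have g3 := controller_defect dtn CN3 HX0 HX1 (se _ d1 d0 v1 v0 t1) (pl _ t1).
  rewrite [_ - _]g3.
  apply: le_trans (pnorm_tri sR (pform_psd hS1) I I) _.
  rewrite (pnormZ sR (pform_psd hS1) _ I) normrM (ger0_norm h2).
  have m1 := le_trans (nm_tr1 hB dpe) Ts.
  apply: le_trans (lerD T1 (ler_wpM2r _ (ler_wpM2l h2 (trace_div sJ m1)))) _.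
    exact: sqrtr_ge0.
  have -> : dt / 2 * (Es / Num.sqrt (bJ B)) * pnorm (pform S1) (cb S1) = dt / 2 * k3 * Es.
    by rewrite /k3; field; rewrite gt_eqF.
  by case: RnE => _ [_ []].
- have g4 := controller_defect dtn CN4 HY0 HY1 (se _ d1 d0 v1 v0 t0) (pl _ t0).
  rewrite [_ - _]g4.
  apply: le_trans (pnorm_tri sR (pform_psd hS2) I I) _.
  rewrite (pnormZ sR (pform_psd hS2) _ I) normrM (ger0_norm h2).
  have m0 := le_trans (nm_tr0 hB dpe) Ts.
  apply: le_trans (lerD T2 (ler_wpM2r _ (ler_wpM2l h2 (trace_div sM m0)))) _.
    exact: sqrtr_ge0.
  have -> : dt / 2 * (Es / Num.sqrt (bM B)) * pnorm (pform S2) (cb S2) = dt / 2 * k4 * Es.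
    by rewrite /k4; field; rewrite gt_eqF.
  by case: RnE => _ [_ []].
Qed.

End one_step.

(** * Norms of functions of time *)

Section time_estimates.
Context {R : realType}.
Local Notation leb := (@lebesgue_measure R).
Local Notation rT := (measurableTypeR R).

Section space.
Variables (X : nspace R) (q : X -> X -> R).
Hypotheses (sX : lsub (dom X)) (hX : hilb q).
Implicit Types (a b s t : R) (f g : R -> X).

(** The functional enters the scalar estimate only through its bound. *)
Lemma trap_dual (l : X -> R) K a b f0 f1 f2 f3 s t : dual X l ->
  (forall x, dom X x -> `|l x| <= K * nrm x) ->
  weak_deriv a b f0 f1 -> weak_deriv a b f1 f2 -> weak_deriv a b f2 f3 ->
  cont a b f0 -> cont a b f1 -> cont a b f2 -> a <= s -> s <= t -> t <= b ->
  `|(t - s) / 2 * (l (f1 t) + l (f1 s)) - (l (f0 t) - l (f0 s))| <=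
  3 / 2 * (t - s) ^+ 2 * (K * \int[leb]_(x in `]s, t[%classic) nrm (f3 x)).
Proof.
move=> dl lK w0 w1 w2 c0 c1 c2 as_ st tb.
apply: le_trans (trapezoid (sweak_dual sX dl w0) (sweak_dual sX dl w1) (sweak_dual sX dl w2)
  (cont_dual sX dl c0) (cont_dual sX dl c1) (cont_dual sX dl c2) as_ st tb) _.
apply: ler_wpM2l; first by rewrite mulr_ge0 ?sqr_ge0// divr_ge0.
by case: w2 => _ bf _; exact: (int_dual_le sX hX dl lK bf as_ tb).
Qed.

Lemma RI_nrm_ge0 a b s t f : a <= s -> t <= b -> bochner_L2 X a b f ->
  {ae leb, forall x, `]s, t[%classic x -> 0 <= nrm (f x)}.
Proof.
move=> as_ tb [df _ _]; apply: aeS df => x df Dx; apply: (nrm_ge0 hX); apply: df.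
exact: (subset_oo as_ tb).
Qed.

(** Tested with the increment itself, so that only scalar integrals occur. *)
Lemma nrm_increment a b f g s t : weak_deriv a b f g -> cont a b f ->
  a <= s -> s <= t -> t <= b ->
  nrm (f t - f s) <= \int[leb]_(x in `]s, t[%classic) nrm (g x).
Proof.
move=> fg cf as_ st tb; have [bf bg _] := fg; have [p e] := hX.
have dt : dom X (f t) by have [] := cf t; rewrite /= ?in_itv/= ?(le_trans as_ st) ?tb.
have ds : dom X (f s) by have [] := cf s; rewrite /= ?in_itv/= ?as_ ?(le_trans st tb).
have dd := lsubB sX dt ds; rewrite (nrm_pnorm hX dd).
have dl := hilb_dual sX hX dd.
set y := f t - f s in dd dl *.
have i0 : 0 <= \int[leb]_(x in `]s, t[%classic) nrm (g x).
  by apply: RI_ge0; exact: RI_nrm_ge0 bg.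
have [->//|nz] := eqVneq (pnorm q y) 0.
have np : 0 < pnorm q y by rewrite lt_neqAle eq_sym nz sqrtr_ge0.
rewrite -(ler_pM2l np) -expr2 (pnorm_sqr p dd) {1}/y (lin_onB (psd_linl p dd) dt ds).
rewrite (sweak_ftc (sweak_dual sX dl fg) (cont_dual sX dl cf) as_ st tb).
have Lg : L2 `]s, t[%classic (fun x => q (g x) y) := L2_sub as_ tb (dual_L2 sX dl bg).
apply: le_trans (ler_norm _) _; apply: le_trans (RI_abs (mitv _) (L2_I1oo Lg)) _.
apply: (int_dual_le sX hX dl _ bg as_ tb) => x dx; rewrite mulrC (nrm_pnorm hX dx).
exact: (psd_CSn sX p dx dd).
Qed.

Lemma sobolev_term a b m f j : (j <= m)%N ->
  Num.sqrt (\int[leb]_(t in `]a, b[%classic) (nrm (wdiffn X a b j f t) ^+ 2)) <=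
  sobolev_norm X a b m f.
Proof.
move=> jm; apply: ler_wsqrtr.
have j' : (j < m.+1)%N by [].
rewrite (bigD1 (Ordinal j'))//= lerDl; apply: sumr_ge0 => i _.
by apply: RI_ge0; apply: aeW => x _; exact: sqr_ge0.
Qed.

Lemma nrm_int_sobolev a b m f j : a <= b -> (j <= m)%N -> sobolev X a b m f ->
  \int[leb]_(t in `]a, b[%classic) nrm (wdiffn X a b j f t) <=
  Num.sqrt (b - a) * sobolev_norm X a b m f.
Proof.
move=> ab jm [hs _]; apply: le_trans (nrm_int sX hX ab (hs j jm)) _.
by apply: ler_wpM2l; [exact: sqrtr_ge0|exact: sobolev_term].
Qed.

(** The time steps tile the interval up to [n dt], and norms are nonnegative beyond it. *)
Lemma sum_int T dt n f : 0 <= dt -> n%:R * dt <= T -> bochner_L2 X 0 T f ->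
  \sum_(k < n) \int[leb]_(t in `]k%:R * dt, k.+1%:R * dt[%classic) nrm (f t) <=
  \int[leb]_(t in `]0, T[%classic) nrm (f t).
Proof.
move=> dt0 nT bf; have LT := L2_I1oo (nrm_L2 sX hX bf).
have n0 k : 0 <= k%:R * dt by rewrite mulr_ge0.
have E m : (m <= n)%N -> \sum_(k < m) \int[leb]_(t in `]k%:R * dt, k.+1%:R * dt[%classic) nrm (f t) =
    \int[leb]_(t in `]0, m%:R * dt[%classic) nrm (f t).
  elim: m => [_|m IH mn]; first by rewrite big_ord0 mul0r RI_oo_ge.
  have mT : m.+1%:R * dt <= T by apply: le_trans nT; rewrite ler_wpM2r// ler_nat.
  rewrite big_ord_recr/= (IH (ltnW mn)) (@RI_split _ 0 (m%:R * dt) (m.+1%:R * dt))//.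
    by rewrite n0 ler_wpM2r// ler_nat.
  exact: (I1_sub (lexx _) mT LT).
rewrite (E n (leqnn n)) (@RI_split _ 0 (n%:R * dt) T) ?n0 ?nT// lerDl.
by apply: RI_ge0; exact: (RI_nrm_ge0 (n0 n) (lexx _) bf).
Qed.

End space.

Lemma shift_sobolev (X : nspace R) (a b : R) m n (f : R -> X) :
  sobolev X a b (m + n) f -> sobolev X a b m (wdiffn X a b n f).
Proof.
have E j : wdiffn X a b j (wdiffn X a b n f) = wdiffn X a b (j + n) f.
  by rewrite /wdiffn iterD.
move=> [h1 h2]; split=> j jm; rewrite !E; first by apply: h1; rewrite leq_add2r.
by apply: h2; rewrite ltn_add2r.
Qed.

(** The weak derivatives selected in [Ht] and in [Hk] may be different representatives,
    but they have equal norms; the rest is the Cauchy-Schwarz inequality in time. *)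
Lemma Ht_int_le (L T : R) k m j (f : R -> Ht L k) : 0 < L -> 0 < T -> (1 < k)%N -> (j <= m)%N ->
  sobolev (Ht L k) 0 T m f ->
  \int[leb]_(t in `]0, T[%classic) nrm (wdiffn (Ht L k) 0 T j f t) <=
  Num.sqrt T * sobolev_norm (Hk L k) 0 T m (f : R -> Hk L k).
Proof.
move=> L0 T0 k1 jm hf; have [hs _] := hf.
have sT := Ht_lsub L0 k1; have hT := Ht_hilb L0 k.
have sK := Hk_lsub L0 k; have hK := Hk_hilb L0 k.
apply: le_trans (nrm_int sT hT (ltW T0) (hs j jm)) _; rewrite subr0.
apply: ler_wpM2l; first exact: sqrtr_ge0.
have st := @sobolev_term (Hk L k) 0 T m f j jm.
apply: le_trans st.
have [nq _] := sobolev_push sT sK hT hK (@Ht_Hk_bop R L k) (Hk_sep L0 (ltnW k1)) T0 hf jm.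
apply: ler_wsqrtr; rewrite le_eqVlt; apply/orP; left; apply/eqP; apply: RI_aeq.
apply: aeS nq => t nq Dt; have [d1 d2 n0] := nq Dt.
have := nrm_lip sK hK d1 d2; rewrite n0 normr_le0 subr_eq0 => /eqP e.
exact: (congr1 (fun x : R => x ^+ 2) e).
Qed.

End time_estimates.

(** * Estimates for the exact solution *)

Section solution_estimates.
Context {R : realType}.
Local Notation leb := (@lebesgue_measure R).
Local Notation rT := (measurableTypeR R).
Variable B : beam R.
Hypothesis hB : beam_ok B.
Local Notation L := (bL B).
Local Notation L0 := (bL_gt0 hB).
Local Notation Dx := (Dx L).
Local Notation X2 := (Ht L 2).
Local Notation X4 := (Ht L 4).
Local Notation HT := (dom X2).
Local Notation na := (pnorm (form_a B)).
Local Notation nm := (pnorm (form_m B)).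

Lemma na_le_nrm : exists2 c, 0 <= c & forall v, HT v -> na v <= c * nrm (v : X2).
Proof.
have [c c0 h] := na_upper hB; exists c => // v dv; apply: le_trans (h v dv) _.
apply: (ler_wpM2l c0); exact: (en_nrm L0 (isT : (1 < 2)%N) dv).
Qed.

Lemma nm_le_nrm : exists2 c, 0 <= c & forall v, HT v -> nm v <= c * nrm (v : X2).
Proof.
have [c c0 h] := nm_upper hB; exists c => // v dv; apply: le_trans (h v dv) _.
apply: (ler_wpM2l c0); exact: (en_nrm L0 (isT : (1 < 2)%N) dv).
Qed.

Lemma Ht4_HT v : dom X4 v -> HT v.
Proof. by case: (@Ht_bop R L L0 4 2 isT) => h _ _; exact: h. Qed.

(** The estimate in [na] also controls [nm], both being compared with [en]. *)
Lemma proj_err_norms : exists2 c, 0 <= c &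
  forall P N (w : 'I_N -> R -> R), (0 < P)%N -> is_basis B P w ->
  forall v, dom X4 v ->
    na (proj B w v - v) <= c * (L / P%:R) ^+ 2 * nrm (v : X4) /\
    nm (proj B w v - v) <= c * (L / P%:R) ^+ 2 * nrm (v : X4).
Proof.
have [c1 c10 h1] := na_upper hB; have [c2 c20 h2] := nm_upper hB.
have [c3 c30 h3] := na_lower hB.
exists (c1 + c2 * c3 * c1); first by apply: addr_ge0 => //; apply: mulr_ge0 => //; exact: mulr_ge0.
move=> P N w P0 bw v dv.
have e := proj_err hB P0 bw h1 c10 dv; have dv2 := Ht4_HT dv.
have dp : HT (proj B w v - v) := lsubB (HT_lsub hB) (proj_HT hB P0 bw v) dv2.
have n0 : 0 <= nrm (v : X4) := nrm_ge0 (Ht_hilb L0 4) dv.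
set a := (L / P%:R) ^+ 2 in e *; have a0 : 0 <= a := sqr_ge0 _.
have an0 : 0 <= a * nrm (v : X4) := mulr_ge0 a0 n0.
rewrite -mulrA in e; split; rewrite -[leRHS]mulrA mulrDl.
  apply: le_trans e _; rewrite lerDl; apply: mulr_ge0 => //.
  by apply: mulr_ge0 => //; exact: mulr_ge0.
apply: le_trans (h2 _ dp) _; apply: le_trans (ler_wpM2l c20 (h3 _ dp)) _.
apply: le_trans (ler_wpM2l c20 (ler_wpM2l c30 e)) _.
rewrite -[leLHS]add0r; apply: lerD; first exact: (mulr_ge0 c10 an0).
by rewrite le_eqVlt; apply/orP; left; apply/eqP; ring.
Qed.

Section solution.
Variables (r : nat) (S1 S2 : controller R r) (T : R) (hT : 0 < T).
Variables (u : R -> R -> R) (z1 z2 : R -> 'cV[R]_r).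
Hypothesis hu4 : sobolev X4 0 T 2 u.
Hypothesis hu2 : sobolev X2 0 T 4 u.
Local Notation U j := (wdiffn X2 0 T j u).
Local Notation V j := (wdiffn X4 0 T j u).
Local Notation Zd j z := (wdiffn (euclid r) 0 T j z).
Local Notation int2 j s t := (\int[leb]_(x in `]s, t[%classic) nrm (U j x)).
Local Notation int4 j s t := (\int[leb]_(x in `]s, t[%classic) nrm (V j x)).
Local Notation s4 := (Ht_lsub L0 (isT : (1 < 4)%N)).
Local Notation h4 := (Ht_hilb L0 4).
Local Notation h2 := (Ht_hilb L0 2).

Lemma V_dom j t : (j < 2)%N -> 0 <= t <= T -> dom X4 (V j t).
Proof. by move=> j2 tT; have [_ h] := hu4; have [/(_ t)[]] := h j j2; rewrite /= ?in_itv. Qed.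

(** The assumptions give a velocity with values in H^4 and one with values in H^2. Both
    are continuous in H^2 and agree almost everywhere. *)
Lemma V_U t : 0 <= t <= T -> [/\ HT (V 1 t), HT (U 1 t) & nrm (V 1 t - U 1 t : X2) = 0].
Proof.
move=> tT; have bo := @Ht_bop R L L0 4 2 isT.
have sp := Ht_sep L0 (isT : (0 < 2)%N).
have [nq h] := sobolev_push s4 (HT_lsub hB) h4 h2 bo sp hT hu4 (isT : (1 <= 2)%N).
have [cU _] := h isT; have [_ h'] := hu4; have [cV _] := h' 1%N isT.
have cV' : @cont R X2 0 T (V 1) := bop_cont s4 (HT_lsub hB) h2 bo cV.
have nq' : @ae_same R X2 0 T (V 1) (U 1) := nq.
exact: (cont_same (HT_lsub hB) sp hT cV' cU nq' tT).
Qed.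

Lemma V_U_dual l t : dual X2 l -> 0 <= t <= T -> l (V 1 t) = l (U 1 t).
Proof. by move=> dl /V_U[d1 d2 n0]; exact: (dual_comp_sub (HT_lsub hB) dl d1 d2 n0). Qed.

Lemma form_trap (q : (R -> R^o) -> (R -> R^o) -> R) c j s t y : psd HT q ->
  (forall v, HT v -> pnorm q v <= c * nrm (v : X2)) -> dual X2 (fun v => q v y) -> HT y ->
  (j < 2)%N -> 0 <= s -> s <= t -> t <= T ->
  `|(t - s) / 2 * (q (U j.+1 t) y + q (U j.+1 s) y) - (q (U j t) y - q (U j s) y)| <=
  3 / 2 * (t - s) ^+ 2 * c * int2 j.+3 s t * pnorm q y.
Proof.
move=> pq qc dl dy j2 s0 st tT.
have lK x : HT x -> `|q x y| <= c * pnorm q y * nrm (x : X2).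
  move=> dx; apply: le_trans (psd_CSn (HT_lsub hB) pq dx dy) _.
  by rewrite mulrAC; apply: ler_wpM2r; [exact: sqrtr_ge0|exact: qc].
have j0 : (j < 4)%N by apply: leq_trans j2 _.
have j1 : (j.+1 < 4)%N by apply: leq_trans (_ : (j.+1 < 3)%N) _.
have := trap_dual (HT_lsub hB) h2 dl lK (U_weak hu2 j0) (U_weak hu2 j1)
  (U_weak hu2 (_ : (j.+2 < 4)%N)) (U_cont hu2 j0) (U_cont hu2 j1) (U_cont hu2 (_ : (j.+2 < 4)%N)) s0 st tT.
move=> /(_ j2 j2) h; apply: le_trans h _.
by rewrite le_eqVlt; apply/orP; left; apply/eqP; ring.
Qed.

(** The defect is tested with itself. *)
Lemma control_trap (S : controller R r) c z s t : controller_ok S -> sobolev (euclid r) 0 T 3 z ->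
  0 <= c -> (forall x, pnorm (pform S) x <= c * Num.sqrt (dotp x x)) ->
  0 <= s -> s <= t -> t <= T ->
  pnorm (pform S) (((t - s) / 2) *: (Zd 1 z t + Zd 1 z s) - (z t - z s)) <=
  3 / 2 * (t - s) ^+ 2 * c * \int[leb]_(x in `]s, t[%classic) nrm (Zd 3 z x).
Proof.
move=> hS [_ hz] c0 hc s0 st tT.
have sE := @euclid_lsub R r; have hE := @euclid_hilb R r.
have pp := pform_psd hS.
set g := _ - _.
have lg := psd_linl pp (I : setT g).
have lK (x : euclid r) : dom (euclid r) x -> `|pform S x g| <= c * pnorm (pform S) g * nrm x.
  move=> _; apply: le_trans (psd_CSn sE pp I I) _.
  by rewrite mulrAC; apply: ler_wpM2r; [exact: sqrtr_ge0|exact: hc].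
have dl : dual (euclid r) (fun x => pform S x g).
  split; first exact: lg.
  by exists (c * pnorm (pform S) g); exact: lK.
have [c0' w0] := hz 0%N isT; have [c1 w1] := hz 1%N isT; have [c2 w2] := hz 2%N isT.
have h := trap_dual sE hE dl lK w0 w1 w2 c0' c1 c2 s0 st tT.
have i0 : 0 <= \int[leb]_(x in `]s, t[%classic) nrm (Zd 3 z x).
  by case: w2 => _ bf _; apply: RI_ge0; exact: (RI_nrm_ge0 hE s0 tT bf).
have q0 : 0 <= 3 / 2 * (t - s) ^+ 2 by rewrite mulr_ge0 ?sqr_ge0// divr_ge0.
apply: (pnorm_le pp I); first by apply: mulr_ge0 => //; exact: mulr_ge0.
have -> : pform S g g = (t - s) / 2 * (pform S (Zd 1 z t) g + pform S (Zd 1 z s) g)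
    - (pform S (Zd 0 z t) g - pform S (Zd 0 z s) g).
  rewrite {1}/g (lin_onB lg I I) (lin_onZ sE lg _ I) (lin_onD lg I I) (lin_onB lg I I).
  by [].
apply: le_trans h _.
by rewrite le_eqVlt; apply/orP; left; apply/eqP; ring.
Qed.

(** Values at a given time are bounded at the cost of one more time derivative. *)
Lemma V_sup j t : (j < 2)%N -> 0 <= t <= T ->
  nrm (V j t) <= (T^-1 + 1) * Num.sqrt T * sobolev_norm (Hk L 4) 0 T 2 u.
Proof.
move=> j2 tT; have [_ h] := hu4; have [cV wV] := h j j2.
have := hilb_sup s4 h4 hT wV cV tT; rewrite subr0 => e; apply: le_trans e _.
have i1 := Ht_int_le L0 hT (isT : (1 < 4)%N) (ltnW j2) hu4.
have i2 := Ht_int_le L0 hT (isT : (1 < 4)%N) j2 hu4.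
have T1 : 0 <= T^-1 by rewrite invr_ge0; exact: ltW hT.
rewrite -mulrA mulrDl mul1r; exact: (lerD (ler_wpM2l T1 i1) i2).
Qed.

Lemma V_incr s t : 0 <= s -> s <= t -> t <= T -> nrm (V 1 t - V 1 s) <= int4 2 s t.
Proof.
move=> s0 st tT; have [_ h] := hu4; have [cV wV] := h 1%N isT.
exact: (nrm_increment s4 h4 wV cV s0 st tT).
Qed.

End solution.
End solution_estimates.

(** * The recursion for the error *)

Section convergence.
Context {R : realType}.
Local Notation leb := (@lebesgue_measure R).
Local Notation rT := (measurableTypeR R).
Variable B : beam R.
Hypothesis hB : beam_ok B.
Local Notation L := (bL B).
Local Notation L0 := (bL_gt0 hB).
Local Notation Dx := (Dx L).
Local Notation X2 := (Ht L 2).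
Local Notation X4 := (Ht L 4).
Local Notation HT := (dom X2).
Local Notation na := (pnorm (form_a B)).
Local Notation nm := (pnorm (form_m B)).
Variables (r : nat) (S1 S2 : controller R r).
Hypotheses (hS1 : controller_ok S1) (hS2 : controller_ok S2).
Variable (T : R).
Hypothesis hT : 0 < T.
Local Notation nz := (pnorm (eform B S1 S2)).
Local Notation sT := (HT_lsub hB).
Local Notation s4 := (Ht_lsub L0 (isT : (1 < 4)%N)).
Local Notation h4 := (Ht_hilb L0 4).
Local Notation h2 := (Ht_hilb L0 2).

Lemma trace_cst_ge0 : 0 <= trace_cst B S1 S2.
Proof.
have [[_ M0 J0 _ _] _ _ _ _] := hB.
have [_ [a1 a2] _ _ _] := hS1; have [_ [b1 b2] _ _ _] := hS2.
have d1 := le_trans (ltW a1) a2; have d2 := le_trans (ltW b1) b2.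
rewrite /trace_cst; apply: mulr_ge0; first by rewrite invr_ge0.
apply: addr_ge0; last by apply: divr_ge0; exact: sqrtr_ge0.
apply: addr_ge0; last by apply: divr_ge0; exact: sqrtr_ge0.
by apply: addr_ge0; apply: divr_ge0 => //; exact: ltW.
Qed.

Lemma recursion_sum (e : nat -> R) (d : nat -> R) S : (forall k, (k < S)%N -> e k.+1 <= e k + d k) ->
  forall n, (n <= S)%N -> e n <= e 0%N + \sum_(k < n) d k.
Proof.
move=> h; elim=> [|n IH] nS; first by rewrite big_ord0 addr0.
rewrite big_ord_recr/= addrA; apply: le_trans (h n nS) _; rewrite lerD2r.
by apply: IH; exact: ltnW.
Qed.

(** For arbitrary sequences, so that the weights can be taken out of the sums. *)
Lemma weighted_recursion (e I1 I2 I3 I4 I5 : nat -> R) S a1 a2 a3 a4 a5 d b1 b2 b3 b4 b5 n :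
  (forall k, (k < S)%N ->
    e k.+1 <= e k + 4 * (a1 * I1 k + a2 * I2 k + a3 * I3 k + a4 * I4 k + a5 * I5 k + d)) ->
  (n <= S)%N -> 0 <= a1 -> 0 <= a2 -> 0 <= a3 -> 0 <= a4 -> 0 <= a5 ->
  \sum_(k < n) I1 k <= b1 -> \sum_(k < n) I2 k <= b2 -> \sum_(k < n) I3 k <= b3 ->
  \sum_(k < n) I4 k <= b4 -> \sum_(k < n) I5 k <= b5 ->
  e n <= e 0%N + 4 * (a1 * b1 + a2 * b2 + a3 * b3 + a4 * b4 + a5 * b5 + n%:R * d).
Proof.
move=> he nS p1 p2 p3 p4 p5 h1 h2' h3 h4' h5.
apply: le_trans (recursion_sum he nS) _; rewrite lerD2l.
rewrite -mulr_sumr !big_split/= -!mulr_sumr sumr_const card_ord ler_pM2l//.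
by rewrite -[d *+ n]mulr_natl lerD2r !lerD ?ler_wpM2l.
Qed.

Lemma final_arith (ca cm c1 c2 s k H D2 D3 D4 : R) :
  0 <= ca -> 0 <= cm -> 0 <= c1 -> 0 <= c2 -> 0 <= s -> 0 <= k ->
  0 <= H -> 0 <= D2 -> 0 <= D3 -> 0 <= D4 ->
  4 * (3 / 2 * ca * s * D2 + 3 / 2 * cm * s * D2 + k * H + 3 / 2 * c1 * s * D3 + 3 / 2 * c2 * s * D4)
  <= 4 * (3 / 2 * (ca + cm + c1 + c2) * s + k) * (H + (D2 + D3 + D4)).
Proof.
move=> ? ? ? ? ? ? ? ? ? ?; rewrite -subr_ge0.
have -> : 4 * (3 / 2 * (ca + cm + c1 + c2) * s + k) * (H + (D2 + D3 + D4)) -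
  4 * (3 / 2 * ca * s * D2 + 3 / 2 * cm * s * D2 + k * H + 3 / 2 * c1 * s * D3 + 3 / 2 * c2 * s * D4)
  = 6 * s * ((ca + cm) * (H + D3 + D4) + c1 * (H + D2 + D4) + c2 * (H + D2 + D3))
    + 4 * k * (D2 + D3 + D4) by field.
by rewrite !(addr_ge0, mulr_ge0).
Qed.

Lemma error_arith (ca cm c1 c2 c s T' tc n4 n2 nz1 nz2 d h : R) n :
  0 <= ca -> 0 <= cm -> 0 <= c1 -> 0 <= c2 -> 0 <= c -> 0 <= s -> 0 < T' -> 0 <= tc ->
  0 <= n4 -> 0 <= n2 -> 0 <= nz1 -> 0 <= nz2 -> n%:R * d <= T' ->
  4 * (3 / 2 * d ^+ 2 * ca * (s * n2) + 3 / 2 * d ^+ 2 * cm * (s * n2) + c * h ^+ 2 * (s * n4)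
    + 3 / 2 * d ^+ 2 * c1 * (s * nz1) + 3 / 2 * d ^+ 2 * c2 * (s * nz2)
    + n%:R * (d * tc * (c * h ^+ 2 * ((T'^-1 + 1) * s * n4 + (T'^-1 + 1) * s * n4))))
  <= 4 * (3 / 2 * (ca + cm + c1 + c2) * s + c * s * (1 + 2 * T' * tc * (T'^-1 + 1)))
     * (h ^+ 2 * n4 + d ^+ 2 * (n2 + nz1 + nz2)).
Proof.
move=> ca0 cm0 c10 c20 c0 sq0 T0 tc0 n40 n20 nz10 nz20 nd.
have T10 : 0 <= T'^-1 + 1 by apply: addr_ge0 => //; rewrite invr_ge0 ltW.
have T'0 := ltW T0.
have H0 : 0 <= h ^+ 2 := sqr_ge0 _; have D0 : 0 <= d ^+ 2 := sqr_ge0 _.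
move: (h ^+ 2) (d ^+ 2) (T'^-1 + 1) H0 D0 T10 => h' d' w' H0 D0 T10.
have k0 : 0 <= c * s * (1 + 2 * T' * tc * w').
  by apply: mulr_ge0; [exact: mulr_ge0|apply: addr_ge0 => //; rewrite !mulr_ge0].
have t6 : n%:R * (d * tc * (c * h' * (w' * s * n4 + w' * s * n4))) <=
    T' * (tc * (c * h' * (w' * s * n4 + w' * s * n4))).
  rewrite -[d * _ * _]mulrA [leLHS]mulrA; apply: ler_wpM2r nd.
  by rewrite !(mulr_ge0, addr_ge0).
have fa := final_arith ca0 cm0 c10 c20 sq0 k0 (mulr_ge0 H0 n40) (mulr_ge0 D0 n20)
  (mulr_ge0 D0 nz10) (mulr_ge0 D0 nz20).
rewrite !(mulrDr d'); apply: le_trans fa.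
rewrite ler_pM2l//; apply: le_trans (lerD (lexx _) t6) _.
by rewrite le_eqVlt; apply/orP; left; apply/eqP; ring.
Qed.

Section solution.
Variables (u : R -> R -> R) (z1 z2 : R -> 'cV[R]_r).
Variables (u0 : R -> R) (v0 : Hsp B) (z10 z20 : 'cV[R]_r).
Hypothesis hw : weak_solution S1 S2 T u z1 z2 u0 v0 z10 z20.
Hypothesis hu4 : sobolev X4 0 T 2 u.
Hypothesis hu2 : sobolev X2 0 T 4 u.
Hypotheses (hz1 : sobolev (euclid r) 0 T 3 z1) (hz2 : sobolev (euclid r) 0 T 3 z2).
Local Notation U j := (wdiffn X2 0 T j u).
Local Notation V j := (wdiffn X4 0 T j u).
Local Notation Zd j z := (wdiffn (euclid r) 0 T j z).
Local Notation int2 j s t := (\int[leb]_(x in `]s, t[%classic) nrm (U j x)).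
Local Notation int4 j s t := (\int[leb]_(x in `]s, t[%classic) nrm (V j x)).
Local Notation intz z s t := (\int[leb]_(x in `]s, t[%classic) nrm (Zd 3 z x)).
Local Notation N4 := (sobolev_norm (Hk L 4) 0 T 2 u).
Local Notation N2 := (sobolev_norm (Hk L 2) 0 T 2 (U 2)).
Local Notation NZ z := (sobolev_norm (euclid r) 0 T 1 (Zd 2 z)).
Local Notation M4 := ((T^-1 + 1) * Num.sqrt T * N4).

Section scheme.
Variables (P S : nat) (P0 : (0 < P)%N) (S0 : (0 < S)%N).
Variables (N : nat) (w : 'I_N -> R -> R).
Hypothesis bw : is_basis B P w.
Variables (Un Vn : nat -> 'cV[R]_N) (zn1 zn2 : nat -> 'cV[R]_r).
Local Notation dt := (T / S%:R).
Local Notation h := (L / P%:R).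
Local Notation tm n := (n%:R * dt).
Hypothesis hCN : crank_nicolson B S1 S2 w dt S Un Vn zn1 zn2.
Local Notation err n := (err_state B w (Un n) (Vn n) (u (tm n)) (V 1 (tm n))
  (zn1 n) (z1 (tm n)) (zn2 n) (z2 (tm n))).

Lemma dt_gt0 : 0 < dt.
Proof. by rewrite divr_gt0// ltr0n. Qed.

Lemma tm_itv n : (n <= S)%N -> 0 <= tm n <= T.
Proof.
move=> nS; rewrite mulr_ge0 ?(ltW dt_gt0)//= mulrCA ger_pMr//.
by rewrite ler_pdivrMr ?ltr0n// mul1r ler_nat.
Qed.

Variables (ca cm c1 c2 c : R).
Hypotheses (ca0 : 0 <= ca) (cm0 : 0 <= cm) (c10 : 0 <= c1) (c20 : 0 <= c2) (c0 : 0 <= c).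
Hypotheses (hca : forall v, HT v -> na v <= ca * nrm (v : X2))
  (hcm : forall v, HT v -> nm v <= cm * nrm (v : X2))
  (hc1 : forall x, pnorm (pform S1) x <= c1 * Num.sqrt (dotp x x))
  (hc2 : forall x, pnorm (pform S2) x <= c2 * Num.sqrt (dotp x x))
  (hc : forall v, dom X4 v -> nm (proj B w v - v) <= c * h ^+ 2 * nrm (v : X4)).

(** The two trapezoidal rules see [u_ttt] and [u_tttt], those of the controllers their
    third derivatives. The projection error enters through the increment of the velocity,
    hence through [u_tt] in H^4, and through its traces, hence through the supremum of [u_t]. *)
Lemma step_bound k : (k < S)%N -> nz (err k.+1) <= nz (err k) +
  4 * (3 / 2 * dt ^+ 2 * ca * int2 3 (tm k) (tm k.+1) + 3 / 2 * dt ^+ 2 * cm * int2 4 (tm k) (tm k.+1)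
    + c * h ^+ 2 * int4 2 (tm k) (tm k.+1)
    + 3 / 2 * dt ^+ 2 * c1 * intz z1 (tm k) (tm k.+1) + 3 / 2 * dt ^+ 2 * c2 * intz z2 (tm k) (tm k.+1)
    + dt * trace_cst B S1 S2 * (c * h ^+ 2 * (M4 + M4))).
Proof.
move=> kS; have [CN1 CN2 CN3 CN4] := hCN kS.
have i0 := tm_itv (ltnW kS); have i1 := tm_itv kS.
have dtE : tm k.+1 - tm k = dt by rewrite -mulrBl -natrB// subSnn mul1r.
have st : tm k <= tm k.+1 by rewrite -subr_ge0 dtE ltW// dt_gt0.
have [[s0 _] [_ tT]] := (andP i0, andP i1).
have q0 : 0 <= 3 / 2 * dt ^+ 2 by rewrite mulr_ge0 ?sqr_ge0// divr_ge0.
have e1 t : 0 <= t <= T -> Dx 1 (V 1 t) L = Dx 1 (U 1 t) L.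
  by move=> tT'; exact: (V_U_dual hB hT hu4 (tr1_dual hB) tT').
have e0 t : 0 <= t <= T -> V 1 t L = U 1 t L.
  by move=> tT'; exact: (V_U_dual hB hT hu4 (tr0_dual hB) tT').
have dV t : 0 <= t <= T -> dom X4 (V 1 t) := V_dom hu4 (isT : (1 < 2)%N).
have d0 := dV _ i0; have d1 := dV _ i1.
have ha y : HT y -> dual X2 (fun v => form_a B v y) := form_a_dual hB (y := y).
have hm y : HT y -> dual X2 (fun v => form_m B v y) := form_m_dual hB (y := y).
have cn0 : 0 <= c * h ^+ 2 by rewrite mulr_ge0 ?sqr_ge0.
have iU j (j4 : (j < 4)%N) : 0 <= int2 j.+1 (tm k) (tm k.+1).
  by have [_ bf _] := U_weak hu2 j4; apply: RI_ge0; exact: (RI_nrm_ge0 h2 s0 tT bf).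
have tr_a := fun y dy => form_trap hB hu2 (form_a_psd hB) hca (ha y dy) dy (isT : (0 < 2)%N) s0 st tT.
have tr_m := fun y dy => form_trap hB hu2 (form_m_psd hB) hcm (hm y dy) dy (isT : (1 < 2)%N) s0 st tT.
have tr_1 := control_trap hS1 hz1 c10 hc1 s0 st tT.
have tr_2 := control_trap hS2 hz2 c20 hc2 s0 st tT.
rewrite dtE in tr_1 tr_2.
apply: (step_error hB hS1 hS2 P0 bw dt_gt0 CN1 CN2 CN3 CN4 (U_HT hu2 (isT : (0 < 4)%N) i0)
  (U_HT hu2 (isT : (0 < 4)%N) i1) (Ht4_HT hB d0) (Ht4_HT hB d1)
  (U_HT hu2 (isT : (2 < 4)%N) i0) (U_HT hu2 (isT : (2 < 4)%N) i1) _ _ _ _ _ _ _ _ tr_1 tr_2).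
- by move=> y dy; rewrite (e1 _ i0) (e0 _ i0); exact: (weak_eq_all hB hT hw hu2 hz1 hz2 dy i0).
- by move=> y dy; rewrite (e1 _ i1) (e0 _ i1); exact: (weak_eq_all hB hT hw hu2 hz1 hz2 dy i1).
- by rewrite (e1 _ i0); exact: (control1_eq hB hT hw hu2 hz1 i0).
- by rewrite (e1 _ i1); exact: (control1_eq hB hT hw hu2 hz1 i1).
- by rewrite (e0 _ i0); exact: (control2_eq hB hT hw hu2 hz2 i0).
- by rewrite (e0 _ i1); exact: (control2_eq hB hT hw hu2 hz2 i1).
- move=> y dy; have := tr_a y dy; rewrite dtE.
  by rewrite (V_U_dual hB hT hu4 (ha y dy) i0) (V_U_dual hB hT hu4 (ha y dy) i1).
- move=> y dy; have := tr_m y dy; rewrite dtE.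
  by rewrite (V_U_dual hB hT hu4 (hm y dy) i0) (V_U_dual hB hT hu4 (hm y dy) i1).
- apply: le_trans (hc (lsubB s4 d1 d0)) _; apply: (ler_wpM2l cn0).
  exact: (V_incr hB hu4 s0 st tT).
- apply: le_trans (hc (lsubD s4 d1 d0)) _; apply: (ler_wpM2l cn0).
  apply: le_trans (nrm_tri s4 h4 d1 d0) _.
  exact: (lerD (V_sup hB hT hu4 (isT : (1 < 2)%N) i1) (V_sup hB hT hu4 (isT : (1 < 2)%N) i0)).
- by apply: mulr_ge0 (iU 2 isT); exact: mulr_ge0.
- by apply: mulr_ge0 (iU 3 isT); exact: mulr_ge0.
Qed.

Lemma error_sum n : (n <= S)%N -> nz (err n) <= nz (err 0) +
  4 * (3 / 2 * (ca + cm + c1 + c2) * Num.sqrt T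
       + c * Num.sqrt T * (1 + 2 * T * trace_cst B S1 S2 * (T^-1 + 1)))
  * (h ^+ 2 * N4 + dt ^+ 2 * (N2 + NZ z1 + NZ z2)).
Proof.
move=> nS; have /andP[_ nT] := tm_itv nS.
have sE := @euclid_lsub R r; have hE := @euclid_hilb R r.
have dt0 := ltW dt_gt0.
have tc0 := trace_cst_ge0.
have sq0 : 0 <= Num.sqrt T := sqrtr_ge0 T.
have b23 : \sum_(k < n) int2 3 (tm k) (tm k.+1) <= Num.sqrt T * N2.
  have [_ bf _] := U_weak hu2 (isT : (2 < 4)%N).
  apply: le_trans (sum_int sT h2 dt0 nT bf) _.
  exact: (Ht_int_le L0 hT (isT : (1 < 2)%N) (isT : (1 <= 2)%N) (shift_sobolev (hu2 : sobolev X2 0 T (2 + 2) u))).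
have b24 : \sum_(k < n) int2 4 (tm k) (tm k.+1) <= Num.sqrt T * N2.
  have [_ bf _] := U_weak hu2 (isT : (3 < 4)%N).
  apply: le_trans (sum_int sT h2 dt0 nT bf) _.
  exact: (Ht_int_le L0 hT (isT : (1 < 2)%N) (isT : (2 <= 2)%N) (shift_sobolev (hu2 : sobolev X2 0 T (2 + 2) u))).
have b42 : \sum_(k < n) int4 2 (tm k) (tm k.+1) <= Num.sqrt T * N4.
  have [_ hV] := hu4; have [_ [_ bf _]] := hV 1%N isT.
  apply: le_trans (sum_int s4 h4 dt0 nT bf) _.
  exact: (Ht_int_le L0 hT (isT : (1 < 4)%N) (isT : (2 <= 2)%N) hu4).
have bz z : sobolev (euclid r) 0 T 3 z ->
    \sum_(k < n) intz z (tm k) (tm k.+1) <= Num.sqrt T * NZ z.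
  move=> hz; have [_ hZ] := hz; have [_ [_ bf _]] := hZ 2%N isT.
  apply: le_trans (sum_int sE hE dt0 nT bf) _.
  have := nrm_int_sobolev sE hE (ltW hT) (isT : (1 <= 1)%N) (shift_sobolev (hz : sobolev (euclid r) 0 T (1 + 2) z)).
  by rewrite subr0.
have bz1 := bz _ hz1; have bz2 := bz _ hz2.
have N40 : 0 <= N4 := sqrtr_ge0 _; have N20 : 0 <= N2 := sqrtr_ge0 _.
have NZ1 : 0 <= NZ z1 := sqrtr_ge0 _; have NZ2 : 0 <= NZ z2 := sqrtr_ge0 _.
have H0 : 0 <= h ^+ 2 := sqr_ge0 _; have D0 : 0 <= dt ^+ 2 := sqr_ge0 _.
have T10 : 0 <= T^-1 + 1 by apply: addr_ge0 => //; rewrite invr_ge0 ltW.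
have q0 x : 0 <= x -> 0 <= 3 / 2 * dt ^+ 2 * x.
  by move=> x0; apply: mulr_ge0 x0; apply: mulr_ge0 D0; apply: divr_ge0.
apply: le_trans (@weighted_recursion (fun k => nz (err k)) _ _ _ _ _ S _ _ _ _ _ _ _ _ _ _ _ n
  step_bound nS (q0 _ ca0) (q0 _ cm0) (mulr_ge0 c0 H0) (q0 _ c10) (q0 _ c20)
  b23 b24 b42 bz1 bz2) _.
rewrite lerD2l.
exact: (error_arith h ca0 cm0 c10 c20 c0 sq0 hT tc0 N40 N20 NZ1 NZ2 nT).
Qed.

End scheme.
End solution.
End convergence.

(** * Comparison with the exact solution *)

Section comparison.
Context {R : realType}.
Variable B : beam R.
Hypothesis hB : beam_ok B.
Local Notation L := (bL B).
Local Notation L0 := (bL_gt0 hB).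
Local Notation X2 := (Ht L 2).
Local Notation X4 := (Ht L 4).
Local Notation HT := (dom X2).
Local Notation na := (pnorm (form_a B)).
Local Notation nm := (pnorm (form_m B)).
Local Notation sT := (HT_lsub hB).
Local Notation s4 := (Ht_lsub L0 (isT : (1 < 4)%N)).
Local Notation h4 := (Ht_hilb L0 4).
Local Notation h2 := (Ht_hilb L0 2).
Variables (r : nat) (S1 S2 : controller R r).
Hypotheses (hS1 : controller_ok S1) (hS2 : controller_ok S2).
Local Notation nz := (pnorm (eform B S1 S2)).
Implicit Types (a b : R -> R^o).

Lemma nz_change a b a' b' (x y : 'cV[R]_r) : HT a -> HT b -> HT a' -> HT b' ->
  nz ((a, b), (x, y)) <= nz ((a', b'), (x, y)) + na (a - a') + nm (b - b').
Proof.
move=> da db da' db'; rewrite -addrA.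
have d1 : sdom B (((a', b'), (x, y)) : state r) by split.
have dd1 := lsubB sT da da'; have dd2 := lsubB sT db db'.
have d2 : sdom B (((a - a', b - b'), (0, 0)) : state r) by split.
have -> : ((a, b), (x, y)) = ((a', b'), (x, y)) + ((a - a', b - b'), (0, 0)) :> state r.
  have e (U : zmodType) (p q : U) : p = q + (p - q) by rewrite addrCA subrr addr0.
  change (((a, b), (x, y)) = ((a' + (a - a'), b' + (b - b')), (x + 0, y + 0))).
  by rewrite -!e !addr0.
apply: le_trans (pnorm_tri (sdom_lsub hB r) (eform_psd hB hS1 hS2) d1 d2) _.
apply: lerD; first exact: lexx.
have n1 : 0 <= na (a - a') := sqrtr_ge0 _; have n2 : 0 <= nm (b - b') := sqrtr_ge0 _.
rewrite -ler_sqr ?nnegrE ?sqrtr_ge0 ?addr_ge0//.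
rewrite (pnorm_sqr (eform_psd hB hS1 hS2) d2) /eform /=.
rewrite -(pnorm_sqr (form_a_psd hB) dd1) -(pnorm_sqr (form_m_psd hB) dd2).
rewrite /pform !mulmx0 (lin_on0 (@euclid_lsub R r) (dotp_linr 0)).
have m0 := mulr_ge0 n1 n2; have := sqr_ge0 (na (a - a')); have := sqr_ge0 (nm (b - b')).
by rewrite sqrrD; lra.
Qed.

Variables (T : R) (u : R -> R -> R).
Hypothesis hT : 0 < T.
Hypothesis hu4 : sobolev X4 0 T 2 u.
Hypothesis hu2 : sobolev X2 0 T 4 u.
Variables (P N : nat) (w : 'I_N -> R -> R) (pu : R -> R -> R).
Hypotheses (P0 : (0 < P)%N) (bw : is_basis B P w) (hpu : is_projection B P T u pu).
Local Notation U j := (wdiffn X2 0 T j u).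
Local Notation V j := (wdiffn X4 0 T j u).
Local Notation proj := (proj B w).

Lemma pu_proj t : 0 <= t <= T -> HT (pu t) /\ forall x, 0 <= x <= L -> pu t x = proj (u t) x.
Proof.
move=> tT; have [|Wp ep] := hpu (_ : `[0, T]%classic t); first by rewrite /= in_itv.
have du := U_HT hu2 (isT : (0 < 4)%N) tT.
split; first exact: (Wh_Ht2 hB P0 Wp).
have E wh : Wh B P wh -> form_a B (pu t) wh = form_a B (proj (u t)) wh.
  by move=> Wwh; rewrite ep// (proj_spec hB P0 bw du Wwh).
by move=> x xL; exact: (Wh_uniq hB P0 Wp (proj_Wh hB P0 bw _) E xL).
Qed.

Lemma nrm2_ext a b : HT a -> HT b -> (forall x, 0 <= x <= L -> a x = b x) -> nrm (a - b : X2) = 0.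
Proof.
move=> da db e; have dd := lsubB sT da db; have [c c0 h] := nrm2_upper hB.
apply/eqP; rewrite eq_le (nrm_ge0 h2 dd) andbT; apply: le_trans (h _ dd) _.
by rewrite (en_eq0 hB da db e) mulr0.
Qed.

(** The projection is a bounded operator and so commutes with the weak derivative. The
    projected velocity is continuous, hence it has the value selected at the initial time. *)
Lemma projection_velocity : let put := wdiffn X2 0 T 1 pu in
  HT (put 0) /\ nrm (put 0 - proj (V 1 0) : X2) = 0.
Proof.
move=> put; have T0 : 0 <= (0 : R) <= T by rewrite lexx ltW.
have bp := proj_bop hB P0 bw.
have wp : @weak_deriv R X2 0 T (fun t => proj (u t)) (fun t => proj (U 1 t)).
  exact: (bop_weak sT sT h2 h2 bp (U_weak hu2 (isT : (0 < 4)%N))).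
have nq : @ae_same R X2 0 T (fun t => proj (u t)) pu.
  apply: aeW => t; rewrite /= in_itv/= => /andP[t0 tT].
  have tT' : 0 <= t <= T by rewrite !ltW.
  have [dp ep] := pu_proj tT'; split=> //; first exact: (proj_HT hB P0 bw).
  apply: nrm2_ext => //; first exact: (proj_HT hB P0 bw).
  by move=> x xL; rewrite ep.
have wpu := weak_deriv_same sT h2 nq wp.
have cp : @cont R X2 0 T (fun t => proj (U 1 t)).
  exact: (bop_cont sT sT h2 bp (U_cont hu2 (isT : (1 < 4)%N))).
have [w1 w2] := @wdiff_spec R X2 0 T pu (ex_intro _ _ wpu).
have c1 := w2 (ex_intro _ _ (conj wpu cp)).
have sp := Ht_sep L0 (isT : (0 < 2)%N).
have nput := weak_deriv_uniq sT sp nq wp w1.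
have [d1 d2 n0] := cont_same sT sp hT cp c1 nput T0.
have [e1 e2 n1] := V_U hB hT hu4 T0.
have dp := proj_HT hB P0 bw (V 1 0).
split; first exact: d2.
have n2 : nrm (proj (U 1 0) - proj (V 1 0) : X2) = 0.
  have [_ lp [K hK]] := bp.
  rewrite -(lin_onB lp e2 e1); apply/eqP; rewrite eq_le.
  rewrite (nrm_ge0 h2 (proj_HT hB P0 bw _)) andbT.
  by apply: le_trans (hK _ (lsubB sT e2 e1)) _; rewrite (nrmC sT h2 e2 e1) n1 mulr0.
by rewrite -(nrm_eq sT h2 d1 d2 dp n0).
Qed.

Lemma collect (K c m H d z0 n4 na' n2 nz1 nz2 z e e0 A M M' g1 g2 : R) :
  0 <= K -> 0 <= c -> 0 <= m -> 0 <= H -> 0 <= d -> 0 <= z0 ->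
  0 <= n4 -> 0 <= na' -> 0 <= n2 -> 0 <= nz1 -> 0 <= nz2 ->
  z <= e + A + M -> e <= e0 + K * (H * n4 + d * (n2 + nz1 + nz2)) -> e0 <= z0 + 0 + 0 ->
  A <= c * H * g1 -> g1 <= m * n4 -> M <= M' + 0 -> M' <= c * H * g2 -> g2 <= m * n4 ->
  z <= (1 + K + 2 * c * m) * (z0 + H * n4 + d * (na' + n2 + nz1 + nz2)).
Proof.
move=> K0 c0 m0 H0 d0 z00 n40 na0 n20 nz10 nz20 h1 h3 h5 h6 h7 h8 h9 h10.
have cH := mulr_ge0 c0 H0; have HN := mulr_ge0 H0 n40.
have DX : 0 <= d * (n2 + nz1 + nz2) by rewrite mulr_ge0// !addr_ge0.
have DN := mulr_ge0 d0 na0.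
have a1 := le_trans h6 (ler_wpM2l cH h7); have a2 := le_trans h9 (ler_wpM2l cH h10).
have -> : (1 + K + 2 * c * m) * (z0 + H * n4 + d * (na' + n2 + nz1 + nz2)) =
  z0 + H * n4 + d * na' + d * (n2 + nz1 + nz2)
  + K * (z0 + d * na') + K * (H * n4 + d * (n2 + nz1 + nz2))
  + 2 * c * m * (z0 + d * na' + d * (n2 + nz1 + nz2)) + 2 * (c * H * (m * n4)) by ring.
have p1 : 0 <= K * (z0 + d * na') by rewrite mulr_ge0// addr_ge0.
have p2 : 0 <= 2 * c * m * (z0 + d * na' + d * (n2 + nz1 + nz2)).
  by apply: mulr_ge0; [rewrite !mulr_ge0|rewrite !addr_ge0].
by lra.
Qed.

End comparison.

Theorem theorem9 (R : realType) (B : beam R) (r : nat)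
    (S1 S2 : controller R r) (T : R)
    (hr : (1 <= r)%N) (hB : beam_ok B)
    (hS1 : controller_ok S1) (hS2 : controller_ok S2) (hT : 0 < T) :
  exists C : R,
  forall (u : R -> R -> R) (z1 z2 : R -> 'cV[R]_r)
         (u0 : R -> R) (v0 : Hsp B) (z10 z20 : 'cV[R]_r),
    weak_solution S1 S2 T u z1 z2 u0 v0 z10 z20 ->
    sobolev (Ht (bL B) 4) 0 T 2 u ->
    sobolev (Ht (bL B) 2) 0 T 4 u ->
    sobolev (euclid r) 0 T 3 z1 ->
    sobolev (euclid r) 0 T 3 z2 ->
  forall (P S : nat), (0 < P)%N -> (0 < S)%N ->
  forall (w : 'I_(2 * P) -> R -> R), is_basis B P w ->
  forall (pu : R -> R -> R), is_projection B P T u pu ->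
  forall (U V : nat -> 'cV[R]_(2 * P)) (zn1 zn2 : nat -> 'cV[R]_r),
    let h := bL B / P%:R in
    let dt := T / S%:R in
    let ut := wdiffn (Ht (bL B) 2) 0 T 1 u in
    let utt := wdiffn (Ht (bL B) 2) 0 T 2 u in
    let put := wdiffn (Ht (bL B) 2) 0 T 1 pu in
    crank_nicolson B S1 S2 w dt S U V zn1 zn2 ->
  forall n : nat, (n <= S)%N ->
    let tn := n%:R * dt in
    znorm B S1 S2
      (comb w (U n) \- u tn) (comb w (V n) \- ut tn)
      (zn1 n - z1 tn) (zn2 n - z2 tn)
    <= C *
      (znorm B S1 S2
         (comb w (U 0%N) \- pu 0) (comb w (V 0%N) \- put 0)
         (zn1 0%N - z1 0) (zn2 0%N - z2 0)
       + h ^+ 2 * sobolev_norm (Hk (bL B) 4) 0 T 2 u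
       + dt ^+ 2 *
         (sobolev_norm (Hk (bL B) 4) 0 T 0 utt
          + sobolev_norm (Hk (bL B) 2) 0 T 2 utt
          + sobolev_norm (euclid r) 0 T 1 (wdiffn (euclid r) 0 T 2 z1)
          + sobolev_norm (euclid r) 0 T 1 (wdiffn (euclid r) 0 T 2 z2))).

Proof.
have [ca ca0 hca] := na_le_nrm hB; have [cm cm0 hcm] := nm_le_nrm hB.
have [c1 c10 hc1] := pform_upper S1; have [c2 c20 hc2] := pform_upper S2.
have [c c0 hc] := proj_err_norms hB.
pose K := 4 * (3 / 2 * (ca + cm + c1 + c2) * Num.sqrt T
  + c * Num.sqrt T * (1 + 2 * T * trace_cst B S1 S2 * (T^-1 + 1))).
pose kp := 2 * c * ((T^-1 + 1) * Num.sqrt T).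
exists (1 + K + kp) => u z1 z2 u0 v0 z10 z20 hw hu4 hu2 hz1 hz2 P S P0 S0 w bw pu hpu U V zn1 zn2.
move=> h dt ut utt put CN n nS; cbv zeta; set tn := n%:R * dt.
have L0 := bL_gt0 hB; have sT := HT_lsub hB.
have h2 := Ht_hilb L0 2; have h4 := Ht_hilb L0 4.
have hcP v dv := hc P _ w P0 bw v dv.
pose V1 t := wdiffn (Ht (bL B) 4) 0 T 1 u t.
have tI : 0 <= tn <= T := tm_itv hT S0 nS.
have zI : 0 <= (0 : R) <= T by rewrite lexx ltW.
have cb0 := comb_HT hB P0 bw.
have du t : 0 <= t <= T -> dom (Ht (bL B) 4) (u t) := V_dom hu4 (isT : (0 < 2)%N).
have dv t : 0 <= t <= T -> dom (Ht (bL B) 4) (V1 t) := V_dom hu4 (isT : (1 < 2)%N).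
have combB a b : (comb w (a - b) : R -> R^o) = (comb w a : R -> R^o) - comb w b.
  by rewrite addrC -scaleN1r comb_lin scaleN1r addrC.
have diffE (A p q : R -> R^o) : A - p - (A - q) = q - p by rewrite opprB addrC addrA subrK.
have nm0 v : dom (Ht (bL B) 2) v -> nrm (v : Ht (bL B) 2) = 0 -> pnorm (form_m B) v = 0.
  move=> dv' v0'; apply/eqP; rewrite eq_le sqrtr_ge0 andbT.
  by apply: le_trans (hcm _ dv') _; rewrite v0' mulr0.
have sum := error_sum hB hS1 hS2 hT hw hu4 hu2 hz1 hz2 P0 S0 bw CN ca0 cm0 c10 c20 c0 hca hcm hc1 hc2
  (fun v dv => (hcP v dv).2) nS.
have t00 : 0%:R * (T / S%:R) = 0 :> R by rewrite mul0r.
rewrite t00 in sum.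
have [_ dut nVU] := V_U hB hT hu4 tI.
have [dpu0 epu0] := pu_proj hB hu2 P0 bw hpu zI.
have [dput nput] := projection_velocity hB hT hu4 hu2 P0 bw hpu.
have dun := Ht4_HT hB (du _ tI); have dvn := Ht4_HT hB (dv _ tI).
have dp v := proj_HT hB P0 bw v.
(* At the time considered the projected solution is replaced by the solution itself, at the
   initial time by the given projection and its selected time derivative. *)
have fin := nz_change hB hS1 hS2 (zn1 n - z1 tn) (zn2 n - z2 tn)
  (lsubB sT (cb0 (U n)) dun) (lsubB sT (cb0 (V n)) dut)
  (cb0 (U n - projc B w (u tn))) (cb0 (V n - projc B w (V1 tn))).
have ini := nz_change hB hS1 hS2 (zn1 0%N - z1 0) (zn2 0%N - z2 0)
  (cb0 (U 0%N - projc B w (u 0))) (cb0 (V 0%N - projc B w (V1 0)))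
  (lsubB sT (cb0 (U 0%N)) dpu0) (lsubB sT (cb0 (V 0%N)) dput).
have zE := znormE S1 S2 (zn1 n - z1 tn) (zn2 n - z2 tn)
  (lsubB sT (cb0 (U n)) dun) (lsubB sT (cb0 (V n)) dut).
have iE := znormE S1 S2 (zn1 0%N - z1 0) (zn2 0%N - z2 0)
  (lsubB sT (cb0 (U 0%N)) dpu0) (lsubB sT (cb0 (V 0%N)) dput).
have i1 := na_ext hB dpu0 (dp (u 0)) epu0.
have i2 := nm0 _ (lsubB sT dput (dp (V1 0))) nput.
have f1 := (hcP _ (du _ tI)).1; have f2 := (hcP _ (dv _ tI)).2.
have f3 := nm0 _ (lsubB sT dvn dut) nVU.
have f4 := pnorm_tri sT (form_m_psd hB) (lsubB sT (dp (V1 tn)) dvn) (lsubB sT dvn dut).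
have b1 := V_sup hB hT hu4 (isT : (0 < 2)%N) tI; have b2 := V_sup hB hT hu4 (isT : (1 < 2)%N) tI.
have g1 : pnorm (form_a B) ((comb w (U n) : R -> R^o) - u tn - comb w (U n - projc B w (u tn)))
    = pnorm (form_a B) (proj B w (u tn) - u tn) by rewrite combB diffE.
have g2 : pnorm (form_m B) ((comb w (V n) : R -> R^o) - wdiffn (Ht (bL B) 2) 0 T 1 u tn
      - comb w (V n - projc B w (V1 tn)))
    = pnorm (form_m B) (proj B w (V1 tn) - V1 tn + (V1 tn - wdiffn (Ht (bL B) 2) 0 T 1 u tn)).
  by rewrite combB diffE addrA subrK.
have g3 : pnorm (form_a B) ((comb w (U 0%N - projc B w (u 0)) : R -> R^o)
    - ((comb w (U 0%N) : R -> R^o) - pu 0)) = 0 by rewrite combB diffE.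
have g4 : pnorm (form_m B) ((comb w (V 0%N - projc B w (V1 0)) : R -> R^o)
    - ((comb w (V 0%N) : R -> R^o) - wdiffn (Ht (bL B) 2) 0 T 1 pu 0)) = 0 by rewrite combB diffE.
rewrite g1 g2 in fin; rewrite g3 g4 in ini; rewrite f3 in f4; rewrite -zE in fin; rewrite -iE in ini.
have K0 : 0 <= K.
  have tc0 := trace_cst_ge0 hB hS1 hS2; have s0 := sqrtr_ge0 T.
  have Ti : 0 <= T^-1 + 1 by apply: addr_ge0 => //; rewrite invr_ge0 ltW.
  have T2 : 0 <= 2 * T * trace_cst B S1 S2 * (T^-1 + 1).
    by apply: mulr_ge0 Ti; apply: mulr_ge0 tc0; apply: mulr_ge0 => //; exact: ltW.
  apply: mulr_ge0 => //; apply: addr_ge0.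
    by apply: mulr_ge0 s0; apply: mulr_ge0; [exact: divr_ge0|rewrite !addr_ge0].
  by apply: mulr_ge0; [exact: mulr_ge0|exact: addr_ge0].
have m0 : 0 <= (T^-1 + 1) * Num.sqrt T.
  by apply: mulr_ge0; [apply: addr_ge0 => //; rewrite invr_ge0 ltW|exact: sqrtr_ge0].
exact: (collect K0 c0 m0 (sqr_ge0 h) (sqr_ge0 dt) (sqrtr_ge0 _) (sqrtr_ge0 _) (sqrtr_ge0 _) (sqrtr_ge0 _)
  (sqrtr_ge0 _) (sqrtr_ge0 _) fin sum ini f1 b1 f4 f2 b2).
Qed.
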